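(* For each integer $m\ge 0$ let $F_m(s)=\sum_{j=0}^m \frac{a_{m,j}B_j}{s+j-1}$ and $h_m=\sum_{j=1}^m 1/j$. Then \[ h_m^{s-1}(s-1)F_m(s)\ \longrightarrow\ (s-1)\Gamma(s)\zeta(s) \] as $m\to\infty$, locally uniformly on the half-plane $\{s:\Re s>0\}$ (at $s=1$ both sides are understood as their holomorphic extensions, i.e. the residues: the left side equals $1$ and the right side equals $1$ there).
   Context: For an integer $m\ge0$, $p_m(t)=(1-t)(1-t/2)\cdots(1-t/m)$ (with $p_0\equiv1$), and the coefficients $a_{m,j}$ are defined by $p_m(t)=\sum_{j=0}^m(-1)^j a_{m,j}t^j$. The $B_j$ are the Bernoulli numbers defined by $\frac{z}{e^z-1}=\sum_{j\ge0}\frac{B_j}{j!}z^j$. $\Gamma$ is the Gamma function and $\zeta$ the Riemann zeta function. *)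

(* Defs.v *)
From Stdlib Require Import Reals Factorial Lra Lia Psatz.
From Coquelicot Require Import Coquelicot.

Open Scope R_scope.

Definition Cexp (z : C) : C :=
  (exp (Re z) * cos (Im z), exp (Re z) * sin (Im z)).

(* [r ^ s] for a real base [r > 0], with the real logarithm of [r]. *)
Definition Cpow_pos (r : R) (s : C) : C := Cexp (s * RtoC (ln r))%C.

Fixpoint p (m : nat) (t : R) : R :=
  match m with
  | O => 1
  | S k => p k t * (1 - t / INR (S k))
  end.

Definition p_coefficients (a : nat -> nat -> R) : Prop :=
  forall (m : nat) (t : R), p m t = sum_n (fun j => (-1) ^ j * a m j * t ^ j) m.

(* [z = 0] is excluded because [0 / 0 = 0] for [Rdiv]. *)
Definition bernoulli_numbers (B : nat -> R) : Prop :=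
  exists r : posreal, forall z : R, 0 < Rabs z < r ->
    is_pseries (fun j => B j / INR (fact j)) z (z / (exp z - 1)).

Definition harmonic (m : nat) : R := sum_n_m (fun j => / INR j) 1 m.

Definition F (a : nat -> nat -> R) (B : nat -> R) (m : nat) (s : C) : C :=
  sum_n (fun j => RtoC (a m j * B j) / (s + INR j - 1))%C m.

Definition half_plane (s : C) : Prop := 0 < Re s.

(* Euler's integral; it converges exactly on the half-plane [0 < Re s]. *)
Definition Gamma (s : C) : C :=
  RInt_gen (V := C_R_CompleteNormedModule)
    (fun t : R => (Cpow_pos t (s - 1) * RtoC (exp (- t)))%C)
    (at_right 0) (Rbar_locally p_infty).

Definition C_Lim_seq (u : nat -> C) : C :=
  (real (Lim_seq (fun n => Re (u n))), real (Lim_seq (fun n => Im (u n)))).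

Definition zeta_approx (s : C) (N : nat) : C :=
  (sum_n_m (fun n => Cpow_pos (INR n) (- s)) 1 N
   - Cpow_pos (INR N) (1 - s) / (1 - s))%C.

(* The Riemann zeta function on the half-plane [0 < Re s], [s <> 1]. That this
   limit is the analytic continuation of the Dirichlet series is proved below:
   see [zeta_dirichlet] and [zeta_holomorphic]. *)
Definition zeta (s : C) : C := C_Lim_seq (zeta_approx s).

(* The function [f] with its value at [s = 1] replaced by [1]. *)
Definition extend_at_1 (f : C -> C) (s : C) : C :=
  if Ceq_dec s (RtoC 1) then RtoC 1 else f s.

Definition cvg_locally_uniformly (D : C -> Prop) (f : nat -> C -> C)
    (g : C -> C) : Prop :=
  forall s0 : C, D s0 -> exists delta : posreal, forall eps : posreal,
    eventually (fun m => forall s : C, D s -> Cmod (s - s0) < delta ->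
      Cmod (f m s - g s) < eps).

Lemma Cexp_0 : Cexp 0 = RtoC 1.
Proof.
  unfold Cexp; simpl. rewrite exp_0, cos_0, sin_0. unfold RtoC. f_equal; ring.
Qed.

Lemma Cexp_plus (x y : C) : Cexp (x + y) = (Cexp x * Cexp y)%C.
Proof.
  destruct x as [a b], y as [c d]. unfold Cexp, Cplus, Cmult; simpl.
  rewrite exp_plus, cos_plus, sin_plus. f_equal; ring.
Qed.

Lemma Cmod_Cexp (z : C) : Cmod (Cexp z) = exp (Re z).
Proof.
  unfold Cmod, Cexp; simpl fst; simpl snd.
  replace (_ + _) with ((exp (Re z)) ^ 2).
  - apply sqrt_pow2. left. apply exp_pos.
  - pose proof (sin2_cos2 (Im z)) as H. unfold Rsqr in H.
    replace ((exp (Re z)) ^ 2) with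
      ((exp (Re z)) ^ 2 * (sin (Im z) * sin (Im z) + cos (Im z) * cos (Im z)))
      by (rewrite H; ring).
    ring.
Qed.

Lemma Re_mult_R (z : C) (x : R) : Re (z * RtoC x) = Re z * x.
Proof. destruct z; unfold RtoC, Cmult; simpl; ring. Qed.

Lemma Im_mult_R (z : C) (x : R) : Im (z * RtoC x) = Im z * x.
Proof. destruct z; unfold RtoC, Cmult; simpl; ring. Qed.

Lemma Cmod_Cpow_pos (r : R) (s : C) : Cmod (Cpow_pos r s) = exp (Re s * ln r).
Proof. unfold Cpow_pos. rewrite Cmod_Cexp, Re_mult_R. reflexivity. Qed.

Lemma Cpow_pos_plus (r : R) (s t : C) :
  Cpow_pos r (s + t) = (Cpow_pos r s * Cpow_pos r t)%C.
Proof.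
  unfold Cpow_pos. rewrite <- Cexp_plus. f_equal. ring.
Qed.

Lemma Cpow_pos_1 (r : R) : 0 < r -> Cpow_pos r 1 = RtoC r.
Proof.
  intros Hr. unfold Cpow_pos, Cexp. rewrite Re_mult_R, Im_mult_R; simpl.
  rewrite Rmult_0_l, Rmult_1_l, cos_0, sin_0, exp_ln by assumption.
  unfold RtoC; f_equal; ring.
Qed.

Lemma Cmod_le_2 (z : C) (e : R) :
  Rabs (Re z) <= e -> Rabs (Im z) <= e -> Cmod z <= 2 * e.
Proof.
  intros H1 H2. pose proof (Cmod_2Rmax z) as H.
  assert (Hm : Rmax (Rabs (fst z)) (Rabs (snd z)) <= e)
    by (apply Rmax_lub; assumption).
  assert (0 <= e) by (pose proof (Rabs_pos (Re z)); lra).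
  assert (sqrt 2 <= 2).
  { rewrite <- (sqrt_pow2 2) at 2 by lra. apply sqrt_le_1; lra. }
  pose proof (sqrt_pos 2). nra.
Qed.

Lemma im_le_Cmod (z : C) : Rabs (Im z) <= Cmod z.
Proof.
  eapply Rle_trans; [apply Rmax_r | apply Rmax_Cmod].
Qed.

(* Componentwise derivative of a complex function of a real variable. *)
Definition is_Rderive (g : R -> C) (x : R) (l : C) : Prop :=
  is_derive (fun x => Re (g x)) x (Re l) /\
  is_derive (fun x => Im (g x)) x (Im l).

Lemma is_Rderive_eq (g : R -> C) (x : R) (l l' : C) :
  is_Rderive g x l -> l = l' -> is_Rderive g x l'.
Proof. intros H <-; exact H. Qed.

Lemma is_Rderive_ext (f g : R -> C) (x : R) (l : C) :
  (forall x, f x = g x) -> is_Rderive f x l -> is_Rderive g x l.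
Proof.
  intros E [H1 H2]; split; eapply is_derive_ext; eauto; intros; simpl; now rewrite E.
Qed.

Lemma is_Rderive_const (c : C) (x : R) : is_Rderive (fun _ => c) x 0.
Proof. split; simpl; auto_derive; auto. Qed.

Lemma is_Rderive_plus (f g : R -> C) (x : R) (l l' : C) :
  is_Rderive f x l -> is_Rderive g x l' ->
  is_Rderive (fun x => f x + g x)%C x (l + l')%C.
Proof.
  intros [H1 H2] [H3 H4]; split; simpl.
  - apply (is_derive_plus _ _ _ _ _ H1 H3).
  - apply (is_derive_plus _ _ _ _ _ H2 H4).
Qed.

Lemma is_Rderive_mult (f g : R -> C) (x : R) (l l' : C) :
  is_Rderive f x l -> is_Rderive g x l' ->
  is_Rderive (fun x => f x * g x)%C x (l * g x + f x * l')%C.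
Proof.
  intros [H1 H2] [H3 H4]; split; simpl.
  - apply (is_derive_ext (fun x => Re (f x) * Re (g x) - Im (f x) * Im (g x))).
    { reflexivity. }
    eapply filterdiff_ext_lin.
    + apply (is_derive_minus (fun x => Re (f x) * Re (g x)) (fun x => Im (f x) * Im (g x))).
      * apply (is_derive_mult _ _ x _ _ H1 H3 Rmult_comm).
      * apply (is_derive_mult _ _ x _ _ H2 H4 Rmult_comm).
    + intros y. unfold scal, minus, plus, opp, mult; simpl.
      unfold mult, plus, opp; simpl. unfold Re, Im. ring.
  - apply (is_derive_ext (fun x => Re (f x) * Im (g x) + Im (f x) * Re (g x))).
    { reflexivity. }
    eapply filterdiff_ext_lin.
    + apply (is_derive_plus (fun x => Re (f x) * Im (g x)) (fun x => Im (f x) * Re (g x))).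
      * apply (is_derive_mult _ _ x _ _ H1 H4 Rmult_comm).
      * apply (is_derive_mult _ _ x _ _ H2 H3 Rmult_comm).
    + intros y. unfold scal, plus, mult; simpl.
      unfold mult, plus; simpl. unfold Re, Im. ring.
Qed.

Lemma is_Rderive_RtoC (f : R -> R) (x l : R) :
  is_derive f x l -> is_Rderive (fun x => RtoC (f x)) x (RtoC l).
Proof. intros H; split; simpl; [exact H | auto_derive; auto]. Qed.

Lemma is_Rderive_Cexp (z : C) (x : R) :
  is_Rderive (fun t => Cexp (z * RtoC t)) x (z * Cexp (z * RtoC x))%C.
Proof.
  destruct z as [a b]. split; unfold Cexp, RtoC, Cmult; simpl; auto_derive; auto; unfold Rminus; ring.
Qed.

Lemma is_Rderive_Cpow_pos (s : C) (x : R) : 0 < x ->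
  is_Rderive (fun t => Cpow_pos t s) x (s * RtoC (/ x) * Cpow_pos x s)%C.
Proof.
  intros Hx. destruct s as [a b].
  split; unfold Cpow_pos, Cexp, RtoC, Cmult; simpl; auto_derive; auto; unfold Rminus; field; lra.
Qed.

Lemma mean_value_R (g dg f df : R -> R) (a b : R) : a <= b ->
  (forall x, a <= x <= b -> is_derive g x (dg x)) ->
  (forall x, a <= x <= b -> is_derive f x (df x)) ->
  (forall x, a <= x <= b -> Rabs (dg x) <= df x) ->
  Rabs (g b - g a) <= f b - f a.
Proof.
  intros Hab Hg Hf Hd.
  assert (H : forall e, e = 1 \/ e = -1 -> 0 <= (f b + e * g b) - (f a + e * g a)).
  { intros e He.
    assert (D : forall x, a <= x <= b ->
      is_derive (fun x => f x + e * g x) x (df x + e * dg x)).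
    { intros x Hx. apply (is_derive_plus f (fun x => e * g x)).
      - now apply Hf.
      - apply (is_derive_scal g x e). now apply Hg. }
    destruct (MVT_gen (fun x => f x + e * g x) a b (fun x => df x + e * dg x))
      as [c [Hc E]].
    - rewrite Rmin_left, Rmax_right by assumption. intros; apply D; lra.
    - rewrite Rmin_left, Rmax_right by assumption. intros x Hx.
      apply continuity_pt_filterlim. apply (ex_derive_continuous (fun x => f x + e * g x)).
      eexists; apply D; lra.
    - rewrite Rmin_left, Rmax_right in Hc by assumption. rewrite E.
      apply Rmult_le_pos; [|lra]. specialize (Hd c Hc).
      apply Rabs_le_between in Hd. destruct He; subst; lra. }
  pose proof (H 1 (or_introl eq_refl)). pose proof (H (-1) (or_intror eq_refl)).
  apply Rabs_le_between. lra.
Qed.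

Lemma mean_value_C (g dg : R -> C) (f df : R -> R) (a b : R) : a <= b ->
  (forall x, a <= x <= b -> is_Rderive g x (dg x)) ->
  (forall x, a <= x <= b -> is_derive f x (df x)) ->
  (forall x, a <= x <= b -> Cmod (dg x) <= df x) ->
  Cmod (g b - g a) <= 2 * (f b - f a).
Proof.
  intros Hab Hg Hf Hd. apply Cmod_le_2.
  - apply (mean_value_R (fun x => Re (g x)) (fun x => Re (dg x)) f df); auto.
    + intros x Hx; apply (Hg x Hx).
    + intros x Hx. eapply Rle_trans; [apply re_le_Cmod | auto].
  - apply (mean_value_R (fun x => Im (g x)) (fun x => Im (dg x)) f df); auto.
    + intros x Hx; apply (Hg x Hx).
    + intros x Hx. eapply Rle_trans; [apply im_le_Cmod | auto].
Qed.

Lemma Cmod_Cexp_le (w : C) : Cmod (Cexp w) <= exp (Cmod w).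
Proof.
  rewrite Cmod_Cexp. pose proof (re_le_Cmod w) as H. apply Rabs_le_between in H.
  destruct (Rle_lt_or_eq_dec (Re w) (Cmod w)) as [H1|H1]; [lra | |].
  - left; now apply exp_increasing.
  - rewrite H1; lra.
Qed.

Lemma exp_le (x y : R) : x <= y -> exp x <= exp y.
Proof.
  intros [H | ->]; [left; now apply exp_increasing | lra].
Qed.

Lemma Cexp_taylor0 (w : C) : Cmod (Cexp w - 1) <= 2 * (Cmod w * exp (Cmod w)).
Proof.
  pose proof (Cmod_ge_0 w) as Hw.
  replace (Cexp w - 1)%C with (Cexp (w * RtoC 1) - Cexp (w * RtoC 0))%C
    by (rewrite Cmult_1_r, Cmult_0_r, Cexp_0; reflexivity).
  replace (Cmod w * exp (Cmod w))
    with (Cmod w * exp (Cmod w) * 1 - Cmod w * exp (Cmod w) * 0) by ring.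
  apply (mean_value_C (fun t => Cexp (w * RtoC t)) (fun t => w * Cexp (w * RtoC t))%C
    (fun t => Cmod w * exp (Cmod w) * t) (fun _ => Cmod w * exp (Cmod w))); [lra | | |].
  - intros; apply is_Rderive_Cexp.
  - intros; auto_derive; auto; ring.
  - intros t Ht. rewrite Cmod_mult. apply Rmult_le_compat_l; auto.
    eapply Rle_trans; [apply Cmod_Cexp_le|]. apply exp_le.
    rewrite Cmod_mult, Cmod_R, Rabs_right by lra. nra.
Qed.

Lemma Cexp_taylor1 (w : C) :
  Cmod (Cexp w - 1 - w) <= 4 * (Cmod w ^ 2 * exp (Cmod w)).
Proof.
  pose proof (Cmod_ge_0 w) as Hw.
  replace (Cexp w - 1 - w)%C with
    ((Cexp (w * RtoC 1) + - w * RtoC 1) - (Cexp (w * RtoC 0) + - w * RtoC 0))%C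
    by (rewrite !Cmult_1_r, !Cmult_0_r, Cexp_0; ring).
  set (K := 2 * (Cmod w ^ 2 * exp (Cmod w))).
  replace (4 * _) with (2 * (K * 1 - K * 0)) by (unfold K; ring).
  apply (mean_value_C (fun t => Cexp (w * RtoC t) + - w * RtoC t)%C
    (fun t => w * Cexp (w * RtoC t) + (0 * RtoC t + - w * RtoC 1))%C
    (fun t => K * t) (fun _ => K)); [lra | | |].
  - intros; apply is_Rderive_plus; [apply is_Rderive_Cexp|].
    apply is_Rderive_mult; [apply is_Rderive_const |].
    apply is_Rderive_RtoC. auto_derive; auto.
  - intros; auto_derive; auto; ring.
  - intros t Ht.
    replace (_ + _)%C with (w * (Cexp (w * RtoC t) - 1))%C by ring.
    rewrite Cmod_mult.
    pose proof (Cexp_taylor0 (w * RtoC t)) as H.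
    rewrite Cmod_mult, Cmod_R, Rabs_right in H by lra.
    assert (E : exp (Cmod w * t) <= exp (Cmod w)) by (apply exp_le; nra).
    pose proof (exp_pos (Cmod w * t)).
    assert (Cmod w * t * exp (Cmod w * t) <= Cmod w * exp (Cmod w)).
    { apply Rmult_le_compat; try nra. }
    unfold K. replace (2 * (Cmod w ^ 2 * exp (Cmod w)))
      with (Cmod w * (2 * (Cmod w * exp (Cmod w)))) by ring.
    apply Rmult_le_compat_l; lra.
Qed.

Lemma Ccvg_incr (u : nat -> C) (K : R) (t : nat -> R) : 0 <= K ->
  (forall N, 0 <= t N) -> (forall N, t (S N) <= t N) ->
  (forall N, Cmod (u (S N) - u N) <= K * (t N - t (S N))) ->
  forall N M, (N <= M)%nat -> Cmod (u M - u N) <= K * (t N - t M).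
Proof.
  intros HK Ht Hd Hu N M H. induction H as [|M H IH].
  - replace (u N - u N)%C with (RtoC 0) by ring. rewrite Cmod_0. lra.
  - replace (u (S M) - u N)%C with ((u (S M) - u M) + (u M - u N))%C by ring.
    eapply Rle_trans; [apply Cmod_triangle|]. specialize (Hu M). lra.
Qed.

Definition Ccvg (u : nat -> C) (l : C) : Prop :=
  is_lim_seq (fun n => Re (u n)) (Re l) /\ is_lim_seq (fun n => Im (u n)) (Im l).

Lemma Ccvg_cauchy (u : nat -> C) (K : R) (t : nat -> R) : 0 <= K ->
  (forall N, 0 <= t N) -> (forall N, t (S N) <= t N) ->
  (forall N, Cmod (u (S N) - u N) <= K * (t N - t (S N))) ->
  exists l, Ccvg u l.
Proof.
  intros HK Ht Hd Hu.
  assert (Ct : ex_lim_seq_cauchy t).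
  { apply ex_lim_seq_cauchy_corr. apply (ex_finite_lim_seq_decr t 0); auto. }
  assert (H : forall eps : posreal, exists N, forall n m, (N <= n)%nat -> (N <= m)%nat ->
    Cmod (u n - u m) < eps).
  { intros eps.
    assert (He : 0 < eps / (K + 1)) by (apply Rdiv_lt_0_compat; [apply cond_pos | lra]).
    destruct (Ct (mkposreal _ He)) as [N HN]. exists N.
    assert (W : forall n m, (N <= n)%nat -> (n <= m)%nat -> Cmod (u m - u n) < eps).
    { intros n m H1 H2. pose proof (Ccvg_incr u K t HK Ht Hd Hu n m H2) as H3.
      assert (H4 : Rabs (t n - t m) < eps / (K + 1)) by (apply HN; lia).
      apply Rabs_def2 in H4. destruct H4 as [H4 _].
      apply Rle_lt_trans with (K * (eps / (K + 1))).
      - eapply Rle_trans; [apply H3|]. apply Rmult_le_compat_l; lra.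
      - apply Rlt_le_trans with ((K + 1) * (eps / (K + 1))); [nra|].
        right. field. lra. }
    intros n m H1 H2. destruct (Nat.le_gt_cases n m) as [L|L].
    - replace (u n - u m)%C with (- (u m - u n))%C by ring. rewrite Cmod_opp. auto.
    - apply W; lia. }
  assert (Hre : ex_finite_lim_seq (fun n => Re (u n))).
  { apply ex_lim_seq_cauchy_corr. intros eps. destruct (H eps) as [N HN]. exists N.
    intros n m H1 H2. eapply Rle_lt_trans; [|apply (HN n m H1 H2)].
    apply (re_le_Cmod (u n - u m)). }
  assert (Him : ex_finite_lim_seq (fun n => Im (u n))).
  { apply ex_lim_seq_cauchy_corr. intros eps. destruct (H eps) as [N HN]. exists N.
    intros n m H1 H2. eapply Rle_lt_trans; [|apply (HN n m H1 H2)].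
    apply (im_le_Cmod (u n - u m)). }
  destruct Hre as [a Ha], Him as [b Hb]. exists (a, b). split; assumption.
Qed.

Lemma Ccvg_plus (u v : nat -> C) (l m : C) :
  Ccvg u l -> Ccvg v m -> Ccvg (fun n => u n + v n)%C (l + m)%C.
Proof.
  intros [A B] [A' B']; split; simpl.
  - apply (is_lim_seq_plus' _ _ _ _ A A').
  - apply (is_lim_seq_plus' _ _ _ _ B B').
Qed.

Lemma Ccvg_mult_l (c : C) (u : nat -> C) (l : C) :
  Ccvg u l -> Ccvg (fun n => c * u n)%C (c * l)%C.
Proof.
  intros [A B]; split; simpl.
  - apply is_lim_seq_minus'; apply (is_lim_seq_scal_l _ _ (Finite _)); assumption.
  - apply is_lim_seq_plus'; apply (is_lim_seq_scal_l _ _ (Finite _)); assumption.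
Qed.

Lemma Ccvg_ext (u v : nat -> C) (l : C) :
  (forall n, u n = v n) -> Ccvg u l -> Ccvg v l.
Proof.
  intros E [A B]; split; (eapply is_lim_seq_ext; [|eassumption]);
    intros n; simpl; now rewrite E.
Qed.

Lemma Ccvg_bound (u : nat -> C) (l : C) (b : R) :
  Ccvg u l -> (forall n, Cmod (u n) <= b) -> Cmod l <= 2 * b.
Proof.
  intros [A B] H. apply Cmod_le_2.
  - apply (is_lim_seq_le (fun n => Rabs (Re (u n))) (fun _ => b) (Rabs (Re l)) b).
    + intros n. eapply Rle_trans; [apply re_le_Cmod | apply H].
    + apply (is_lim_seq_abs _ _ A).
    + apply is_lim_seq_const.
  - apply (is_lim_seq_le (fun n => Rabs (Im (u n))) (fun _ => b) (Rabs (Im l)) b).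
    + intros n. eapply Rle_trans; [apply im_le_Cmod | apply H].
    + apply (is_lim_seq_abs _ _ B).
    + apply is_lim_seq_const.
Qed.

Lemma Ccvg_Lim (u : nat -> C) (l : C) :
  Ccvg (fun n => u (S n)) l -> C_Lim_seq u = l.
Proof.
  intros [A B]. unfold C_Lim_seq.
  apply (is_lim_seq_incr_1 (fun n => Re (u n))) in A.
  apply (is_lim_seq_incr_1 (fun n => Im (u n))) in B.
  rewrite (is_lim_seq_unique _ _ A), (is_lim_seq_unique _ _ B).
  destruct l; reflexivity.
Qed.

(* [step n s (n + 1)] is the increment of [(1 - s) * zeta_approx s] at [n];
   [step' n s] is its derivative with respect to [s]. *)
Definition step (n : R) (s : C) (x : R) : C :=
  (Cpow_pos n (1 - s) - Cpow_pos x (1 - s)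
   + (1 - s) * RtoC (x - n) * Cpow_pos x (- s))%C.

Definition step' (n : R) (s : C) (x : R) : C :=
  (- RtoC (ln n) * Cpow_pos n (1 - s) + RtoC (ln x) * Cpow_pos x (1 - s)
   - RtoC (x - n) * Cpow_pos x (- s)
   - (1 - s) * RtoC (x - n) * RtoC (ln x) * Cpow_pos x (- s))%C.

Lemma Cpow_pos_1s (x : R) (s : C) : 0 < x ->
  Cpow_pos x (1 - s) = (RtoC x * Cpow_pos x (- s))%C.
Proof.
  intros Hx. unfold Cminus. rewrite Cpow_pos_plus, Cpow_pos_1; auto.
Qed.

Lemma is_Rderive_opp (f : R -> C) (x : R) (l : C) :
  is_Rderive f x l -> is_Rderive (fun x => - f x)%C x (- l)%C.
Proof.
  intros [A B]; split; simpl.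
  - apply (is_derive_opp _ _ _ A).
  - apply (is_derive_opp _ _ _ B).
Qed.

Lemma RtoC_neq_0 (x : R) : x <> 0 -> RtoC x <> 0%C.
Proof. intros H E. apply H. now injection E. Qed.

Lemma is_Rderive_step (n : R) (s : C) (x : R) : 0 < x ->
  is_Rderive (step n s) x
    (- (s * (1 - s)) * RtoC ((x - n) / x) * Cpow_pos x (- s))%C.
Proof.
  intros Hx. unfold step. eapply is_Rderive_eq.
  - apply is_Rderive_plus.
    + apply is_Rderive_plus; [apply is_Rderive_const|].
      apply is_Rderive_opp, is_Rderive_Cpow_pos, Hx.
    + apply is_Rderive_mult.
      * apply is_Rderive_mult; [apply is_Rderive_const|].
        apply is_Rderive_RtoC with (l := 1). auto_derive; auto; ring.
      * apply is_Rderive_Cpow_pos, Hx.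
  - cbv beta. rewrite !Cpow_pos_1s by assumption. rewrite RtoC_div, RtoC_minus, RtoC_inv by lra.
    field. apply RtoC_neq_0; lra.
Qed.

Lemma is_Rderive_step' (n : R) (s : C) (x : R) : 0 < x ->
  is_Rderive (step' n s) x
    (- ((1 - 2 * s) - RtoC (ln x) * (s * (1 - s))) * RtoC ((x - n) / x)
     * Cpow_pos x (- s))%C.
Proof.
  intros Hx. unfold step'.
  assert (Hl : is_Rderive (fun x => RtoC (ln x)) x (RtoC (/ x))).
  { apply is_Rderive_RtoC. auto_derive; auto; field; lra. }
  assert (Hi : is_Rderive (fun x => RtoC (x - n)) x (RtoC 1)).
  { apply is_Rderive_RtoC. auto_derive; auto; ring. }
  eapply is_Rderive_eq.
  - apply is_Rderive_plus; [apply is_Rderive_plus; [apply is_Rderive_plus|]|].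
    + apply is_Rderive_const.
    + apply is_Rderive_mult; [apply Hl | apply is_Rderive_Cpow_pos, Hx].
    + apply is_Rderive_opp, is_Rderive_mult; [apply Hi | apply is_Rderive_Cpow_pos, Hx].
    + apply is_Rderive_opp, is_Rderive_mult; [|apply is_Rderive_Cpow_pos, Hx].
      apply is_Rderive_mult; [|apply Hl].
      apply is_Rderive_mult; [apply is_Rderive_const | apply Hi].
  - cbv beta. rewrite !Cpow_pos_1s by assumption. rewrite RtoC_div, RtoC_minus, RtoC_inv by lra.
    field. apply RtoC_neq_0; lra.
Qed.

Lemma tail_bound (g dg : R -> C) (n K tau : R) : 1 <= n -> 0 <= K -> 0 < tau ->
  (forall x, n <= x <= n + 1 -> is_Rderive g x (dg x)) ->
  (forall x, n <= x <= n + 1 -> Cmod (dg x) <= K * tau / x * exp (- tau * ln x)) ->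
  Cmod (g (n + 1) - g n) <= 2 * K * (exp (- tau * ln n) - exp (- tau * ln (n + 1))).
Proof.
  intros Hn HK Ht Hg Hb.
  replace (2 * K * _) with
    (2 * (- K * exp (- tau * ln (n + 1)) - - K * exp (- tau * ln n))) by ring.
  apply (mean_value_C g dg (fun x => - K * exp (- tau * ln x))
    (fun x => K * tau / x * exp (- tau * ln x))); auto; [lra|].
  intros x Hx. auto_derive; [lra|]. field. lra.
Qed.

Lemma log_bound (tau : R) : 0 < tau ->
  exists M, 0 < M /\ forall L, 0 <= L -> (1 + L) ^ 2 <= M * exp (tau * L).
Proof.
  intros Ht. set (c := Rmin 1 (tau / 2)).
  assert (Hc : 0 < c) by (unfold c; apply Rmin_glb_lt; lra).
  assert (Hc1 : c <= 1) by apply Rmin_l.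
  assert (Hc2 : c <= tau / 2) by apply Rmin_r.
  exists (/ c ^ 2). split; [apply Rinv_0_lt_compat; nra|].
  intros L HL.
  assert (H1 : 1 + tau / 2 * L <= exp (tau / 2 * L)).
  { destruct (Req_dec L 0) as [->|H]; [rewrite Rmult_0_r, exp_0; lra|].
    left. apply exp_ineq1. nra. }
  assert (H2 : c * (1 + L) <= exp (tau / 2 * L)) by nra.
  replace (tau * L) with (tau / 2 * L + tau / 2 * L) by field.
  rewrite exp_plus.
  apply Rmult_le_reg_l with (c ^ 2); [nra|].
  replace (c ^ 2 * (/ c ^ 2 * _)) with (exp (tau / 2 * L) * exp (tau / 2 * L))
    by (field; lra).
  replace (c ^ 2 * (1 + L) ^ 2) with ((c * (1 + L)) * (c * (1 + L))) by ring.
  assert (0 <= c * (1 + L)) by nra. nra.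
Qed.

Lemma ln_nonneg (x : R) : 1 <= x -> 0 <= ln x.
Proof.
  intros [H | <-]; [|rewrite ln_1; lra].
  left. rewrite <- ln_1. apply ln_increasing; lra.
Qed.

Lemma frac_bound (n x : R) : 1 <= n -> n <= x <= n + 1 ->
  Cmod (RtoC ((x - n) / x)) <= / x.
Proof.
  intros Hn Hx. rewrite Cmod_R, Rabs_right.
  - unfold Rdiv. rewrite <- (Rmult_1_l (/ x)) at 2.
    apply Rmult_le_compat_r; [left; apply Rinv_0_lt_compat|]; lra.
  - apply Rle_ge, Rdiv_le_0_compat; lra.
Qed.

Lemma step_bound (s : C) : 0 < Re s ->
  exists K tau, 0 <= K /\ 0 < tau /\ forall n, 1 <= n ->
    Cmod (step n s (n + 1) - step n s n)
      <= K * (exp (- tau * ln n) - exp (- tau * ln (n + 1))).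
Proof.
  intros Hs. set (q := (s * (1 - s))%C).
  exists (2 * (Cmod q / Re s)), (Re s).
  assert (HK : 0 <= Cmod q / Re s) by (apply Rdiv_le_0_compat; [apply Cmod_ge_0 | auto]).
  repeat split; [lra | auto |]. intros n Hn.
  eapply tail_bound; auto.
  - intros x Hx. apply is_Rderive_step. lra.
  - intros x Hx. cbv beta. rewrite !Cmod_mult, Cmod_opp, Cmod_Cpow_pos. fold q.
    replace (Cmod q / Re s * Re s / x) with (Cmod q * / x) by (field; lra).
    replace (Re (- s)) with (- Re s) by reflexivity.
    apply Rmult_le_compat_r; [left; apply exp_pos|].
    apply Rmult_le_compat_l; [apply Cmod_ge_0 | now apply frac_bound].
Qed.

Lemma step'_bound (s : C) : 0 < Re s ->
  exists K tau, 0 <= K /\ 0 < tau /\ forall n, 1 <= n ->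
    Cmod (step' n s (n + 1) - step' n s n)
      <= K * (exp (- tau * ln n) - exp (- tau * ln (n + 1))).
Proof.
  intros Hs. set (q := (s * (1 - s))%C). set (q' := (1 - 2 * s)%C).
  set (tau := Re s / 2).
  destruct (log_bound tau) as [M [HM HL]]; [unfold tau; lra|].
  set (A := Cmod q + Cmod q').
  assert (HA : 0 <= A) by (pose proof (Cmod_ge_0 q); pose proof (Cmod_ge_0 q'); unfold A; lra).
  assert (Htau : 0 < tau) by (unfold tau; lra).
  exists (2 * (A * M / tau)), tau.
  assert (HK : 0 <= A * M / tau) by (apply Rdiv_le_0_compat; nra).
  repeat split; [lra | auto |]. intros n Hn.
  eapply tail_bound; auto.
  - intros x Hx. apply is_Rderive_step'. lra.
  - intros x Hx. cbv beta. rewrite !Cmod_mult, Cmod_opp, Cmod_Cpow_pos. fold q q'.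
    replace (A * M / tau * tau / x) with (A * M * / x) by (field; lra).
    replace (Re (- s) * ln x) with (- tau * ln x + - tau * ln x)
      by (unfold tau; simpl; unfold Re; field).
    rewrite exp_plus, <- Rmult_assoc.
    apply Rmult_le_compat_r; [left; apply exp_pos|].
    assert (Lx : 0 <= ln x) by (apply ln_nonneg; lra).
    specialize (HL (ln x) Lx).
    assert (E : exp (tau * ln x) * exp (- tau * ln x) = 1).
    { rewrite <- exp_plus. replace (_ + _) with 0 by ring. apply exp_0. }
    pose proof (exp_pos (- tau * ln x)) as Hp.
    assert (B1 : Cmod (q' - RtoC (ln x) * q) <= A * (1 + ln x) ^ 2).
    { eapply Rle_trans; [apply Cmod_triangle|].
      rewrite Cmod_opp, Cmod_mult, Cmod_R, Rabs_right by lra.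
      pose proof (Cmod_ge_0 q); pose proof (Cmod_ge_0 q'). unfold A. 
      nra. }
    assert (B2 : (1 + ln x) ^ 2 * exp (- tau * ln x) <= M).
    { apply Rle_trans with (M * exp (tau * ln x) * exp (- tau * ln x)).
      - apply Rmult_le_compat_r; lra.
      - rewrite Rmult_assoc, E; lra. }
    pose proof (frac_bound n x Hn Hx) as B3.
    pose proof (Cmod_ge_0 (RtoC ((x - n) / x))) as B4.
    replace (Cmod (q' - ln x * q) * Cmod ((x - n) / x)%R * exp (- tau * ln x))
      with (Cmod (q' - ln x * q) * exp (- tau * ln x) * Cmod ((x - n) / x)%R) by ring.
    apply Rmult_le_compat; auto.
    + apply Rmult_le_pos; [apply Cmod_ge_0 | lra].
    + apply Rle_trans with (A * (1 + ln x) ^ 2 * exp (- tau * ln x)).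
      * apply Rmult_le_compat_r; lra.
      * rewrite Rmult_assoc. apply Rmult_le_compat_l; auto.
Qed.

Lemma step_remainder (s : C) : 0 < Re s ->
  exists K tau, 0 <= K /\ 0 < tau /\ forall h n, Cmod h <= Re s / 4 -> 1 <= n ->
    Cmod ((step n (s + h) (n + 1) - step n s (n + 1) - h * step' n s (n + 1))
          - (step n (s + h) n - step n s n - h * step' n s n))
      <= K * Cmod h ^ 2 * (exp (- tau * ln n) - exp (- tau * ln (n + 1))).
Proof.
  intros Hs. set (q := (s * (1 - s))%C). set (q' := (1 - 2 * s)%C).
  set (tau := Re s / 2).
  destruct (log_bound (Re s / 4)) as [M [HM HL]]; [lra|].
  set (A := 4 * Cmod q + 2 * Cmod q' + 1).
  pose proof (Cmod_ge_0 q) as Hq. pose proof (Cmod_ge_0 q') as Hq'.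
  assert (HA : 0 <= A) by (unfold A; lra).
  assert (Htau : 0 < tau) by (unfold tau; lra).
  exists (2 * (A * M / tau)), tau.
  assert (HK : 0 <= A * M / tau) by (apply Rdiv_le_0_compat; nra).
  repeat split; [lra | auto |]. intros h n Hh Hn.
  pose proof (Cmod_ge_0 h) as Hh0.
  replace (2 * (A * M / tau) * Cmod h ^ 2) with (2 * (A * M / tau * Cmod h ^ 2)) by ring.
  apply (tail_bound (fun x => step n (s + h) x - step n s x - h * step' n s x)%C
   (fun x => - RtoC ((x - n) / x) * Cpow_pos x (- s) *
     (q * (Cexp (- h * RtoC (ln x)) - 1 - - h * RtoC (ln x))
      + h * q' * (Cexp (- h * RtoC (ln x)) - 1)
      - h * h * Cexp (- h * RtoC (ln x))))%C); auto.
  - apply Rmult_le_pos; [auto | apply pow2_ge_0].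
  - intros x Hx. eapply is_Rderive_eq.
    + apply is_Rderive_plus; [apply is_Rderive_plus|].
      * apply is_Rderive_step; lra.
      * apply is_Rderive_opp, is_Rderive_step; lra.
      * apply is_Rderive_opp, is_Rderive_mult;
          [apply is_Rderive_const | apply is_Rderive_step'; lra].
    + replace (- (s + h))%C with (- s + - h)%C by ring.
      rewrite Cpow_pos_plus. change (Cpow_pos x (- h)) with (Cexp (- h * RtoC (ln x))).
      unfold q, q'. ring.
  - intros x Hx. cbv beta. rewrite !Cmod_mult, Cmod_opp, Cmod_Cpow_pos.
    assert (Lx : 0 <= ln x) by (apply ln_nonneg; lra).
    specialize (HL (ln x) Lx). set (L := ln x) in *.
    set (y := (- h * RtoC L)%C).
    assert (Hy : Cmod y = Cmod h * L)
      by (unfold y; rewrite Cmod_mult, Cmod_opp, Cmod_R, Rabs_right by lra; reflexivity).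
    pose proof (Cexp_taylor0 y) as T0. pose proof (Cexp_taylor1 y) as T1.
    pose proof (Cmod_Cexp_le y) as T2. rewrite Hy in T0, T1, T2.
    assert (Ee : exp (Cmod h * L) <= exp (Re s / 4 * L)) by (apply exp_le; nra).
    pose proof (exp_pos (Cmod h * L)) as P0.
    set (e := exp (Cmod h * L)) in *.
    assert (B1 : Cmod (q * (Cexp y - 1 - y) + h * q' * (Cexp y - 1) - h * h * Cexp y)
      <= Cmod h ^ 2 * e * (A * (1 + L) ^ 2)).
    { apply Rle_trans with
        (Cmod q * (4 * ((Cmod h * L) ^ 2 * e)) + Cmod h * Cmod q' * (2 * (Cmod h * L * e))
         + Cmod h * Cmod h * e).
      - unfold Cminus at 1.
        eapply Rle_trans; [apply Cmod_triangle|]. rewrite Cmod_opp.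
        apply Rplus_le_compat;
          [eapply Rle_trans; [apply Cmod_triangle|]; apply Rplus_le_compat|];
          rewrite !Cmod_mult; apply Rmult_le_compat_l; auto;
          try apply Rmult_le_pos; auto.
      - apply Rle_trans with
          (Cmod h ^ 2 * e * (Cmod q * 4 * L ^ 2 + 2 * Cmod q' * L + 1)); [right; ring|].
        apply Rmult_le_compat_l.
        + apply Rmult_le_pos; [apply pow2_ge_0 | lra].
        + unfold A. assert (L ^ 2 <= (1 + L) ^ 2) by nra.
          assert (L <= (1 + L) ^ 2) by nra. assert (1 <= (1 + L) ^ 2) by nra.
          nra. }
    assert (E1 : exp (Re (- s) * L) * e * (1 + L) ^ 2 <= M * exp (- tau * L)).
    { apply Rle_trans with
        (exp (Re (- s) * L) * exp (Re s / 4 * L) * (M * exp (Re s / 4 * L))).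
      - pose proof (exp_pos (Re (- s) * L)).
        apply Rmult_le_compat; [nra | apply pow2_ge_0 | | exact HL].
        apply Rmult_le_compat_l; lra.
      - replace (exp (Re (- s) * L) * exp (Re s / 4 * L) * (M * exp (Re s / 4 * L)))
          with (M * (exp (Re (- s) * L) * exp (Re s / 4 * L) * exp (Re s / 4 * L))) by ring.
        rewrite <- !exp_plus. right. do 2 f_equal. unfold tau; simpl. unfold Re. field. }
    pose proof (frac_bound n x Hn Hx) as B3.
    pose proof (Cmod_ge_0 (RtoC ((x - n) / x))) as B4.
    pose proof (exp_pos (Re (- s) * L)) as P1.
    apply Rle_trans with
      (/ x * exp (Re (- s) * L) * (Cmod h ^ 2 * e * (A * (1 + L) ^ 2))).
    + apply Rmult_le_compat; auto.
      * apply Rmult_le_pos; lra.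
      * apply Cmod_ge_0.
      * apply Rmult_le_compat_r; lra.
    + replace (/ x * exp (Re (- s) * L) * (Cmod h ^ 2 * e * (A * (1 + L) ^ 2)))
        with (/ x * Cmod h ^ 2 * A * (exp (Re (- s) * L) * e * (1 + L) ^ 2)) by ring.
      replace (A * M / tau * Cmod h ^ 2 * tau / x * exp (- tau * L))
        with (/ x * Cmod h ^ 2 * A * (M * exp (- tau * L))) by (field; lra).
      apply Rmult_le_compat_l; auto.
      apply Rmult_le_pos; auto. apply Rmult_le_pos; [|apply pow2_ge_0].
      left; apply Rinv_0_lt_compat; lra.
Qed.

Lemma step_diag (n : R) (s : C) : step n s n = 0%C.
Proof. unfold step. rewrite Rminus_diag. ring. Qed.

Lemma step'_diag (n : R) (s : C) : step' n s n = 0%C.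
Proof. unfold step'. rewrite Rminus_diag. ring. Qed.

Lemma Cpow_pos_base_1 (s : C) : Cpow_pos 1 s = RtoC 1.
Proof. unfold Cpow_pos. rewrite ln_1, Cmult_0_r. apply Cexp_0. Qed.

Lemma zeta_approx_1 (s : C) : s <> 1%C -> ((1 - s) * zeta_approx s 1 = - s)%C.
Proof.
  intros Hs. unfold zeta_approx. rewrite sum_n_n, !Cpow_pos_base_1. field.
  intros E. apply Hs. replace s with (1 - (1 - s))%C by ring. rewrite E. ring.
Qed.

Lemma zeta_approx_S (s : C) (N : nat) : s <> 1%C ->
  ((1 - s) * zeta_approx s (S (S N)) =
   (1 - s) * zeta_approx s (S N) + step (INR (S N)) s (INR (S N) + 1))%C.
Proof.
  intros Hs. unfold zeta_approx, step.
  rewrite (sum_n_Sm _ 1 (S N)) by lia.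
  replace (INR (S N) + 1 - INR (S N)) with 1 by ring.
  rewrite <- (S_INR (S N)). change plus with Cplus. field.
  intros E. apply Hs. replace s with (1 - (1 - s))%C by ring. rewrite E. ring.
Qed.

Definition tail (tau : R) (N : nat) : R := exp (- tau * ln (INR (S N))).

Lemma INR_S_ge_1 (N : nat) : 1 <= INR (S N).
Proof. rewrite S_INR. pose proof (pos_INR N). lra. Qed.

Lemma tail_decr (tau : R) (N : nat) : 0 < tau -> tail tau (S N) <= tail tau N.
Proof.
  intros Ht. apply exp_le. pose proof (INR_S_ge_1 N).
  assert (ln (INR (S N)) <= ln (INR (S (S N)))).
  { left. apply ln_increasing; [lra|]. rewrite (S_INR (S N)). lra. }
  nra.
Qed.

Lemma tail_0 (tau : R) : tail tau 0 = 1.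
Proof. unfold tail. simpl INR. rewrite ln_1, Rmult_0_r. apply exp_0. Qed.

Lemma tail_pos (tau : R) (N : nat) : 0 <= tail tau N.
Proof. left; apply exp_pos. Qed.

Lemma zeta_cvg (s : C) : 0 < Re s -> s <> 1%C ->
  Ccvg (fun N => zeta_approx s (S N)) (zeta s).
Proof.
  intros Hs H1.
  assert (H1' : (1 - s)%C <> 0%C).
  { intros E. apply H1. replace s with (1 - (1 - s))%C by ring. rewrite E. ring. }
  destruct (step_bound s Hs) as [K [tau [HK [Ht HB]]]].
  destruct (Ccvg_cauchy (fun N => (1 - s) * zeta_approx s (S N))%C K (tail tau))
    as [l Hl]; auto using tail_pos, tail_decr.
  - intros N. rewrite zeta_approx_S by assumption.
    specialize (HB (INR (S N)) (INR_S_ge_1 N)). rewrite step_diag in HB.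
    unfold tail. rewrite (S_INR (S N)).
    replace (_ - _)%C with (step (INR (S N)) s (INR (S N) + 1) - 0)%C by ring.
    exact HB.
  - assert (Hz : Ccvg (fun N => zeta_approx s (S N)) (/ (1 - s) * l)%C).
    { eapply Ccvg_ext; [|apply Ccvg_mult_l, Hl]. intros N. simpl. field. exact H1'. }
    unfold zeta. now rewrite (Ccvg_Lim _ _ Hz).
Qed.

Lemma Ccvg_filterlim (u : nat -> C) (l : C) :
  Ccvg u l -> filterlim u eventually (locally l).
Proof.
  intros [A B]. apply filterlim_locally. intros eps.
  apply filterlim_locally with (eps := eps) in A.
  apply filterlim_locally with (eps := eps) in B.
  generalize (filter_and _ _ A B). apply filter_imp. intros n [H1 H2]. split; assumption.
Qed.

Theorem zeta_dirichlet (s : C) : 1 < Re s ->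
  is_series (fun n => Cpow_pos (INR (S n)) (- s)) (zeta s).
Proof.
  intros Hs.
  assert (H1 : s <> 1%C) by (intros ->; simpl in Hs; lra).
  assert (Hz : Ccvg (fun N => zeta_approx s (S N)) (zeta s)) by (apply zeta_cvg; [lra | auto]).
  assert (H0 : is_lim_seq (fun N => exp ((1 - Re s) * ln (INR (S N)))) 0).
  { apply is_lim_seq_ext with (fun N => exp (- ((Re s - 1) * ln (INR (S N))))).
    { intros N; f_equal; ring. }
    apply (filterlim_comp _ _ _ (fun N => - ((Re s - 1) * ln (INR (S N)))) exp
      eventually (Rbar_locally m_infty)).
    - apply (is_lim_seq_opp _ p_infty).
      apply (is_lim_seq_mult (fun _ => Re s - 1) (fun N => ln (INR (S N)))
        (Re s - 1) p_infty p_infty).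
      + apply is_lim_seq_const.
      + apply (filterlim_comp _ _ _ (fun N => INR (S N)) ln eventually
          (Rbar_locally p_infty)).
        * apply (is_lim_seq_incr_1 INR). apply is_lim_seq_INR.
        * apply is_lim_ln_p.
      + apply is_Rbar_mult_sym, is_Rbar_mult_p_infty_pos. simpl. lra.
    - apply is_lim_exp_m. }
  assert (Hc : Ccvg (fun N => Cpow_pos (INR (S N)) (1 - s)) 0%C).
  { split; apply is_lim_seq_abs_0;
      (eapply is_lim_seq_le_le; [|apply is_lim_seq_const | exact H0]);
      intros N; (split; [apply Rabs_pos|]);
      replace (1 - Re s) with (Re (1 - s)%C) by reflexivity;
      rewrite <- Cmod_Cpow_pos; [apply re_le_Cmod | apply im_le_Cmod]. }
  apply Ccvg_filterlim.
  apply Ccvg_ext with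
    (fun N => zeta_approx s (S N) + / (1 - s) * Cpow_pos (INR (S N)) (1 - s))%C.
  - intros N.
    transitivity (sum_n_m (fun n => Cpow_pos (INR (S n)) (- s)) 0 N); [|reflexivity].
    unfold zeta_approx. rewrite <- (sum_n_m_S (fun n => Cpow_pos (INR n) (- s)) 0 N).
    unfold Cdiv. ring.
  - replace (zeta s) with (zeta s + / (1 - s) * 0)%C by ring.
    apply Ccvg_plus; [exact Hz | apply Ccvg_mult_l, Hc].
Qed.

Fixpoint zeta_approx' (s : C) (N : nat) : C :=
  match N with
  | O => (- 1)%C
  | S N => (zeta_approx' s N + step' (INR (S N)) s (INR (S N) + 1))%C
  end.

Lemma zeta_approx'_S (s : C) (N : nat) :
  zeta_approx' s (S N) = (zeta_approx' s N + step' (INR (S N)) s (INR (S N) + 1))%C.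
Proof. reflexivity. Qed.

Lemma zeta_quadratic (s : C) : 0 < Re s -> s <> 1%C ->
  exists (D : C) (K delta : R), 0 <= K /\ 0 < delta /\
    forall h, Cmod h <= delta ->
      0 < Re (s + h) /\ (s + h)%C <> 1%C /\ 
      Cmod ((1 - (s + h)) * zeta (s + h) - (1 - s) * zeta s - h * D) <= K * Cmod h ^ 2.
Proof.
  intros Hs H1.
  assert (Hd : 0 < Cmod (1 - s)).
  { apply Cmod_gt_0. intros E. apply H1.
    replace s with (1 - (1 - s))%C by ring. rewrite E. ring. }
  destruct (step'_bound s Hs) as [K' [tau' [HK' [Ht' HB']]]].
  destruct (Ccvg_cauchy (zeta_approx' s) K' (tail tau'))
    as [D HD]; auto using tail_pos, tail_decr.
  { intros N. rewrite zeta_approx'_S.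
    specialize (HB' (INR (S N)) (INR_S_ge_1 N)). rewrite step'_diag in HB'.
    unfold tail. rewrite (S_INR (S N)).
    replace (_ - _)%C with (step' (INR (S N)) s (INR (S N) + 1) - 0)%C by ring.
    exact HB'. }
  destruct (step_remainder s Hs) as [K [tau [HK [Ht HB]]]].
  exists D, (2 * K), (Rmin (Re s / 4) (Cmod (1 - s) / 2)).
  split; [lra|]. split; [apply Rmin_glb_lt; lra|].
  intros h Hh.
  assert (Hh1 : Cmod h <= Re s / 4) by (eapply Rle_trans; [apply Hh | apply Rmin_l]).
  assert (Hh2 : Cmod h <= Cmod (1 - s) / 2) by (eapply Rle_trans; [apply Hh | apply Rmin_r]).
  assert (R1 : 0 < Re (s + h)).
  { pose proof (re_le_Cmod h) as H. apply Rabs_le_between in H.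
    change (Re (s + h)) with (Re s + Re h). lra. }
  assert (R2 : (s + h)%C <> 1%C).
  { intros E. replace (1 - s)%C with h in Hh2 by (rewrite <- E; ring).
    replace (1 - s)%C with h in Hd by (rewrite <- E; ring). lra. }
  repeat split; auto.
  rewrite Rmult_assoc.
  pose (u := fun N => ((1 - (s + h)) * zeta_approx (s + h) (S N)
    - (1 - s) * zeta_approx s (S N) - h * zeta_approx' s N)%C).
  apply Ccvg_bound with u.
  - apply Ccvg_ext with (fun N => (1 - (s + h)) * zeta_approx (s + h) (S N)
      + - (1 - s) * zeta_approx s (S N) + - h * zeta_approx' s N)%C.
    { intros N; unfold u; ring. }
    replace ((1 - (s + h)) * zeta (s + h) - (1 - s) * zeta s - h * D)%C with
      ((1 - (s + h)) * zeta (s + h) + - (1 - s) * zeta s + - h * D)%C by ring.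
    repeat apply Ccvg_plus; apply Ccvg_mult_l; auto using zeta_cvg.
  - intros N.
    assert (U0 : u O = 0%C).
    { unfold u. rewrite !zeta_approx_1 by assumption. simpl zeta_approx'. ring. }
    assert (K2 : 0 <= K * Cmod h ^ 2) by (apply Rmult_le_pos; [auto | apply pow2_ge_0]).
    pose proof (Ccvg_incr u (K * Cmod h ^ 2) (tail tau) K2
      (tail_pos tau) (fun N => tail_decr tau N Ht)) as H.
    assert (HN : Cmod (u N - u O) <= K * Cmod h ^ 2 * (tail tau 0 - tail tau N)).
    { apply H; [|lia]. intros M.
      specialize (HB h (INR (S M)) Hh1 (INR_S_ge_1 M)).
      rewrite !step_diag, step'_diag in HB.
      unfold tail. rewrite (S_INR (S M)).
      replace (u (S M) - u M)%C with
        (step (INR (S M)) (s + h) (INR (S M) + 1) - step (INR (S M)) s (INR (S M) + 1)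
         - h * step' (INR (S M)) s (INR (S M) + 1) - (0 - 0 - h * 0))%C.
      - exact HB.
      - unfold u. rewrite !zeta_approx_S, zeta_approx'_S by assumption. ring. }
    rewrite U0, tail_0 in HN. replace (u N - 0)%C with (u N) in HN by ring.
    pose proof (tail_pos tau N). nra.
Qed.

Lemma is_derive_quadratic (f : C -> C) (s l : C) (K delta : R) : 0 <= K -> 0 < delta ->
  (forall h, Cmod h <= delta -> Cmod (f (s + h) - f s - h * l)%C <= K * Cmod h ^ 2) ->
  is_derive f s l.
Proof.
  intros HK Hd H. split; [apply is_linear_scal_l|].
  intros x Hx.
  apply (is_filter_lim_locally_unique (V := AbsRing_NormedModule C_AbsRing)) in Hx. subst x.
  intros eps.
  assert (E : forall y : C, (s + (y - s))%C = y) by (intros; ring).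
  assert (He : 0 < Rmin delta (eps / (K + 1))).
  { apply Rmin_glb_lt; auto. apply Rdiv_lt_0_compat; [apply cond_pos | lra]. }
  exists (mkposreal _ He). intros y Hy.
  change (Cmod (y - s) < Rmin delta (eps / (K + 1))) in Hy.
  change (Cmod (f y - f s - (y - s) * l)%C <= eps * Cmod (y - s)).
  specialize (H (y - s)%C). rewrite E in H.
  pose proof (Rmin_l delta (eps / (K + 1))). pose proof (Rmin_r delta (eps / (K + 1))).
  eapply Rle_trans; [apply H; lra|].
  pose proof (Cmod_ge_0 (y - s)).
  replace (K * Cmod (y - s) ^ 2) with (K * Cmod (y - s) * Cmod (y - s)) by ring.
  apply Rmult_le_compat_r; auto.
  apply Rle_trans with ((K + 1) * (eps / (K + 1))); [|right; field; lra].
  apply Rmult_le_compat; lra.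
Qed.

Theorem zeta_holomorphic (s : C) : 0 < Re s -> s <> 1%C -> ex_derive zeta s.
Proof.
  intros Hs H1.
  destruct (zeta_quadratic s Hs H1) as [D [K [delta [HK [Hd H]]]]].
  set (c := (1 - s)%C) in *.
  assert (Hc0 : c <> 0%C).
  { intros E. apply H1. replace s with (1 - (1 - s))%C by ring. fold c. rewrite E. ring. }
  assert (Hc : 0 < Cmod c) by now apply Cmod_gt_0.
  set (V := (c * zeta s)%C) in *.
  exists (D / c + V / (c * c))%C.
  set (A := (K * (Cmod c) ^ 2 + Cmod (D * c + V)) * (2 / Cmod c ^ 3)).
  assert (H3 : 0 < 2 / Cmod c ^ 3).
  { apply Rdiv_lt_0_compat; [lra | apply pow_lt; auto]. }
  apply is_derive_quadratic with A (Rmin delta (Cmod c / 2)).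
  - apply Rmult_le_pos; [|lra]. apply Rplus_le_le_0_compat; [|apply Cmod_ge_0].
    apply Rmult_le_pos; [auto | apply pow2_ge_0].
  - apply Rmin_glb_lt; lra.
  - intros h Hh.
    assert (Hh1 : Cmod h <= delta) by (eapply Rle_trans; [apply Hh | apply Rmin_l]).
    assert (Hh2 : Cmod h <= Cmod c / 2) by (eapply Rle_trans; [apply Hh | apply Rmin_r]).
    destruct (H h Hh1) as [_ [R2 Hq]].
    replace (1 - (s + h))%C with (c - h)%C in Hq by (unfold c; ring).
    assert (Hm : Cmod c / 2 <= Cmod (c - h)).
    { pose proof (Cmod_triangle (c - h) h) as T.
      replace (c - h + h)%C with c in T by ring. lra. }
    assert (Hm0 : (c - h)%C <> 0%C).
    { intros E. rewrite E, Cmod_0 in Hm. lra. }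
    set (rho := ((c - h) * zeta (s + h) - V - h * D)%C) in *.
    replace (zeta (s + h) - zeta s - h * (D / c + V / (c * c)))%C with
      ((rho * (c * c) + h * h * (D * c + V)) / (c * c * (c - h)))%C
      by (unfold rho, V; field; split; assumption).
    unfold Cdiv. rewrite Cmod_mult.
    assert (N1 : Cmod (rho * (c * c) + h * h * (D * c + V))
      <= (K * Cmod c ^ 2 + Cmod (D * c + V)) * Cmod h ^ 2).
    { eapply Rle_trans; [apply Cmod_triangle|]. rewrite !Cmod_mult.
      replace ((K * Cmod c ^ 2 + Cmod (D * c + V)) * Cmod h ^ 2) with
        (K * Cmod h ^ 2 * (Cmod c * Cmod c) + Cmod h * Cmod h * Cmod (D * c + V)) by ring.
      apply Rplus_le_compat_r, Rmult_le_compat_r; [apply Rmult_le_pos; lra | exact Hq]. }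
    assert (N2 : Cmod (/ (c * c * (c - h))) <= 2 / Cmod c ^ 3).
    { rewrite Cmod_inv by (repeat apply Cmult_neq_0; auto).
      rewrite !Cmod_mult.
      replace (2 / Cmod c ^ 3) with (/ (Cmod c * Cmod c * (Cmod c / 2))) by (field; lra).
      apply Rinv_le_contravar; [repeat apply Rmult_lt_0_compat; lra|].
      apply Rmult_le_compat_l; [apply Rmult_le_pos; lra | auto]. }
    replace (A * Cmod h ^ 2) with
      ((K * Cmod c ^ 2 + Cmod (D * c + V)) * Cmod h ^ 2 * (2 / Cmod c ^ 3))
      by (unfold A; ring).
    apply Rmult_le_compat; auto; apply Cmod_ge_0.
Qed.

(* Main.v *)
Require Import Defs.
From Stdlib Require Import Reals Factorial Lra Lia Psatz Arith.
From Coquelicot Require Import Coquelicot.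
Open Scope R_scope.

(** Put [G_m x = sum_j a_{m,j} B_j x^j] and [h = harmonic m]. The polynomials [p n] satisfy
    [p m (x y) = sum_n conn x m n * p n y], where the [conn x m n] obey a two-term recurrence
    that makes them nonnegative for [0 <= x <= 1]. The umbral map [y^j |-> (-1)^j B_j] sends
    [p n y] to [1 / (n + 1)], so that [G_m x = sum_n conn x m n / (n + 1)] is a mean of the
    numbers [1 / (n + 1)]. Comparing with [y = 0], [y = 1] and [y = 1/2] gives
    [1 - h x <= G_m x <= exp (- h x / 2)]; and, as [m -> oo], [conn (u / h) m n] tends to the
    geometric law [exp (-u) (1 - exp (-u))^n], so [G_m (u / h) -> g u = u / (exp u - 1)]
    uniformly.

    By termwise integration
      [h^(s-1) (s-1) F_m s = h^(s-1) exp (-h)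
         + int_0^h ((s-1) u^(s-2) (G_m (u/h) - exp (-u)) + u^(s-1) exp (-u)) du],
    where subtracting [exp (-u)] makes the integral converge for [0 < Re s]. The same integral
    over [(0, oo)] with [g] in place of [G_m (u/h)] equals [(s-1) Gamma s zeta s], which is
    obtained by expanding [g] in a geometric series; the bounds above dominate the difference. *)

(** * Bernoulli numbers and connection coefficients *)

(** The obstacle is that limits cannot be taken coefficient by coefficient. For fixed [j],
    [coef m j / h^j] tends to [1 / j!], so the formal limit of [G_m (u / h)] is the power series of
    [g], which diverges for [u > 2 pi], while [u] runs up to [h]. The Bernoulli sums consist of
    large cancelling terms; rewriting them as averages with nonnegative weights removes the
    cancellation and gives bounds independent of [m]. The identity with [zeta] is obtained for all
    [0 < Re s], [s <> 1] at once, by a finite telescoping that reproduces [zeta_approx] up to a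
    vanishing remainder, so no analytic continuation enters. The factor [s - 1] stays inside the
    integrals, so that no constant degenerates as [s] approaches 1. The limit of the right-hand side
    at [s = 1] is then a consequence of the uniform convergence and of the explicit residue of
    [F_m], not of the residue of zeta. *)

(* [coef m j] is the paper's [a_{m,j}], the coefficient of [t ^ j] in [p m (- t)]. *)
Fixpoint coef (m j : nat) : R :=
  match m with
  | O => match j with O => 1 | S _ => 0 end
  | S m' => coef m' j + match j with O => 0 | S j' => coef m' j' / INR (S m') end
  end.

(** * Finite sums and uniqueness of polynomial coefficients *)

Lemma INR_S_neq_0 (n : nat) : INR (S n) <> 0.
Proof. apply not_0_INR; discriminate. Qed.

Lemma sum_f_R0_extend (f : nat -> R) (i n : nat) : (i <= n)%nat ->
  (forall k, (i < k)%nat -> f k = 0) -> sum_f_R0 f n = sum_f_R0 f i.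
Proof.
  intros H Hf. induction H as [|n H IH]; [reflexivity|].
  rewrite tech5, IH, Hf by lia. ring.
Qed.

Lemma sum_f_R0_shift (al be : nat -> R) (m : nat) :
  sum_f_R0 (fun n => al n + match n with O => 0 | S n' => be n' end) (S m)
  = sum_f_R0 al (S m) + sum_f_R0 be m.
Proof.
  rewrite plus_sum. f_equal.
  rewrite (decomp_sum (fun n => match n with O => 0 | S n' => be n' end)) by lia.
  simpl pred. rewrite Rplus_0_l. reflexivity.
Qed.

Lemma sum_f_R0_switch (u : nat -> nat -> R) (m n : nat) :
  sum_f_R0 (fun i => sum_f_R0 (u i) n) m
  = sum_f_R0 (fun j => sum_f_R0 (fun i => u i j) m) n.
Proof.
  induction m as [|m IH]; [reflexivity|].
  rewrite tech5, IH, <- plus_sum. apply sum_eq; intros; reflexivity.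
Qed.

Lemma coef_gt (m j : nat) : (m < j)%nat -> coef m j = 0.
Proof.
  revert j; induction m as [|m IH]; intros j H; destruct j as [|j]; try lia; [reflexivity|].
  cbn [coef]. rewrite !IH by lia. unfold Rdiv; ring.
Qed.

Lemma coef_0 (m : nat) : coef m 0 = 1.
Proof. induction m as [|m IH]; cbn [coef]; [reflexivity | rewrite IH; ring]. Qed.

Lemma p_coef (m : nat) (t : R) :
  p m (- t) = sum_f_R0 (fun j => coef m j * t ^ j) m.
Proof.
  induction m as [|m IH]; [simpl; ring|].
  cbn [p]. rewrite IH.
  transitivity (sum_f_R0 (fun n => coef m n * t ^ n +
    match n with O => 0 | S n' => coef m n' * t ^ n' * (t / INR (S m)) end) (S m)).
  - rewrite (sum_f_R0_shift (fun n => coef m n * t ^ n)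
      (fun n => coef m n * t ^ n * (t / INR (S m)))).
    rewrite tech5, coef_gt by lia. rewrite <- scal_sum. field. apply INR_S_neq_0.
  - apply sum_eq. intros [|j] _; cbn [coef]; [ring|]. simpl pow. field. apply INR_S_neq_0.
Qed.

(** The constant term vanishes because the rest is of order [t]; then [t] is divided out. Excluding
    [t = 0] in the hypothesis lets it survive this division. *)
Lemma poly_zero (n : nat) : forall e : nat -> R,
  (forall t, t <> 0 -> sum_f_R0 (fun j => e j * t ^ j) n = 0) ->
  forall j, (j <= n)%nat -> e j = 0.
Proof.
  induction n as [|n IH]; intros e H j Hj.
  - replace j with O by lia. specialize (H 1 R1_neq_R0). simpl in H. lra.
  - assert (E : forall t, sum_f_R0 (fun j => e j * t ^ j) (S n)
      = e O + t * sum_f_R0 (fun j => e (S j) * t ^ j) n).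
    { intros t. rewrite decomp_sum by lia. simpl pred. rewrite scal_sum. simpl (t ^ 0).
      rewrite Rmult_1_r. f_equal. apply sum_eq; intros; simpl; ring. }
    set (M := sum_f_R0 (fun j => Rabs (e (S j))) n).
    assert (HM : 0 <= M) by (apply cond_pos_sum; intros; apply Rabs_pos).
    assert (E0 : e O = 0).
    { destruct (Req_dec (e O) 0) as [H0|H0]; [exact H0 | exfalso].
      (* With this [t], the higher terms, bounded by [t * M], stay strictly below [Rabs (e O)]. *)
      apply Rabs_pos_lt in H0. set (t := Rmin 1 (Rabs (e O) / (M + 1))).
      assert (Ht : 0 < t) by (apply Rmin_glb_lt; [lra | apply Rdiv_lt_0_compat; lra]).
      assert (Ht1 : t <= 1) by apply Rmin_l.
      assert (Ht2 : t * (M + 1) <= Rabs (e O)).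
      { apply Rle_trans with (Rabs (e O) / (M + 1) * (M + 1)); [|right; field; lra].
        apply Rmult_le_compat_r; [lra | apply Rmin_r]. }
      assert (B : Rabs (sum_f_R0 (fun j => e (S j) * t ^ j) n) <= M).
      { eapply Rle_trans; [apply Rsum_abs|]. apply sum_Rle. intros i _.
        rewrite Rabs_mult, (Rabs_right (t ^ i)) by (apply Rle_ge, pow_le; lra).
        assert (t ^ i <= 1) by (rewrite <- (pow1 i); apply pow_incr; lra).
        pose proof (Rabs_pos (e (S i))). nra. }
      specialize (H t ltac:(lra)). rewrite E in H.
      replace (e O) with (- (t * sum_f_R0 (fun j => e (S j) * t ^ j) n)) in Ht2 by lra.
      rewrite Rabs_Ropp, Rabs_mult, (Rabs_right t) in Ht2 by lra. nra. }
    destruct j as [|j]; [exact E0|].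
    apply (IH (fun j => e (S j))); [|lia]. intros t Ht. specialize (H t Ht).
    rewrite E, E0, Rplus_0_l in H. apply Rmult_integral in H as [H|H]; tauto.
Qed.

Lemma poly_unique (n : nat) (c d : nat -> R) :
  (forall t, sum_f_R0 (fun j => c j * t ^ j) n = sum_f_R0 (fun j => d j * t ^ j) n) ->
  forall j, (j <= n)%nat -> c j = d j.
Proof.
  intros H j Hj. apply Rminus_diag_uniq.
  apply (poly_zero n (fun j => c j - d j)); [|exact Hj]. intros t _.
  transitivity (sum_f_R0 (fun j => c j * t ^ j) n - sum_f_R0 (fun j => d j * t ^ j) n).
  - rewrite <- minus_sum. apply sum_eq; intros; ring.
  - rewrite H; ring.
Qed.

Lemma p_coefficients_unique (a : nat -> nat -> R) (m j : nat) :
  p_coefficients a -> (j <= m)%nat -> a m j = coef m j.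
Proof.
  intros Ha. revert j. apply poly_unique. intros t.
  rewrite <- p_coef, (Ha m (- t)), sum_n_Reals. apply sum_eq. intros j _.
  replace ((- t) ^ j) with ((-1) ^ j * t ^ j) by (rewrite <- Rpow_mult_distr; f_equal; ring).
  replace ((-1) ^ j * a m j * ((-1) ^ j * t ^ j))
    with (((-1) ^ j * (-1) ^ j) * a m j * t ^ j) by ring.
  rewrite <- Rpow_mult_distr. replace (-1 * -1) with 1 by ring. rewrite pow1. ring.
Qed.

(** * Power series and the recurrence of the Bernoulli numbers *)

Lemma CV_radius_ge (a : nat -> R) (x : R) :
  ex_pseries a x -> Rbar_le (Rabs x) (CV_radius a).
Proof.
  intros H. apply Rbar_not_lt_le. intros L. apply (CV_disk_outside _ _ L).
  eapply is_lim_seq_ext; [|apply ex_series_lim_0, H].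
  intros n. simpl. rewrite pow_n_pow. apply Rmult_comm.
Qed.

Lemma is_pseries_X (x : R) :
  is_pseries (fun n => match n with 1%nat => 1 | _ => 0 end) x x.
Proof.
  apply filterlim_ext_loc with (fun _ => x); [|apply filterlim_const].
  exists 1%nat. intros n Hn.
  rewrite sum_n_Reals.
  rewrite (sum_f_R0_extend _ 1 n Hn).
  - simpl sum_f_R0. unfold scal, one; simpl. unfold mult, one; simpl. ring.
  - intros [|[|k]] Hk; try lia. apply Rmult_0_r.
Qed.

(** Coefficients are compared in [z / (exp z - 1) * exp z = z / (exp z - 1) + z], with a Cauchy
    product on the left. *)
Lemma bernoulli_convolution (B : nat -> R) (n : nat) : bernoulli_numbers B ->
  sum_f_R0 (fun k => B k / INR (fact k) * / INR (fact (n - k))) n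
  = B n / INR (fact n) + match n with 1%nat => 1 | _ => 0 end.
Proof.
  intros [r Hr]. pose proof (cond_pos r) as Hr0.
  set (a := fun j => B j / INR (fact j)) in *.
  set (e := fun j => / INR (fact j)).
  set (d := fun n => match n with 1%nat => 1 | _ => 0 end).
  change (PS_mult a e n = PS_plus a d n).
  assert (Ra : Rbar_le (r / 2) (CV_radius a)).
  { rewrite <- (Rabs_right (r / 2)) by lra. apply CV_radius_ge.
    eexists. apply Hr. rewrite Rabs_right; lra. }
  assert (Re : forall x, Rbar_lt (Rabs x) (CV_radius e)).
  { intros x. apply Rbar_lt_le_trans with (Rabs (Rabs x + 1)).
    - simpl. pose proof (Rabs_pos x). rewrite (Rabs_right (_ + _)); lra.
    - apply CV_radius_ge. eexists. apply is_exp_Reals. }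
  assert (Ha : forall x, Rabs x < r / 2 -> Rbar_lt (Rabs x) (CV_radius a)).
  { intros x Hx. eapply Rbar_lt_le_trans; [|apply Ra]. exact Hx. }
  assert (H : forall x, Rabs x < r / 2 ->
    ex_pseries (PS_mult a e) x /\ ex_pseries (PS_plus a d) x /\
    PSeries (PS_mult a e) x = PSeries (PS_plus a d) x).
  { intros x Hx. split; [|split].
    - apply ex_pseries_mult; auto.
    - apply ex_pseries_plus; [apply CV_radius_inside; auto | eexists; apply is_pseries_X].
    - destruct (Req_dec x 0) as [->|H0].
      + rewrite !PSeries_0. unfold PS_mult, PS_plus, d, e. simpl.
        unfold plus; simpl. field.
      + rewrite PSeries_mult by auto.
        rewrite PSeries_plus; [|apply CV_radius_inside; auto | eexists; apply is_pseries_X].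
        rewrite (is_pseries_unique d x x (is_pseries_X x)).
        rewrite (is_pseries_unique e x _ (is_exp_Reals x)).
        rewrite (is_pseries_unique a x (x / (exp x - 1))).
        * field. intros E. apply H0. apply exp_inv. rewrite exp_0. lra.
        * apply Hr. split; [apply Rabs_pos_lt; auto | lra]. }
  assert (P : forall c : nat -> R, ex_pseries c (r / 4) -> Rbar_lt 0 (CV_radius c)).
  { intros c Hc. eapply Rbar_lt_le_trans; [|apply CV_radius_ge, Hc].
    simpl. rewrite Rabs_right; lra. }
  assert (H4 : Rabs (r / 4) < r / 2) by (rewrite Rabs_right; lra).
  apply PSeries_ext_recip; [apply P, H, H4 | apply P, H, H4 |].
  assert (Hr2 : 0 < r / 2) by lra.
  exists (mkposreal _ Hr2). intros x Hx. apply H.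
  change (Rabs (x - 0) < r / 2) in Hx. now rewrite Rminus_0_r in Hx.
Qed.

(** The coefficient of [y ^ k] in [(y + 1) ^ j - y ^ j]. The guard drops the cancelling top term and
    the nonzero value that [Binomial.C j k] takes for [k > j], where [j - k] is truncated. *)
Definition diff_binom (j k : nat) : R := if (k <? j)%nat then Binomial.C j k else 0.

(** This is [bernoulli_convolution] multiplied by [j!], with [B j] cancelled on both sides. The
    length [n] common to all [j <= n + 1] allows the sums over [j] and [k] to be exchanged later. *)
Lemma bernoulli_recurrence (B : nat -> R) (j n : nat) : bernoulli_numbers B ->
  (j <= S n)%nat ->
  sum_f_R0 (fun k => diff_binom j k * B k) n = match j with 1%nat => 1 | _ => 0 end.
Proof.
  intros HB Hj. destruct j as [|j].
  - apply sum_eq_R0. intros k _. unfold diff_binom. simpl. ring.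
  - rewrite (sum_f_R0_extend _ j n);
      [| lia | intros k Hk; unfold diff_binom; destruct (Nat.ltb_spec k (S j)); [lia | ring]].
    pose proof (bernoulli_convolution B (S j) HB) as H.
    rewrite tech5, Nat.sub_diag in H. change (INR (fact 0)) with 1 in H.
    rewrite Rinv_1, Rmult_1_r in H.
    assert (F : INR (fact (S j)) <> 0) by apply INR_fact_neq_0.
    replace (sum_f_R0 (fun k => diff_binom (S j) k * B k) j) with
      (INR (fact (S j)) *
       sum_f_R0 (fun k => B k / INR (fact k) * / INR (fact (S j - k))) j).
    + replace (sum_f_R0 (fun k => B k / INR (fact k) * / INR (fact (S j - k))) j)
        with (match S j with 1%nat => 1 | _ => 0 end) by lra.
      destruct j as [|j]; [simpl; ring | ring].
    + rewrite scal_sum. apply sum_eq. intros k Hk. unfold diff_binom, Binomial.C.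
      destruct (Nat.ltb_spec k (S j)); [|lia]. field.
      split; apply INR_fact_neq_0.
Qed.

Lemma diff_pow (y : R) (j n : nat) : (j <= S n)%nat ->
  (y + 1) ^ j - y ^ j = sum_f_R0 (fun k => diff_binom j k * y ^ k) n.
Proof.
  intros Hj. destruct j as [|j].
  - simpl. rewrite sum_eq_R0; [ring|]. intros k _. unfold diff_binom; simpl; ring.
  - rewrite (sum_f_R0_extend _ j n);
      [| lia | intros k Hk; unfold diff_binom; destruct (Nat.ltb_spec k (S j)); [lia | ring]].
    rewrite binomial, tech5, pow1.
    replace (Binomial.C (S j) (S j)) with 1
      by (unfold Binomial.C; rewrite Nat.sub_diag; change (INR (fact 0)) with 1; field;
          apply INR_fact_neq_0).
    replace (sum_f_R0 (fun k => diff_binom (S j) k * y ^ k) j) with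
      (sum_f_R0 (fun i => Binomial.C (S j) i * y ^ i * 1 ^ (S j - i)) j); [simpl; ring|].
    apply sum_eq. intros k Hk. rewrite pow1. unfold diff_binom.
    destruct (Nat.ltb_spec k (S j)); [ring | lia].
Qed.

(** At [1 - y] the factors of [p (S n)] are [(k - 1 + y) / k]; moving the denominators by one place
    turns the product into [y / (n + 1) * p n (- y)]. *)
Lemma p_shift (n : nat) (y : R) :
  p (S n) (- y) - p (S n) (- y + 1) = p n (- y).
Proof.
  assert (H : forall n, p (S n) (- y + 1) = y / INR (S n) * p n (- y)).
  { clear n. induction n as [|n IH]; [simpl; field|].
    change (p (S (S n)) (- y + 1)) with (p (S n) (- y + 1) * (1 - (- y + 1) / INR (S (S n)))).
    rewrite IH. cbn [p]. rewrite (S_INR (S n)).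
    pose proof (INR_S_neq_0 n). pose proof (pos_INR (S n)). field. split; lra. }
  rewrite H. cbn [p]. field. apply INR_S_neq_0.
Qed.

(* The umbral functional [y ^ j |-> B j] sends [f (y + 1) - f y] to [f' 0]; here
   [f y = p (S n) (1 - y) = y * p n (- y) / (n + 1)]. *)
Lemma bernoulli_p (B : nat -> R) (n : nat) : bernoulli_numbers B ->
  sum_f_R0 (fun j => coef n j * B j) n = / INR (S n).
Proof.
  intros HB.
  set (c := fun j => match j with O => 0 | S i => coef n i / INR (S n) end).
  assert (Hc : forall y, p (S n) (1 - y) = sum_f_R0 (fun j => c j * y ^ j) (S n)).
  { intros y. rewrite decomp_sum by lia. simpl pred.
    replace (sum_f_R0 (fun i => c (S i) * y ^ S i) n) with
      (y / INR (S n) * p n (- y)).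
    - replace (1 - y) with (- y + 1) by ring.
      pose proof (p_shift n y) as H.
      change (p (S n) (- y)) with (p n (- y) * (1 - - y / INR (S n))) in H.
      change (c O) with 0. rewrite Rmult_0_l, Rplus_0_l.
      replace (y / INR (S n) * p n (- y)) with (p n (- y) * (1 - - y / INR (S n)) - p n (- y))
        by (field; apply INR_S_neq_0). lra.
    - rewrite p_coef, scal_sum. apply sum_eq. intros i _. unfold c. simpl pow. field.
      apply INR_S_neq_0. }
  assert (Hd : forall k, (k <= n)%nat ->
    coef n k = sum_f_R0 (fun j => c j * diff_binom j k) (S n)).
  { apply poly_unique. intros y. rewrite <- p_coef.
    rewrite <- p_shift. replace (- y + 1) with (1 - y) by ring.
    replace (- y) with (1 - (y + 1)) by ring. rewrite !Hc, <- minus_sum.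
    transitivity (sum_f_R0 (fun j => sum_f_R0 (fun k => c j * diff_binom j k * y ^ k) n) (S n)).
    - apply sum_eq. intros j Hj.
      rewrite <- Rmult_minus_distr_l, (diff_pow y j n Hj), scal_sum.
      apply sum_eq; intros; ring.
    - rewrite sum_f_R0_switch. apply sum_eq. intros k _.
      rewrite Rmult_comm, scal_sum. apply sum_eq; intros; ring. }
  transitivity (sum_f_R0 (fun k => sum_f_R0 (fun j => c j * diff_binom j k * B k) (S n)) n).
  { apply sum_eq. intros k Hk. rewrite (Hd k Hk), Rmult_comm, scal_sum.
    apply sum_eq; intros; ring. }
  rewrite sum_f_R0_switch.
  transitivity (sum_f_R0 (fun j => c j * match j with 1%nat => 1 | _ => 0 end) (S n)).
  { apply sum_eq. intros j Hj. rewrite <- (bernoulli_recurrence B j n HB Hj), scal_sum.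
    apply sum_eq; intros; ring. }
  rewrite (sum_f_R0_extend _ 1 (S n)); [| lia | intros [|[|k]] Hk; try lia; ring].
  cbn [sum_f_R0]. unfold c. rewrite coef_0. field. apply INR_S_neq_0.
Qed.

(* Connection coefficients: [p m (x * y) = sum_n conn x m n * p n y]. *)
Fixpoint conn (x : R) (m n : nat) : R :=
  match m with
  | O => match n with O => 1 | S _ => 0 end
  | S m' => (1 - x * INR (S n) / INR (S m')) * conn x m' n +
      match n with
      | O => 0
      | S n' => x * INR (S n') / INR (S m') * conn x m' n'
      end
  end.

(** For [0 <= x <= 1] this is an expectation: [conn x m] is the law after [m] steps of the chain
    started at 0 that jumps from [n] to [n + 1] at step [k] with probability [x * (n + 1) / k]. It
    is a discrete Yule process, whence the geometric limit law. *)
Definition mean (x : R) (m : nat) (phi : nat -> R) : R :=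
  sum_f_R0 (fun n => conn x m n * phi n) m.

Lemma conn_gt (x : R) (m n : nat) : (m < n)%nat -> conn x m n = 0.
Proof.
  revert n; induction m as [|m IH]; intros n H; destruct n as [|n]; try lia; [reflexivity|].
  cbn [conn]. rewrite !IH by lia. ring.
Qed.

(** The recurrence of the weights transposed onto [phi]: one more step replaces [phi] by its
    expected value after the possible jump. *)
Lemma mean_S (x : R) (m : nat) (phi : nat -> R) :
  mean x (S m) phi =
  mean x m (fun n => phi n + x * INR (S n) / INR (S m) * (phi (S n) - phi n)).
Proof.
  unfold mean.
  transitivity (sum_f_R0 (fun n => (1 - x * INR (S n) / INR (S m)) * conn x m n * phi n +
    match n with
    | O => 0
    | S n' => x * INR (S n') / INR (S m) * conn x m n' * phi (S n')
    end) (S m)).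
  - apply sum_eq. intros [|n] _; cbn [conn]; ring.
  - rewrite (sum_f_R0_shift
      (fun n => (1 - x * INR (S n) / INR (S m)) * conn x m n * phi n)
      (fun n => x * INR (S n) / INR (S m) * conn x m n * phi (S n))).
    rewrite tech5, conn_gt by lia.
    rewrite Rmult_0_r, Rmult_0_l, Rplus_0_r, <- plus_sum.
    apply sum_eq; intros; ring.
Qed.

Lemma mean_ext (x : R) (m : nat) (phi psi : nat -> R) :
  (forall n, phi n = psi n) -> mean x m phi = mean x m psi.
Proof. intros H. apply sum_eq. intros; now rewrite H. Qed.

Lemma mean_plus (x : R) (m : nat) (phi psi : nat -> R) :
  mean x m (fun n => phi n + psi n) = mean x m phi + mean x m psi.
Proof. unfold mean. rewrite <- plus_sum. apply sum_eq; intros; ring. Qed.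

Lemma mean_scal (x c : R) (m : nat) (phi : nat -> R) :
  mean x m (fun n => c * phi n) = c * mean x m phi.
Proof. unfold mean. rewrite scal_sum. apply sum_eq; intros; ring. Qed.

(** Since [p (S n) y - p n y = - y / (n + 1) * p n y], the sequence [p n y] is an eigenvector of the
    step in [mean_S], with eigenvalue [1 - x * y / (m + 1)]. *)
Lemma mean_p (x y : R) (m : nat) : mean x m (fun n => p n y) = p m (x * y).
Proof.
  induction m as [|m IH]; [unfold mean; simpl; ring|].
  rewrite mean_S. cbn [p]. rewrite <- IH, Rmult_comm, <- mean_scal.
  apply mean_ext. intros n. cbn [p]. field. split; apply INR_S_neq_0.
Qed.

(** This is [mean_p] read coefficient by coefficient in [- y]; the same induction proves it, with
    the recurrence of [coef] in place of that of [p]. *)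
Lemma mean_coef (x : R) (m j : nat) :
  mean x m (fun n => coef n j) = coef m j * x ^ j.
Proof.
  revert j; induction m as [|m IH]; intros j.
  { unfold mean. destruct j; simpl; ring. }
  rewrite mean_S. destruct j as [|j].
  - rewrite (mean_ext _ _ _ (fun n => coef n 0)).
    + rewrite IH. cbn [coef]. ring.
    + intros n. cbn [coef]. ring.
  - rewrite (mean_ext _ _ _ (fun n => coef n (S j) + x / INR (S m) * coef n j)).
    + rewrite mean_plus, mean_scal, !IH. cbn [coef]. simpl pow. field. apply INR_S_neq_0.
    + intros n. cbn [coef]. field. split; apply INR_S_neq_0.
Qed.

(** The polynomial [G_m], not the classical Bernoulli polynomial of degree [m]. *)
Definition bern_poly (B : nat -> R) (m : nat) (x : R) : R :=
  sum_f_R0 (fun j => coef m j * B j * x ^ j) m.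

Lemma bern_poly_mean (B : nat -> R) (m : nat) (x : R) : bernoulli_numbers B ->
  bern_poly B m x = mean x m (fun n => / INR (S n)).
Proof.
  intros HB.
  (* Each inner sum is lengthened from [n] to [m], where [coef n j] vanishes, so that the two sums
     can be exchanged. *)
  transitivity (mean x m (fun n => sum_f_R0 (fun j => coef n j * B j) m)).
  - unfold bern_poly, mean.
    transitivity (sum_f_R0 (fun j => sum_f_R0 (fun n => conn x m n * coef n j * B j) m) m).
    + apply sum_eq. intros j _.
      replace (coef m j * B j * x ^ j) with (B j * (coef m j * x ^ j)) by ring.
      rewrite <- mean_coef. unfold mean. rewrite scal_sum. apply sum_eq; intros; ring.
    + rewrite sum_f_R0_switch. apply sum_eq. intros n _. rewrite scal_sum.
      apply sum_eq; intros; ring.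
  - unfold mean. apply sum_eq. intros n Hn. f_equal.
    rewrite <- (bernoulli_p B n HB). apply sum_f_R0_extend; [exact Hn|].
    intros k Hk. rewrite coef_gt by exact Hk. ring.
Qed.

(** * Bounds and uniform convergence of the Bernoulli means *)

Lemma harmonic_0 : harmonic 0 = 0.
Proof. unfold harmonic. rewrite sum_n_m_zero by lia. reflexivity. Qed.

Lemma harmonic_S (m : nat) : harmonic (S m) = harmonic m + / INR (S m).
Proof. unfold harmonic. rewrite sum_n_Sm by lia. reflexivity. Qed.

Lemma inv_INR_S_pos (n : nat) : 0 < / INR (S n).
Proof. apply Rinv_0_lt_compat. pose proof (INR_S_ge_1 n). lra. Qed.

Lemma inv_INR_S_le_1 (n : nat) : / INR (S n) <= 1.
Proof. rewrite <- Rinv_1. apply Rinv_le_contravar; [lra | apply INR_S_ge_1]. Qed.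

Lemma harmonic_ge_0 (m : nat) : 0 <= harmonic m.
Proof.
  induction m as [|m IH]; [rewrite harmonic_0; lra|].
  rewrite harmonic_S. pose proof (inv_INR_S_pos m). lra.
Qed.

Lemma exp_ge (t : R) : 1 + t <= exp t.
Proof.
  destruct (Req_dec t 0) as [->|H]; [rewrite exp_0; lra | left; now apply exp_ineq1].
Qed.

Lemma harmonic_ge_ln (m : nat) : ln (INR (S m)) <= harmonic m.
Proof.
  induction m as [|m IH]; [simpl INR; rewrite ln_1, harmonic_0; lra|].
  rewrite harmonic_S.
  pose proof (INR_S_ge_1 m) as H1. pose proof (inv_INR_S_pos m) as H2.
  replace (INR (S (S m))) with (INR (S m) * (1 + / INR (S m)))
    by (rewrite (S_INR (S m)); field; lra).
  rewrite ln_mult by lra.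
  assert (ln (1 + / INR (S m)) <= / INR (S m)); [|lra].
  rewrite <- (ln_exp (/ INR (S m))) at 2. apply ln_le; [lra | apply exp_ge].
Qed.

Lemma harmonic_lim : is_lim_seq harmonic p_infty.
Proof.
  apply is_lim_seq_le_p_loc with (fun m => ln (INR (S m))).
  - exists O. intros; apply harmonic_ge_ln.
  - apply (filterlim_comp _ _ _ (fun m => INR (S m)) ln eventually (Rbar_locally p_infty)).
    + apply (is_lim_seq_incr_1 INR). apply is_lim_seq_INR.
    + apply is_lim_ln_p.
Qed.

Lemma harmonic_eventually (M : R) : eventually (fun m => M < harmonic m).
Proof. apply (harmonic_lim (fun y => M < y)). exists M. auto. Qed.

(** The only factor that could be negative is [1 - x * (n + 1) / (m + 1)], and it multiplies a
    weight that vanishes unless [n <= m]. *)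
Lemma conn_ge_0 (x : R) (m n : nat) : 0 <= x <= 1 -> 0 <= conn x m n.
Proof.
  intros Hx. revert n; induction m as [|m IH]; intros n; [destruct n; simpl; lra|].
  cbn [conn]. apply Rplus_le_le_0_compat.
  - destruct (Nat.le_gt_cases n m) as [H|H]; [|rewrite conn_gt by lia; lra].
    apply Rmult_le_pos; auto.
    assert (INR (S n) * / INR (S m) <= 1).
    { apply Rmult_le_reg_r with (INR (S m)); [apply lt_0_INR; lia|].
      rewrite Rmult_assoc, Rinv_l, Rmult_1_l, Rmult_1_r by apply INR_S_neq_0.
      apply le_INR; lia. }
    assert (0 <= INR (S n) * / INR (S m)).
    { apply Rmult_le_pos; [apply pos_INR | left; apply inv_INR_S_pos]. }
    unfold Rdiv. nra.
  - destruct n as [|n]; [lra|]. apply Rmult_le_pos; auto.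
    unfold Rdiv. repeat apply Rmult_le_pos; [lra | apply pos_INR | left; apply inv_INR_S_pos].
Qed.

Lemma mean_le (x : R) (m : nat) (phi psi : nat -> R) : 0 <= x <= 1 ->
  (forall n, phi n <= psi n) -> mean x m phi <= mean x m psi.
Proof.
  intros Hx H. apply sum_Rle. intros n _. apply Rmult_le_compat_l; auto.
  now apply conn_ge_0.
Qed.

Lemma p_0 (n : nat) : p n 0 = 1.
Proof.
  induction n as [|n IH]; [reflexivity|]. cbn [p]. rewrite IH. field. apply INR_S_neq_0.
Qed.

Lemma mean_const (x c : R) (m : nat) : mean x m (fun _ => c) = c.
Proof.
  rewrite (mean_ext _ _ _ (fun n => c * p n 0)) by (intros; rewrite p_0; ring).
  rewrite mean_scal, mean_p, Rmult_0_r, p_0. ring.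
Qed.

Lemma mean_trunc (x : R) (m K : nat) (phi : nat -> R) :
  (forall k, (K < k)%nat -> phi k = 0) ->
  mean x m phi = sum_f_R0 (fun n => conn x m n * phi n) K.
Proof.
  intros H. unfold mean. destruct (Nat.le_gt_cases K m) as [L|L].
  - apply sum_f_R0_extend; auto. intros k Hk. rewrite H by lia. ring.
  - symmetry. apply sum_f_R0_extend; [lia|]. intros k Hk. rewrite conn_gt by lia. ring.
Qed.

(** Each ratio [n / (n + 1)] is at most the factor [1 - 1 / (2 * n)] up to the index shift. The
    point 1/2 is the largest possible: at [n = 1] the inequality for a general [y] reads
    [1 / 2 <= 1 - y]. *)
Lemma p_half_ge (n : nat) : / INR (S n) <= p n (1 / 2).
Proof.
  induction n as [|n IH]; [simpl; lra|]. cbn [p].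
  pose proof (INR_S_ge_1 n) as H1. pose proof (inv_INR_S_pos n) as H2.
  replace (/ INR (S (S n))) with (/ INR (S n) * (INR (S n) / (INR (S n) + 1)))
    by (rewrite (S_INR (S n)); field; lra).
  apply Rmult_le_compat; [lra | apply Rdiv_le_0_compat; lra | exact IH |].
  apply Rminus_le.
  replace (_ - _) with (- ((INR (S n) - 1) / (2 * INR (S n) * (INR (S n) + 1)))) by (field; lra).
  assert (0 <= (INR (S n) - 1) / (2 * INR (S n) * (INR (S n) + 1))); [|lra].
  apply Rdiv_le_0_compat; nra.
Qed.

Lemma factor_bounds (x : R) (n : nat) : 0 <= x <= 1 -> 0 <= x / INR (S n) <= 1.
Proof.
  intros Hx. pose proof (inv_INR_S_pos n). pose proof (inv_INR_S_le_1 n).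
  unfold Rdiv. nra.
Qed.

(** A product of factors [1 - t] in [[0, 1]] is at least 1 minus the sum of the [t], and at most the
    exponential of minus that sum. *)
Lemma p_bounds (x : R) (m : nat) : 0 <= x <= 1 ->
  0 <= p m x /\ 1 - x * harmonic m <= p m x /\ p m x <= exp (- (x * harmonic m)).
Proof.
  intros Hx. induction m as [|m [I0 [I1 I2]]].
  - rewrite harmonic_0, Rmult_0_r, Ropp_0, exp_0. simpl. lra.
  - cbn [p]. rewrite harmonic_S, Rmult_plus_distr_l.
    fold (x / INR (S m)). pose proof (factor_bounds x m Hx) as Hf.
    set (t := x / INR (S m)) in *.
    assert (p m x <= 1).
    { eapply Rle_trans; [exact I2|]. rewrite <- exp_0. apply exp_le.
      pose proof (harmonic_ge_0 m). nra. }
    repeat split; [nra | nra |].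
    rewrite Ropp_plus_distr, exp_plus. pose proof (exp_ge (- t)).
    apply Rmult_le_compat; lra.
Qed.

(** The upper bound passes through [/ (1 + t)], using [(1 + t) * (1 - t + t ^ 2) = 1 + t ^ 3]. *)
Lemma exp_opp_quadratic (t : R) : 0 <= t -> 0 <= exp (- t) - (1 - t) <= t ^ 2.
Proof.
  intros Ht. split; [pose proof (exp_ge (- t)); lra|].
  assert (exp (- t) <= / (1 + t)).
  { rewrite exp_Ropp. apply Rinv_le_contravar; [lra | apply exp_ge]. }
  assert (/ (1 + t) <= 1 - t + t ^ 2); [|lra].
  apply Rmult_le_reg_r with (1 + t); [lra|]. rewrite Rinv_l by lra.
  assert (0 <= t ^ 3) by (apply pow_le; lra). nra.
Qed.

(** Replacing one factor [1 - t] by [exp (- t)], with [t = x / k], costs at most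
    [t ^ 2 <= x ^ 2 / k], and these costs add up to the bound. It is crude, but at [x = u / h] it is
    [u ^ 2 / h], which tends to 0. *)
Lemma p_approx (x : R) (m : nat) : 0 <= x <= 1 ->
  Rabs (p m x - exp (- (x * harmonic m))) <= x ^ 2 * harmonic m.
Proof.
  intros Hx. induction m as [|m IH].
  - rewrite harmonic_0, Rmult_0_r, Ropp_0, exp_0. simpl.
    rewrite Rminus_diag, Rabs_R0. lra.
  - cbn [p]. rewrite harmonic_S, !Rmult_plus_distr_l.
    fold (x / INR (S m)). pose proof (factor_bounds x m Hx) as Hf.
    assert (Ht : (x / INR (S m)) ^ 2 <= x ^ 2 * / INR (S m)).
    { unfold Rdiv. rewrite Rpow_mult_distr. apply Rmult_le_compat_l; [apply pow2_ge_0|].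
      pose proof (inv_INR_S_pos m). pose proof (inv_INR_S_le_1 m). nra. }
    set (t := x / INR (S m)) in *.
    rewrite Ropp_plus_distr, exp_plus.
    pose proof (exp_opp_quadratic t (proj1 Hf)) as Hq.
    set (E := exp (- (x * harmonic m))) in *.
    assert (HE : 0 < E <= 1).
    { split; [apply exp_pos|]. rewrite <- exp_0. apply exp_le.
      pose proof (harmonic_ge_0 m). nra. }
    replace (p m x * (1 - t) - E * exp (- t)) with
      ((p m x - E) * (1 - t) + - (E * (exp (- t) - (1 - t)))) by ring.
    eapply Rle_trans; [apply Rabs_triang|].
    rewrite Rabs_Ropp, !Rabs_mult, (Rabs_right (1 - t)), (Rabs_right E),
      (Rabs_right (exp (- t) - (1 - t))) by lra.
    pose proof (Rabs_pos (p m x - E)). nra.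
Qed.

Lemma conn_0_r (x : R) (m : nat) : conn x m 0 = p m x.
Proof.
  induction m as [|m IH]; [reflexivity|]. cbn [conn p]. rewrite IH. simpl (INR 1).
  unfold Rdiv. ring.
Qed.

Lemma bern_poly_bounds (B : nat -> R) (m : nat) (x : R) : bernoulli_numbers B ->
  0 <= x <= 1 ->
  0 <= bern_poly B m x /\ 1 - x * harmonic m <= bern_poly B m x /\
  bern_poly B m x <= exp (- (x * harmonic m / 2)).
Proof.
  intros HB Hx. rewrite bern_poly_mean by exact HB.
  destruct (p_bounds x m Hx) as [I0 [I1 _]].
  destruct (p_bounds (x * (1 / 2)) m ltac:(lra)) as [_ [_ I2]].
  (* [p n 1] is 1 at [n = 0] and 0 afterwards, since its first factor vanishes; so it lies below
     [/ (n + 1)]. *)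
  assert (P : p m x <= mean x m (fun n => / INR (S n))).
  { rewrite <- (Rmult_1_r x), <- mean_p, Rmult_1_r. apply mean_le; auto.
    intros [|n]; [simpl; lra|].
    replace (p (S n) 1) with 0; [left; apply inv_INR_S_pos|].
    clear. induction n as [|n IH]; [simpl; field|]. cbn [p] in *. rewrite <- IH. ring. }
  repeat split; [lra | lra |].
  apply Rle_trans with (p m (x * (1 / 2))).
  - rewrite <- mean_p. apply mean_le; auto. intros; apply p_half_ge.
  - replace (x * harmonic m / 2) with (x * (1 / 2) * harmonic m) by field. exact I2.
Qed.

(** * Locally uniform convergence and the geometric limit law *)

Definition cvg_unif (f : nat -> R -> R) (g : R -> R) : Prop :=
  forall A eps, 0 < eps ->
    eventually (fun m => forall u, 0 <= u <= A -> Rabs (f m u - g u) <= eps).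

Lemma cvg_unif_ext (f f' : nat -> R -> R) (g g' : R -> R) :
  (forall m u, f m u = f' m u) -> (forall u, g u = g' u) ->
  cvg_unif f g -> cvg_unif f' g'.
Proof.
  intros E1 E2 H A eps He. generalize (H A eps He). apply filter_imp.
  intros m Hm u Hu. rewrite <- E1, <- E2. auto.
Qed.

Lemma cvg_unif_plus (f f' : nat -> R -> R) (g g' : R -> R) :
  cvg_unif f g -> cvg_unif f' g' ->
  cvg_unif (fun m u => f m u + f' m u) (fun u => g u + g' u).
Proof.
  intros H H' A eps He.
  assert (He' : 0 < eps / 2) by lra.
  generalize (filter_and _ _ (H A _ He') (H' A _ He')).
  apply filter_imp. intros m [H1 H2] u Hu. specialize (H1 u Hu). specialize (H2 u Hu).
  replace (f m u + f' m u - (g u + g' u)) with ((f m u - g u) + (f' m u - g' u)) by ring.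
  eapply Rle_trans; [apply Rabs_triang | lra].
Qed.

Lemma cvg_unif_scal (c : R) (f : nat -> R -> R) (g : R -> R) :
  cvg_unif f g -> cvg_unif (fun m u => c * f m u) (fun u => c * g u).
Proof.
  intros H A eps He. pose proof (Rabs_pos c) as Hc.
  assert (He' : 0 < eps / (Rabs c + 1)) by (apply Rdiv_lt_0_compat; lra).
  generalize (H A _ He'). apply filter_imp. intros m Hm u Hu. specialize (Hm u Hu).
  rewrite <- Rmult_minus_distr_l, Rabs_mult.
  apply Rle_trans with ((Rabs c + 1) * (eps / (Rabs c + 1))); [|right; field; lra].
  apply Rmult_le_compat; try lra. apply Rabs_pos.
Qed.

Lemma cvg_unif_sum (f : nat -> nat -> R -> R) (g : nat -> R -> R) (K : nat) :
  (forall k, (k <= K)%nat -> cvg_unif (f k) (g k)) ->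
  cvg_unif (fun m u => sum_f_R0 (fun k => f k m u) K)
    (fun u => sum_f_R0 (fun k => g k u) K).
Proof.
  induction K as [|K IH]; intros H; [apply (H O); lia|].
  apply (cvg_unif_plus (fun m u => sum_f_R0 (fun k => f k m u) K) (f (S K))
    (fun u => sum_f_R0 (fun k => g k u) K) (g (S K))); [apply IH|]; auto.
Qed.

Lemma p_cvg (c : R) : 0 <= c ->
  cvg_unif (fun m u => p m (u / harmonic m * c)) (fun u => exp (- (c * u))).
Proof.
  intros Hc A eps He.
  set (M := c * Rmax A 0).
  assert (HM : 0 <= M) by (apply Rmult_le_pos; [auto | apply Rmax_r]).
  (* [M < h] puts the argument of [p m] into [[0, 1]], and [M ^ 2 / eps < h] makes the error
     [(c * u) ^ 2 / h] of [p_approx] at most [eps]. *)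
  generalize (filter_and _ _ (harmonic_eventually M) (harmonic_eventually (M ^ 2 / eps))).
  apply filter_imp. intros m [H1 H2] u Hu.
  set (h := harmonic m) in *. assert (Hh : 0 < h) by lra.
  assert (Hx : 0 <= c * u <= M).
  { split; [apply Rmult_le_pos; lra|]. apply Rmult_le_compat_l; auto.
    eapply Rle_trans; [apply Hu | apply Rmax_l]. }
  replace (u / h * c) with (c * u / h) by (field; lra).
  set (x := c * u / h).
  assert (Ex : x * h = c * u) by (unfold x; field; lra).
  assert (Hx1 : 0 <= x <= 1).
  { split; [apply Rdiv_le_0_compat; lra|]. apply Rmult_le_reg_r with h; [auto|].
    rewrite Ex. lra. }
  pose proof (p_approx x m Hx1) as P. fold h in P. rewrite Ex in P.
  eapply Rle_trans; [exact P|].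
  replace (x ^ 2 * h) with ((c * u) ^ 2 / h) by (rewrite <- Ex; field; lra).
  apply Rmult_le_reg_r with h; [auto|].
  replace ((c * u) ^ 2 / h * h) with ((c * u) ^ 2) by (field; lra).
  apply Rle_trans with (M ^ 2); [apply pow_incr; lra|].
  apply Rlt_le. apply Rmult_lt_reg_r with (/ eps); [now apply Rinv_0_lt_compat|].
  replace (eps * h * / eps) with h by (field; lra). exact H2.
Qed.

(** The factors are [- (n + 1 - j) / j]; the one with [j = n + 1] is zero. This vanishing makes the
    system for the [conn x m n] triangular. *)
Lemma p_nat (n k : nat) :
  p k (INR (S n)) = if (k <=? n)%nat then (-1) ^ k * Binomial.C n k else 0.
Proof.
  induction k as [|k IH].
  - simpl. unfold Binomial.C. rewrite Nat.sub_0_r. simpl fact. change (INR 1) with 1.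
    field. apply INR_fact_neq_0.
  - cbn [p]. rewrite IH. destruct (Nat.leb_spec k n) as [H|H].
    + destruct (Nat.leb_spec (S k) n) as [H'|H'].
      * rewrite pascal_step3 by lia. rewrite minus_INR by lia. rewrite !S_INR. simpl pow.
        field. pose proof (pos_INR k). lra.
      * replace k with n by lia. unfold Rdiv. rewrite Rinv_r by apply INR_S_neq_0. ring.
    + destruct (Nat.leb_spec (S k) n); [lia | ring].
Qed.

Definition geom (n : nat) (u : R) : R := exp (- u) * (1 - exp (- u)) ^ n.

(** The limit form of [mean_p] at [y = n + 1]: by [p_nat] it is the binomial expansion of
    [(1 - v) ^ n] with [v = 1 - exp (- u)]. *)
Lemma geom_sum (n : nat) (u : R) :
  sum_f_R0 (fun k => p k (INR (S n)) * geom k u) n = exp (- (INR (S n) * u)).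
Proof.
  transitivity (exp (- u) * (- (1 - exp (- u)) + 1) ^ n).
  - rewrite binomial, scal_sum. apply sum_eq. intros k Hk. rewrite p_nat, pow1.
    destruct (Nat.leb_spec k n); [|lia]. unfold geom.
    replace ((- (1 - exp (- u))) ^ k) with ((-1) ^ k * (1 - exp (- u)) ^ k)
      by (rewrite <- Rpow_mult_distr; f_equal; ring).
    ring.
  - replace (- (1 - exp (- u)) + 1) with (exp (- u)) by ring.
    induction n as [|n IH]; [simpl; now rewrite Rmult_1_r, Rmult_1_l|].
    rewrite (S_INR (S n)), Rmult_plus_distr_r, Ropp_plus_distr, exp_plus, <- IH, Rmult_1_l.
    simpl pow. ring.
Qed.

(* At [y = n + 1] the connection formula only involves the terms [k <= n], which gives
   [conn x m n] in terms of [p m ((n + 1) x)] and the previous ones. *)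
Lemma conn_cvg (n : nat) : cvg_unif (fun m u => conn (u / harmonic m) m n) (geom n).
Proof.
  induction n as [n IH] using lt_wf_ind.
  pose proof (p_cvg (INR (S n)) (pos_INR _)) as H.
  destruct n as [|n].
  - revert H. apply cvg_unif_ext.
    + intros m u. rewrite conn_0_r. simpl INR. now rewrite Rmult_1_r.
    + intros u. unfold geom. simpl. rewrite Rmult_1_l. ring.
  - set (c := p (S n) (INR (S (S n)))).
    assert (Hc : c <> 0).
    { unfold c. rewrite p_nat, Nat.leb_refl. unfold Binomial.C.
      rewrite Nat.sub_diag. change (INR (fact 0)) with 1.
      apply Rmult_integral_contrapositive_currified; [apply pow_nonzero; lra|].
      rewrite Rmult_1_r, Rdiv_diag by apply INR_fact_neq_0. lra. }
    assert (H2 : cvg_unif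
      (fun m u => sum_f_R0 (fun k => p k (INR (S (S n))) * conn (u / harmonic m) m k) n)
      (fun u => sum_f_R0 (fun k => p k (INR (S (S n))) * geom k u) n)).
    { apply (cvg_unif_sum (fun k m u => p k (INR (S (S n))) * conn (u / harmonic m) m k)
        (fun k u => p k (INR (S (S n))) * geom k u)).
      intros k Hk. apply (cvg_unif_scal _ (fun m u => conn (u / harmonic m) m k)).
      apply IH. lia. }
    apply (cvg_unif_scal (-1)) in H2.
    generalize (cvg_unif_scal (/ c) _ _ (cvg_unif_plus _ _ _ _ H H2)).
    apply cvg_unif_ext.
    + intros m u. rewrite <- mean_p. rewrite (mean_trunc _ _ (S n)).
      * rewrite tech5. fold c.
        rewrite (sum_eq (fun k => p k (INR (S (S n))) * conn (u / harmonic m) m k)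
          (fun k => conn (u / harmonic m) m k * p k (INR (S (S n))))) by (intros; ring).
        field. exact Hc.
      * intros k Hk. rewrite p_nat. destruct (Nat.leb_spec k (S n)); [lia | reflexivity].
    + intros u. rewrite <- (geom_sum (S n) u), tech5. fold c. field. exact Hc.
Qed.

(** * The generating function [g] and comparison with the means *)

Definition bern_gf (u : R) : R := u / (exp u - 1).

Lemma is_derive_eq (f : R -> R) (x l l' : R) :
  is_derive f x l -> l = l' -> is_derive f x l'.
Proof. now intros H <-. Qed.

(** With [v = 1 - exp (- u)], these are partial sums of [- ln (1 - v) = u]. The remainder [r] has
    derivative [v ^ (K + 1)]. The factor [exp u] in the majorant [M] cancels [v' = exp (- u)], so
    [M' = v ^ (K + 1) + M] dominates [r'], and both vanish at 0. *)
Lemma log_series_remainder (K : nat) (u : R) : 0 <= u ->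
  0 <= u - sum_f_R0 (fun n => (1 - exp (- u)) ^ S n / INR (S n)) K
    <= (1 - exp (- u)) ^ S (S K) * exp u / INR (S (S K)).
Proof.
  intros Hu.
  set (v := fun u => 1 - exp (- u)).
  assert (Hv : forall u, 0 <= u -> 0 <= v u < 1).
  { intros w Hw. unfold v. pose proof (exp_pos (- w)).
    assert (exp (- w) <= exp 0) by (apply exp_le; lra). rewrite exp_0 in *. lra. }
  set (r := fun u => u - sum_f_R0 (fun n => v u ^ S n / INR (S n)) K).
  assert (Dr : forall u, is_derive r u (v u ^ S K)).
  { intros w. unfold r. clear. induction K as [|K IH].
    - simpl sum_f_R0. unfold v. auto_derive; [auto|]. simpl. field.
    - apply (is_derive_ext (fun u => (u - sum_f_R0 (fun n => v u ^ S n / INR (S n)) K)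
        - v u ^ S (S K) / INR (S (S K)))).
      { intros t. rewrite tech5. unfold Rminus. now rewrite Ropp_plus_distr, Rplus_assoc. }
      eapply is_derive_eq.
      + apply (is_derive_minus (fun u => u - sum_f_R0 (fun n => v u ^ S n / INR (S n)) K)
          (fun u => v u ^ S (S K) / INR (S (S K)))); [apply IH|].
        unfold v. auto_derive; auto.
      + unfold minus, plus, opp; simpl. fold (v w).
        change (match K with O => 1 | S _ => INR K + 1 end) with (INR (S K)).
        change (1 + - exp (- w)) with (v w).
        replace (exp (- w)) with (1 - v w) by (unfold v; ring).
        field. rewrite <- S_INR. apply INR_S_neq_0. }
  set (M := fun u => v u ^ S (S K) * exp u / INR (S (S K))).
  assert (DM : forall u, is_derive M u (v u ^ S K + M u)).
  { intros w. unfold M, v. auto_derive; [auto|]. simpl.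
    change (match K with O => 1 | S _ => INR K + 1 end) with (INR (S K)).
    change (1 + - exp (- w)) with (v w). change (1 - exp (- w)) with (v w).
    assert (E : exp w = / (1 - v w)).
    { unfold v. rewrite exp_Ropp. pose proof (exp_pos w). field. lra. }
    rewrite E. replace (exp (- w)) with (1 - v w) by (unfold v; ring).
    field. rewrite <- S_INR. split; [|apply INR_S_neq_0].
    unfold v. pose proof (exp_pos (- w)). lra. }
  assert (V0 : v 0 = 0) by (unfold v; rewrite Ropp_0, exp_0; ring).
  assert (r0 : r 0 = 0).
  { unfold r. rewrite sum_eq_R0; [ring|]. intros n _. rewrite V0.
    rewrite <- tech_pow_Rmult. unfold Rdiv. ring. }
  assert (M0 : M 0 = 0).
  { unfold M. rewrite V0, <- tech_pow_Rmult. unfold Rdiv. ring. }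
  assert (HM : forall w, 0 <= w -> 0 <= M w).
  { intros w Hw. unfold M. apply Rdiv_le_0_compat; [|apply lt_0_INR; lia].
    apply Rmult_le_pos; [apply pow_le, Hv, Hw | left; apply exp_pos]. }
  change (0 <= r u <= M u). split.
  - pose proof (mean_value_R (fun _ => 0) (fun _ => 0) r (fun u => v u ^ S K) 0 u Hu) as H.
    rewrite Rminus_diag, Rabs_R0 in H. rewrite r0 in H.
    enough (0 <= r u - 0) by lra. apply H.
    + intros; auto_derive; auto.
    + intros; apply Dr.
    + intros x Hx. apply pow_le, Hv; lra.
  - pose proof (mean_value_R r (fun u => v u ^ S K) M (fun u => v u ^ S K + M u) 0 u Hu) as H.
    rewrite r0, M0, !Rminus_0_r in H. eapply Rle_trans; [apply Rle_abs|]. apply H.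
    + intros; apply Dr.
    + intros; apply DM.
    + intros x Hx. assert (0 <= v x ^ S K) by (apply pow_le, Hv; lra).
      rewrite Rabs_right by lra. pose proof (HM x ltac:(lra)). lra.
Qed.

(** [bern_gf u = exp (- u) / v * u] is the mean of [/ (n + 1)] under the geometric law. Multiplying
    the logarithmic remainder by [exp (- u) / v] removes [exp u], so the bound is uniform in [u]. *)
Lemma bern_gf_series (K : nat) (u : R) : 0 < u ->
  0 <= bern_gf u - sum_f_R0 (fun n => geom n u * / INR (S n)) K <= / INR (S (S K)).
Proof.
  intros Hu. destruct (log_series_remainder K u ltac:(lra)) as [H1 H2].
  set (v := 1 - exp (- u)) in *.
  assert (He : 0 < exp (- u)) by apply exp_pos.
  assert (He1 : exp (- u) < 1) by (rewrite <- exp_0; apply exp_increasing; lra).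
  assert (Hv : 0 < v < 1) by (unfold v; lra).
  assert (Ee : exp u * exp (- u) = 1) by (rewrite <- exp_plus, Rplus_opp_r; apply exp_0).
  assert (Eg : bern_gf u = exp (- u) / v * u).
  { unfold bern_gf. replace (exp u) with (/ exp (- u)) by (rewrite exp_Ropp, Rinv_inv; auto).
    unfold v. field. lra. }
  assert (Es : sum_f_R0 (fun n => geom n u * / INR (S n)) K =
    exp (- u) / v * sum_f_R0 (fun n => v ^ S n / INR (S n)) K).
  { rewrite scal_sum. apply sum_eq. intros n _. unfold geom. fold v. rewrite <- tech_pow_Rmult.
    field. split; [lra | apply INR_S_neq_0]. }
  rewrite Eg, Es, <- Rmult_minus_distr_l.
  assert (Hc : 0 < exp (- u) / v) by (apply Rdiv_lt_0_compat; lra).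
  split; [apply Rmult_le_pos; lra|].
  eapply Rle_trans; [apply Rmult_le_compat_l; [lra | exact H2]|].
  replace (exp (- u) / v * (v ^ S (S K) * exp u / INR (S (S K)))) with
    ((exp u * exp (- u)) * v ^ S K * / INR (S (S K)))
    by (rewrite <- (tech_pow_Rmult v (S K)); field; split; [apply INR_S_neq_0 | lra]).
  rewrite Ee, Rmult_1_l.
  assert (v ^ S K <= 1) by (rewrite <- (pow1 (S K)); apply pow_incr; lra).
  pose proof (inv_INR_S_pos (S K)). nra.
Qed.

(** The omitted weights have total at most 1 and multiply values at most [/ (K + 2)]. *)
Lemma mean_inv_trunc (x : R) (m K : nat) : 0 <= x <= 1 ->
  0 <= mean x m (fun n => / INR (S n)) - sum_f_R0 (fun n => conn x m n * / INR (S n)) K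
    <= / INR (S (S K)).
Proof.
  intros Hx.
  set (phi := fun n => if (n <=? K)%nat then / INR (S n) else 0).
  assert (E : sum_f_R0 (fun n => conn x m n * / INR (S n)) K = mean x m phi).
  { rewrite (mean_trunc _ _ K).
    - apply sum_eq. intros n Hn. unfold phi. destruct (Nat.leb_spec n K); [reflexivity | lia].
    - intros k Hk. unfold phi. destruct (Nat.leb_spec k K); [lia | reflexivity]. }
  rewrite E.
  assert (L : mean x m phi <= mean x m (fun n => / INR (S n))).
  { apply mean_le; auto. intros n. unfold phi. destruct (n <=? K)%nat; [lra|].
    left; apply inv_INR_S_pos. }
  assert (U : mean x m (fun n => / INR (S n)) <= mean x m (fun n => phi n + / INR (S (S K)))).
  { apply mean_le; auto. intros n. unfold phi. destruct (Nat.leb_spec n K) as [H|H].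
    - pose proof (inv_INR_S_pos (S K)). lra.
    - rewrite Rplus_0_l. apply Rinv_le_contravar; [apply lt_0_INR; lia|]. apply le_INR; lia. }
  rewrite mean_plus, mean_const in U. lra.
Qed.

Lemma exp_sub_exp_ge (t : R) : 0 <= t -> 2 * t <= exp t - exp (- t).
Proof.
  intros Ht.
  pose proof (mean_value_R (fun _ => 0) (fun _ => 0)
    (fun t => exp t - exp (- t) - 2 * t) (fun t => exp t + exp (- t) - 2) 0 t Ht) as H.
  cbv beta in H. rewrite Ropp_0, exp_0, (Rminus_diag 0), Rabs_R0 in H.
  enough (0 <= exp t - exp (- t) - 2 * t - (1 - 1 - 2 * 0)) by lra.
  apply H.
  - intros; auto_derive; auto.
  - intros; auto_derive; auto; ring.
  - intros x _. rewrite exp_Ropp. pose proof (exp_pos x).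
    apply Rmult_le_reg_r with (exp x); [auto|].
    replace ((exp x + / exp x - 2) * exp x) with ((exp x - 1) ^ 2) by (field; lra).
    rewrite Rmult_0_l. apply pow2_ge_0.
Qed.

(** The upper bound is [u / 2 <= sinh (u / 2)]. The bounds are those of [bern_poly] at [u / h], so
    that both functions lie in the same window. *)
Lemma bern_gf_bounds (u : R) : 0 < u ->
  0 <= bern_gf u /\ 1 - u <= bern_gf u /\ bern_gf u <= exp (- (u / 2)).
Proof.
  intros Hu. unfold bern_gf. pose proof (exp_ge u) as H1.
  assert (Hd : 0 < exp u - 1) by lra.
  repeat split.
  - apply Rdiv_le_0_compat; lra.
  - apply Rmult_le_reg_r with (exp u - 1); [auto|].
    replace (u / (exp u - 1) * (exp u - 1)) with u by (field; lra).
    pose proof (exp_ge (- u)) as H2. pose proof (exp_pos u) as H3.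
    assert (E : exp u * exp (- u) = 1) by (rewrite <- exp_plus, Rplus_opp_r; apply exp_0).
    nra.
  - apply Rmult_le_reg_r with (exp u - 1); [auto|].
    replace (u / (exp u - 1) * (exp u - 1)) with u by (field; lra).
    rewrite Rmult_minus_distr_l, <- exp_plus, Rmult_1_r.
    replace (- (u / 2) + u) with (u / 2) by field.
    pose proof (exp_sub_exp_ge (u / 2)). lra.
Qed.

(** The convergence is uniform on the growing range [(0, h]]: up to [A], finitely many terms
    converge by [conn_cvg] and the tails are small for all [m] and [u]; beyond [A], the exponential
    bounds suffice. *)
Lemma bern_poly_cvg (B : nat -> R) (eta : R) : bernoulli_numbers B -> 0 < eta ->
  eventually (fun m => forall u, 0 < u <= harmonic m ->
    Rabs (bern_poly B m (u / harmonic m) - bern_gf u) <= eta).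
Proof.
  intros HB He.
  destruct (nfloor_ex (4 / eta)) as [K HK]; [apply Rdiv_le_0_compat; lra|].
  assert (HK' : / INR (S (S K)) <= eta / 4).
  { replace (eta / 4) with (/ (4 / eta)) by (field; lra).
    apply Rinv_le_contravar; [apply Rdiv_lt_0_compat; lra|]. rewrite !S_INR. lra. }
  (* As [exp (u / 2) >= 1 + u / 2], beyond this [A] both functions lie in [[0, eta]]. *)
  set (A := 2 / eta).
  assert (H : cvg_unif
    (fun m u => sum_f_R0 (fun n => / INR (S n) * conn (u / harmonic m) m n) K)
    (fun u => sum_f_R0 (fun n => / INR (S n) * geom n u) K)).
  { apply (cvg_unif_sum (fun n m u => / INR (S n) * conn (u / harmonic m) m n)
      (fun n u => / INR (S n) * geom n u)).
    intros k _. apply (cvg_unif_scal _ (fun m u => conn (u / harmonic m) m k)).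
    apply conn_cvg. }
  assert (He2 : 0 < eta / 2) by lra.
  generalize (H A _ He2). apply filter_imp. intros m Hm u Hu.
  assert (Hx : 0 <= u / harmonic m <= 1).
  { split; [apply Rdiv_le_0_compat; lra|]. apply Rmult_le_reg_r with (harmonic m); [lra|].
    unfold Rdiv. rewrite Rmult_assoc, Rinv_l by lra. lra. }
  destruct (Rle_lt_dec u A) as [HA|HA].
  - specialize (Hm u ltac:(lra)).
    rewrite bern_poly_mean by exact HB.
    pose proof (mean_inv_trunc (u / harmonic m) m K Hx) as H1.
    pose proof (bern_gf_series K u ltac:(lra)) as H2.
    rewrite (sum_eq _ (fun n => / INR (S n) * conn (u / harmonic m) m n)) in H1
      by (intros; ring).
    rewrite (sum_eq _ (fun n => / INR (S n) * geom n u)) in H2 by (intros; ring).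
    apply Rabs_le_between in Hm. apply Rabs_le_between. lra.
  - destruct (bern_poly_bounds B m _ HB Hx) as [B1 [_ B2]].
    destruct (bern_gf_bounds u ltac:(lra)) as [G1 [_ G2]].
    replace (u / harmonic m * harmonic m / 2) with (u / 2) in B2 by (field; lra).
    assert (exp (- (u / 2)) <= eta).
    { rewrite exp_Ropp. replace eta with (/ (/ eta)) by (field; lra).
      apply Rinv_le_contravar; [now apply Rinv_0_lt_compat|].
      pose proof (exp_ge (u / 2)). unfold A in HA.
      assert (/ eta = 2 / eta / 2) by (field; lra). lra. }
    apply Rabs_le_between. lra.
Qed.

(** The window has width at most [u] and height at most [exp (- (u / 2))]; the bound combines both,
    by cases on [u <= 1]. The factor [u] is what compensates [u^(s-2)] at 0. *)
Lemma sandwich_diff (u v w : R) : 0 < u ->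
  0 <= v /\ 1 - u <= v /\ v <= exp (- (u / 2)) ->
  0 <= w /\ 1 - u <= w /\ w <= exp (- (u / 2)) ->
  Rabs (v - w) <= 2 * u * exp (- (u / 4)).
Proof.
  intros Hu [V0 [V1 V2]] [W0 [W1 W2]].
  assert (E : exp (- (u / 2)) = exp (- (u / 4)) * exp (- (u / 4)))
    by (rewrite <- exp_plus; f_equal; field).
  pose proof (exp_pos (- (u / 4))) as P. set (e := exp (- (u / 4))) in *.
  assert (He : e <= 1) by (unfold e; rewrite <- exp_0; apply exp_le; lra).
  assert (Rabs (v - w) <= u /\ Rabs (v - w) <= e * e) as [D1 D2].
  { split; apply Rabs_le_between; split; nra. }
  destruct (Rle_lt_dec u 1) as [H|H].
  - assert (1 / 2 <= e); [|nra].
    unfold e. pose proof (exp_ge (- (u / 4))). lra.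
  - nra.
Qed.

(** * Improper integrals of complex functions *)

(** Componentwise, so that real integration applies; [improper_RInt_gen] leads back to the integral
    in the definition of [Gamma]. *)
Definition is_CInt (f : R -> C) (a b : R) (l : C) : Prop :=
  is_RInt (fun t => Re (f t)) a b (Re l) /\ is_RInt (fun t => Im (f t)) a b (Im l).

Lemma C_ext (z w : C) : Re z = Re w -> Im z = Im w -> z = w.
Proof. destruct z, w; simpl; intros; subst; reflexivity. Qed.

Lemma is_CInt_unique (f : R -> C) (a b : R) (l l' : C) :
  is_CInt f a b l -> is_CInt f a b l' -> l = l'.
Proof.
  intros [H1 H2] [H1' H2']. apply C_ext.
  - rewrite <- (is_RInt_unique _ _ _ _ H1). now apply is_RInt_unique.
  - rewrite <- (is_RInt_unique _ _ _ _ H2). now apply is_RInt_unique.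
Qed.

Lemma is_CInt_plus (f g : R -> C) (a b : R) (l m : C) :
  is_CInt f a b l -> is_CInt g a b m -> is_CInt (fun t => f t + g t)%C a b (l + m)%C.
Proof.
  intros [H1 H2] [H3 H4]; split; simpl.
  - apply (is_RInt_plus _ _ _ _ _ _ H1 H3).
  - apply (is_RInt_plus _ _ _ _ _ _ H2 H4).
Qed.

Lemma is_CInt_Cmult (c : C) (f : R -> C) (a b : R) (l : C) :
  is_CInt f a b l -> is_CInt (fun t => c * f t)%C a b (c * l)%C.
Proof.
  intros [H1 H2]; split; simpl.
  - apply (is_RInt_minus (fun t => fst c * Re (f t)) (fun t => snd c * Im (f t)));
      now apply (is_RInt_scal (V := R_NormedModule)).
  - apply (is_RInt_plus (fun t => fst c * Im (f t)) (fun t => snd c * Re (f t)));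
      now apply (is_RInt_scal (V := R_NormedModule)).
Qed.

Lemma is_CInt_minus (f g : R -> C) (a b : R) (l m : C) :
  is_CInt f a b l -> is_CInt g a b m -> is_CInt (fun t => f t - g t)%C a b (l - m)%C.
Proof.
  intros [H1 H2] [H3 H4]; split; simpl.
  - apply (is_RInt_minus _ _ _ _ _ _ H1 H3).
  - apply (is_RInt_minus _ _ _ _ _ _ H2 H4).
Qed.

Lemma is_CInt_ext (f g : R -> C) (a b : R) (l : C) : a <= b ->
  (forall x, a < x < b -> f x = g x) -> is_CInt f a b l -> is_CInt g a b l.
Proof.
  intros Hab E [H1 H2].
  split; (eapply is_RInt_ext; [|eassumption]); intros x;
    rewrite Rmin_left, Rmax_right by assumption; intros Hx; simpl; now rewrite E.
Qed.

Lemma is_CInt_Chasles (f : R -> C) (a b c : R) (l m : C) :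
  is_CInt f a b l -> is_CInt f b c m -> is_CInt f a c (l + m)%C.
Proof.
  intros [H1 H2] [H3 H4]; split; simpl.
  - apply (is_RInt_Chasles _ _ _ _ _ _ H1 H3).
  - apply (is_RInt_Chasles _ _ _ _ _ _ H2 H4).
Qed.

Lemma is_CInt_point (f : R -> C) (a : R) : is_CInt f a a 0%C.
Proof. split; apply (is_RInt_point (V := R_NormedModule)). Qed.

Lemma is_CInt_bound (f : R -> C) (df : R -> R) (a b : R) (l : C) (L : R) : a <= b ->
  is_CInt f a b l -> is_RInt df a b L ->
  (forall x, a <= x <= b -> Cmod (f x) <= df x) -> Cmod l <= 2 * L.
Proof.
  intros Hab [H1 H2] HL Hb. apply Cmod_le_2.
  - apply (norm_RInt_le (V := R_NormedModule) (fun t => Re (f t)) df a b); auto.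
    intros x Hx. eapply Rle_trans; [apply re_le_Cmod | auto].
  - apply (norm_RInt_le (V := R_NormedModule) (fun t => Im (f t)) df a b); auto.
    intros x Hx. eapply Rle_trans; [apply im_le_Cmod | auto].
Qed.

Definition ex_Rderive (f : R -> C) (x : R) : Prop := exists l, is_Rderive f x l.

Lemma ex_Rderive_mult (f g : R -> C) (x : R) :
  ex_Rderive f x -> ex_Rderive g x -> ex_Rderive (fun x => f x * g x)%C x.
Proof. intros [l H] [m H']. eexists. apply is_Rderive_mult; eassumption. Qed.

Lemma ex_Rderive_plus (f g : R -> C) (x : R) :
  ex_Rderive f x -> ex_Rderive g x -> ex_Rderive (fun x => f x + g x)%C x.
Proof. intros [l H] [m H']. eexists. apply is_Rderive_plus; eassumption. Qed.

Lemma ex_Rderive_const (c : C) (x : R) : ex_Rderive (fun _ => c) x.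
Proof. eexists. apply is_Rderive_const. Qed.

Lemma ex_Rderive_Cpow_pos (s : C) (x : R) : 0 < x -> ex_Rderive (fun t => Cpow_pos t s) x.
Proof. intros H. eexists. now apply is_Rderive_Cpow_pos. Qed.

Lemma ex_Rderive_RtoC (f : R -> R) (x : R) :
  ex_derive f x -> ex_Rderive (fun x => RtoC (f x)) x.
Proof. intros [l H]. eexists. apply is_Rderive_RtoC, H. Qed.

Lemma ex_Rderive_continuous (f : R -> C) (x : R) : ex_Rderive f x ->
  continuous (fun t => Re (f t)) x /\ continuous (fun t => Im (f t)) x.
Proof.
  intros [l [H1 H2]]; split.
  - apply (ex_derive_continuous (fun t => Re (f t))). eexists; apply H1.
  - apply (ex_derive_continuous (fun t => Im (f t))). eexists; apply H2.
Qed.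

Lemma is_CInt_derive (G dG : R -> C) (a b : R) : a <= b ->
  (forall x, a <= x <= b -> is_Rderive G x (dG x)) ->
  (forall x, a <= x <= b -> ex_Rderive dG x) ->
  is_CInt dG a b (G b - G a)%C.
Proof.
  intros Hab H1 H2; split.
  - apply (is_RInt_derive (fun t => Re (G t)) (fun t => Re (dG t)));
      rewrite Rmin_left, Rmax_right by assumption; intros x Hx.
    + apply (H1 x Hx).
    + apply ex_Rderive_continuous, H2, Hx.
  - apply (is_RInt_derive (fun t => Im (G t)) (fun t => Im (dG t)));
      rewrite Rmin_left, Rmax_right by assumption; intros x Hx.
    + apply (H1 x Hx).
    + apply ex_Rderive_continuous, H2, Hx.
Qed.

Lemma ex_CInt (f : R -> C) (a b : R) : 0 < a -> 0 < b ->
  (forall x, 0 < x -> ex_Rderive f x) -> exists l, is_CInt f a b l.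
Proof.
  intros Ha Hb H.
  assert (Hm : 0 < Rmin a b) by (apply Rmin_glb_lt; auto).
  destruct (ex_RInt_continuous (V := R_CompleteNormedModule) (fun t => Re (f t)) a b)
    as [x Hx].
  { intros z Hz. apply ex_Rderive_continuous, H. lra. }
  destruct (ex_RInt_continuous (V := R_CompleteNormedModule) (fun t => Im (f t)) a b)
    as [y Hy].
  { intros z Hz. apply ex_Rderive_continuous, H. lra. }
  exists (x, y). split; assumption.
Qed.

(* [dom t u] is of the order of [u^(t-1)] at [0] and of [u^(-t-1)] at infinity, and has the
   explicit primitive [dom_int t], of total increase [/ t] over [(0, oo)]. *)
Definition dom (t u : R) : R := Rpower u t / (u * (1 + Rpower u t) ^ 2).
Definition dom_int (t u : R) : R := / t * (1 - / (1 + Rpower u t)).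

Lemma Rpower_pos (x y : R) : 0 < Rpower x y.
Proof. apply exp_pos. Qed.

Lemma is_derive_dom_int (t u : R) : 0 < t -> 0 < u ->
  is_derive (dom_int t) u (dom t u).
Proof.
  intros Ht Hu. unfold dom_int, dom, Rpower. pose proof (exp_pos (t * ln u)).
  auto_derive.
  - split; [exact Hu | split; [lra | auto]].
  - field. repeat split; lra.
Qed.

Lemma is_RInt_dom (t M a b : R) : 0 < t -> 0 < a <= b ->
  is_RInt (fun u => M * dom t u) a b (M * (dom_int t b - dom_int t a)).
Proof.
  intros Ht Ha. apply (is_RInt_scal (V := R_NormedModule) (dom t)).
  apply (is_RInt_derive (dom_int t) (dom t));
    rewrite Rmin_left, Rmax_right by lra; intros x Hx.
  - apply is_derive_dom_int; lra.
  - apply (ex_derive_continuous (dom t)). unfold dom, Rpower.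
    pose proof (exp_pos (t * ln x)).
    auto_derive. repeat split; try lra.
    repeat apply Rmult_integral_contrapositive_currified; lra.
Qed.

Lemma dom_int_bounds (t u : R) : 0 < t -> 0 < u ->
  0 < dom_int t u < / t /\ dom_int t u <= / t * Rpower u t /\
  / t - dom_int t u <= / t * Rpower u (- t).
Proof.
  intros Ht Hu. unfold dom_int. pose proof (Rpower_pos u t) as Hp.
  assert (0 < / t) by now apply Rinv_0_lt_compat.
  rewrite Rpower_Ropp.
  assert (E1 : 0 < / (1 + Rpower u t)) by (apply Rinv_0_lt_compat; lra).
  assert (E2 : / (1 + Rpower u t) < 1)
    by (rewrite <- Rinv_1; apply Rinv_lt_contravar; lra).
  assert (E3 : 1 - / (1 + Rpower u t) <= Rpower u t).
  { replace (1 - / (1 + Rpower u t)) with (Rpower u t * / (1 + Rpower u t)) by (field; lra). nra. }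
  assert (E4 : / (1 + Rpower u t) <= / Rpower u t) by (apply Rinv_le_contravar; lra).
  repeat split; nra.
Qed.

Lemma dom_int_incr (t a b : R) : 0 < t -> 0 < a <= b -> dom_int t a <= dom_int t b.
Proof.
  intros Ht Hab. unfold dom_int. apply Rmult_le_compat_l; [left; now apply Rinv_0_lt_compat|].
  pose proof (Rpower_pos a t). pose proof (Rpower_pos b t).
  assert (Rpower a t <= Rpower b t) by (apply Rle_Rpower_l; lra).
  assert (/ (1 + Rpower b t) <= / (1 + Rpower a t)) by (apply Rinv_le_contravar; lra).
  lra.
Qed.

Lemma Rpower_small (t eps : R) : 0 < t -> 0 < eps ->
  exists d, 0 < d /\ forall u, 0 < u < d -> Rpower u t < eps.
Proof.
  intros Ht He. exists (Rpower eps (/ t)). split; [apply Rpower_pos|].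
  intros u Hu. replace eps with (Rpower (Rpower eps (/ t)) t).
  - apply Rlt_Rpower_l; auto.
  - rewrite Rpower_mult, Rinv_l, Rpower_1 by lra. reflexivity.
Qed.

Lemma Rpower_opp_small (t eps : R) : 0 < t -> 0 < eps ->
  exists A, 0 < A /\ forall u, A < u -> Rpower u (- t) < eps.
Proof.
  intros Ht He. destruct (Rpower_small t eps Ht He) as [d [Hd H]].
  exists (/ d). split; [now apply Rinv_0_lt_compat|]. intros u Hu.
  assert (0 < / d) by now apply Rinv_0_lt_compat.
  replace (Rpower u (- t)) with (Rpower (/ u) t).
  - apply H. split; [apply Rinv_0_lt_compat; lra|].
    rewrite <- (Rinv_inv d). apply Rinv_lt_contravar; [|exact Hu].
    apply Rmult_lt_0_compat; lra.
  - unfold Rpower. rewrite ln_Rinv by lra. f_equal. ring.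
Qed.

(** Both endpoints move independently, and integrability on each [[a, b]] is part of the claim;
    [d <= A] guarantees [a < b]. *)
Definition improper (f : R -> C) (l : C) : Prop :=
  forall eps, 0 < eps -> exists d A, 0 < d /\ d <= A /\
    forall a b, 0 < a < d -> A < b -> exists z, is_CInt f a b z /\ Cmod (z - l) < eps.

Lemma improper_plus (f g : R -> C) (l m : C) :
  improper f l -> improper g m -> improper (fun t => f t + g t)%C (l + m)%C.
Proof.
  intros H H' eps He.
  destruct (H (eps / 2)) as [d [A [Hd [HA P]]]]; [lra|].
  destruct (H' (eps / 2)) as [d' [A' [Hd' [HA' P']]]]; [lra|].
  exists (Rmin d d'), (Rmax A A').
  pose proof (Rmin_l d d'). pose proof (Rmin_r d d').
  pose proof (Rmax_l A A'). pose proof (Rmax_r A A').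
  split; [apply Rmin_glb_lt; auto|]. split; [lra|].
  intros a b Ha Hb.
  destruct (P a b) as [z [Hz1 Hz2]]; [lra | lra |].
  destruct (P' a b) as [z' [Hz1' Hz2']]; [lra | lra |].
  exists (z + z')%C. split; [now apply is_CInt_plus|].
  replace (z + z' - (l + m))%C with ((z - l) + (z' - m))%C by ring.
  eapply Rle_lt_trans; [apply Cmod_triangle | lra].
Qed.

Lemma improper_Cmult (c : C) (f : R -> C) (l : C) :
  improper f l -> improper (fun t => c * f t)%C (c * l)%C.
Proof.
  intros H eps He. pose proof (Cmod_ge_0 c) as Hc.
  assert (He' : 0 < eps / (Cmod c + 1)) by (apply Rdiv_lt_0_compat; lra).
  destruct (H _ He') as [d [A [Hd [HA P]]]]. exists d, A. do 2 (split; auto).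
  intros a b Ha Hb. destruct (P a b Ha Hb) as [z [Hz1 Hz2]].
  exists (c * z)%C. split; [now apply is_CInt_Cmult|].
  replace (c * z - c * l)%C with (c * (z - l))%C by ring. rewrite Cmod_mult.
  apply Rle_lt_trans with (Cmod c * (eps / (Cmod c + 1))); [apply Rmult_le_compat_l; lra|].
  apply Rlt_le_trans with ((Cmod c + 1) * (eps / (Cmod c + 1))); [nra | right; field; lra].
Qed.

Lemma improper_ext (f g : R -> C) (l : C) :
  (forall x, 0 < x -> f x = g x) -> improper f l -> improper g l.
Proof.
  intros E H eps He. destruct (H eps He) as [d [A [Hd [HA P]]]].
  exists d, A. do 2 (split; auto). intros a b Ha Hb.
  destruct (P a b Ha Hb) as [z [Hz1 Hz2]]. exists z. split; auto.
  apply (is_CInt_ext f); auto; [lra|]. intros; apply E; lra.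
Qed.

Lemma improper_unique (f : R -> C) (l m : C) : improper f l -> improper f m -> l = m.
Proof.
  intros H H'. destruct (Ceq_dec l m) as [E|E]; [exact E | exfalso].
  assert (Hp : 0 < Cmod (l - m)).
  { apply Cmod_gt_0. intros E'. apply E. replace l with ((l - m) + m)%C by ring.
    rewrite E'. ring. }
  destruct (H (Cmod (l - m) / 2)) as [d [A [Hd [HA P]]]]; [lra|].
  destruct (H' (Cmod (l - m) / 2)) as [d' [A' [Hd' [HA' P']]]]; [lra|].
  assert (Hm : 0 < Rmin d d') by (apply Rmin_glb_lt; auto).
  pose proof (Rmin_l d d'). pose proof (Rmin_r d d').
  pose proof (Rmax_l A A'). pose proof (Rmax_r A A').
  destruct (P (Rmin d d' / 2) (Rmax A A' + 1)) as [z [Hz1 Hz2]]; [lra | lra |].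
  destruct (P' (Rmin d d' / 2) (Rmax A A' + 1)) as [z' [Hz1' Hz2']]; [lra | lra |].
  rewrite <- (is_CInt_unique _ _ _ _ _ Hz1 Hz1') in Hz2'.
  replace (l - m)%C with (- (z - l) + (z - m))%C in Hp, Hz2, Hz2' by ring.
  pose proof (Cmod_triangle (- (z - l)) (z - m)) as T. rewrite Cmod_opp in T. lra.
Qed.

Lemma improper_scale (c : R) (f : R -> C) (l : C) : 0 < c ->
  improper f l -> improper (fun t => RtoC c * f (c * t)%R)%C l.
Proof.
  intros Hc H eps He. destruct (H eps He) as [d [A [Hd [HA P]]]].
  exists (d / c), (A / c). split; [apply Rdiv_lt_0_compat; auto|].
  split; [apply Rmult_le_compat_r; [left; now apply Rinv_0_lt_compat | auto]|].
  intros a b Ha Hb.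
  destruct (P (c * a) (c * b)) as [z [[Hz1 Hz1'] Hz2]].
  - split; [apply Rmult_lt_0_compat; lra|].
    apply Rlt_le_trans with (c * (d / c)); [apply Rmult_lt_compat_l; lra | right; field; lra].
  - apply Rle_lt_trans with (c * (A / c)); [right; field; lra | apply Rmult_lt_compat_l; lra].
  - exists z. split; auto.
    rewrite <- (Rplus_0_r (c * a)), <- (Rplus_0_r (c * b)) in Hz1, Hz1'.
    apply (is_RInt_comp_lin (V := R_NormedModule)) in Hz1.
    apply (is_RInt_comp_lin (V := R_NormedModule)) in Hz1'.
    split; (eapply is_RInt_ext; [|eassumption]); intros x _; cbv beta; rewrite Rplus_0_r;
      unfold scal; simpl; unfold mult; simpl; unfold Re, Im; ring.
Qed.

(** The integrals over [[1 / (k + 1), k + 1]] form a Cauchy sequence, because increments of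
    [dom_int] control them; every other [[a, b]] is compared with these. The 4 is one factor 2 for
    bounding components and one for passing to the limit. *)
Lemma improper_dominated (f : R -> C) (t M : R) : 0 < t -> 0 <= M ->
  (forall x, 0 < x -> ex_Rderive f x) ->
  (forall x, 0 < x -> Cmod (f x) <= M * dom t x) ->
  exists l, improper f l /\ Cmod l <= 4 * (M * / t).
Proof.
  intros Ht HM Hf Hb.
  assert (Hit : 0 < / t) by now apply Rinv_0_lt_compat.
  assert (B : forall a b z, 0 < a <= b -> is_CInt f a b z ->
    Cmod z <= 2 * (M * (dom_int t b - dom_int t a))).
  { intros a b z Hab Hz. apply (is_CInt_bound f (fun u => M * dom t u) a b); auto; [lra | |].
    - now apply is_RInt_dom.
    - intros x Hx. apply Hb. lra. }
  assert (Bo : forall a b c d z w, 0 < a <= b -> b <= c <= d ->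
    is_CInt f b c z -> is_CInt f a d w ->
    Cmod (w - z) <= 2 * M * ((dom_int t b - dom_int t a) + (dom_int t d - dom_int t c))).
  { intros a b c d z w Hab Hcd Hz Hw.
    destruct (ex_CInt f a b) as [x Hx]; try lra; auto.
    destruct (ex_CInt f c d) as [y Hy]; try lra; auto.
    pose proof (is_CInt_Chasles _ _ _ _ _ _ (is_CInt_Chasles _ _ _ _ _ _ Hx Hz) Hy) as H.
    rewrite (is_CInt_unique _ _ _ _ _ Hw H).
    replace (x + z + y - z)%C with (x + y)%C by ring.
    eapply Rle_trans; [apply Cmod_triangle|].
    pose proof (B a b x Hab Hx). pose proof (B c d y ltac:(lra) Hy). lra. }
  set (lo := fun k => / INR (S k)). set (hi := fun k => INR (S k)).
  assert (Hlo : forall k, 0 < lo k <= 1)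
    by (intros k; split; [apply inv_INR_S_pos | apply inv_INR_S_le_1]).
  assert (Hhi : forall k, 1 <= hi k) by (intros k; apply INR_S_ge_1).
  assert (Hlo' : forall k, lo (S k) <= lo k).
  { intros k. apply Rinv_le_contravar; [apply lt_0_INR; lia | apply le_INR; lia]. }
  assert (Hhi' : forall k, hi k <= hi (S k)) by (intros k; apply le_INR; lia).
  (* [RInt] selects the values as a function of [k], whereas [ex_CInt] only asserts existence. *)
  assert (Z : forall k, {z | is_CInt f (lo k) (hi k) z}).
  { intros k.
    exists (RInt (fun u => Re (f u)) (lo k) (hi k), RInt (fun u => Im (f u)) (lo k) (hi k)).
    destruct (ex_CInt f (lo k) (hi k)) as [z [Hz1 Hz2]]; auto.
    - apply Hlo.
    - specialize (Hhi k). lra.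
    - split; apply (RInt_correct (V := R_CompleteNormedModule)); eexists; eassumption. }
  set (u := fun k => proj1_sig (Z k)).
  assert (Hu : forall k, is_CInt f (lo k) (hi k) (u k)) by (intros k; apply (proj2_sig (Z k))).
  (* The control sequence is the mass of [dom t] outside [[lo k, hi k]]. *)
  destruct (Ccvg_cauchy u (2 * M) (fun k => / t - dom_int t (hi k) + dom_int t (lo k)))
    as [l Hl]; [lra | | | |].
  - intros k. destruct (dom_int_bounds t (hi k) Ht) as [P1 _]; [specialize (Hhi k); lra|].
    destruct (dom_int_bounds t (lo k) Ht) as [P2 _]; [apply Hlo|]. lra.
  - intros k.
    pose proof (dom_int_incr t (hi k) (hi (S k)) Ht
      ltac:(split; auto; specialize (Hhi k); lra)).
    pose proof (dom_int_incr t (lo (S k)) (lo k) Ht ltac:(split; auto; apply Hlo)). lra.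
  - intros k.
    eapply Rle_trans; [apply (Bo (lo (S k)) (lo k) (hi k) (hi (S k)))|]; auto.
    + split; auto. apply Hlo.
    + split; auto. specialize (Hlo k); specialize (Hhi k); lra.
    + right; ring.
  - assert (Main : forall a b z, 0 < a <= b -> is_CInt f a b z ->
      Cmod (z - l) <= 4 * (M * (dom_int t a + (/ t - dom_int t b)))).
    { intros a b z Hab Hz.
      destruct (nfloor_ex (/ a)) as [n1 Hn1]; [left; apply Rinv_0_lt_compat; lra|].
      destruct (nfloor_ex b) as [n2 Hn2]; [lra|].
      set (N := (n1 + n2)%nat).
      replace (4 * (M * (dom_int t a + (/ t - dom_int t b)))) with
        (2 * (2 * M * (dom_int t a + (/ t - dom_int t b)))) by ring.
      replace (z - l)%C with (z + - (1) * l)%C by ring.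
      apply Ccvg_bound with (fun k => z + - (1) * u (k + N)%nat)%C.
      - apply Ccvg_plus; [split; apply is_lim_seq_const|]. apply Ccvg_mult_l.
        destruct Hl as [L1 L2].
        split; [apply (is_lim_seq_incr_n (fun k => Re (u k)))
               | apply (is_lim_seq_incr_n (fun k => Im (u k)))]; assumption.
      - intros k. set (j := (k + N)%nat).
        assert (Hj : INR n1 + 1 <= hi j /\ INR n2 + 1 <= hi j).
        { unfold hi, j, N. rewrite S_INR, !plus_INR.
          pose proof (pos_INR k). pose proof (pos_INR n1). pose proof (pos_INR n2). lra. }
        assert (Ha : lo j <= a).
        { unfold lo. rewrite <- (Rinv_inv a). apply Rinv_le_contravar.
          - apply Rinv_0_lt_compat; lra.
          - change (/ a <= hi j). lra. }
        replace (z + - (1) * u j)%C with (- (u j - z))%C by ring. rewrite Cmod_opp.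
        eapply Rle_trans; [apply (Bo (lo j) a b (hi j) z (u j)); auto|].
        + split; auto. apply Hlo.
        + lra.
        + apply Rmult_le_compat_l; [lra|].
          destruct (dom_int_bounds t (hi j) Ht) as [P1 _]; [specialize (Hhi j); lra|].
          destruct (dom_int_bounds t (lo j) Ht) as [P2 _]; [apply Hlo|]. lra. }
    exists l. split.
    + intros eps He.
      assert (He' : 0 < eps * t / (8 * (M + 1))).
      { apply Rdiv_lt_0_compat; [apply Rmult_lt_0_compat; lra | lra]. }
      destruct (Rpower_small t _ Ht He') as [d [Hd P]].
      destruct (Rpower_opp_small t _ Ht He') as [A [HA Q]].
      exists d, (Rmax d A). split; [auto|]. split; [apply Rmax_l|].
      intros a b Ha Hb0.
      pose proof (Rmax_l d A). pose proof (Rmax_r d A).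
      destruct (ex_CInt f a b) as [z Hz]; try lra; auto.
      exists z. split; auto.
      eapply Rle_lt_trans; [apply (Main a b z ltac:(lra) Hz)|].
      destruct (dom_int_bounds t a Ht ltac:(lra)) as [_ [D1 _]].
      destruct (dom_int_bounds t b Ht ltac:(lra)) as [_ [_ D2]].
      specialize (P a Ha). specialize (Q b ltac:(lra)).
      set (e := eps * t / (8 * (M + 1))) in *.
      assert (Ee : 8 * (M + 1) * (/ t * e) = eps) by (unfold e; field; lra).
      assert (Hte : 0 < / t * e) by (apply Rmult_lt_0_compat; lra).
      assert (D1' : dom_int t a <= / t * e) by nra.
      assert (D2' : / t - dom_int t b <= / t * e) by nra.
      apply Rle_lt_trans with (4 * (M * (2 * (/ t * e)))).
      * apply Rmult_le_compat_l; [lra|]. apply Rmult_le_compat_l; lra.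
      * nra.
    (* On the empty interval at 1 the two masses add up to [/ t], which bounds [l] itself. *)
    + pose proof (Main 1 1 0%C ltac:(lra) (is_CInt_point f 1)) as H.
      replace (0 - l)%C with (- l)%C in H by ring. rewrite Cmod_opp in H.
      eapply Rle_trans; [exact H|]. right; ring.
Qed.

(** Serves as integration by parts: the power bounds make both boundary values of [G] vanish in the
    limit. *)
Lemma improper_derive (G dG : R -> C) (t M : R) : 0 < t -> 0 <= M ->
  (forall x, 0 < x -> is_Rderive G x (dG x)) ->
  (forall x, 0 < x -> ex_Rderive dG x) ->
  (forall x, 0 < x -> Cmod (G x) <= M * Rpower x t) ->
  (forall x, 0 < x -> Cmod (G x) <= M * Rpower x (- t)) ->
  improper dG 0.
Proof.
  intros Ht HM H1 H2 B1 B2 eps He.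
  assert (He' : 0 < eps / (2 * (M + 1))) by (apply Rdiv_lt_0_compat; lra).
  destruct (Rpower_small t _ Ht He') as [d [Hd P]].
  destruct (Rpower_opp_small t _ Ht He') as [A [HA Q]].
  exists d, (Rmax d A). split; [auto|]. split; [apply Rmax_l|].
  intros a b Ha Hb. pose proof (Rmax_l d A). pose proof (Rmax_r d A).
  exists (G b - G a)%C. split.
  - apply is_CInt_derive; [lra | |]; intros; [apply H1 | apply H2]; lra.
  - replace (G b - G a - 0)%C with (G b + - G a)%C by ring.
    eapply Rle_lt_trans; [apply Cmod_triangle|]. rewrite Cmod_opp.
    specialize (P a Ha). specialize (Q b ltac:(lra)).
    specialize (B1 a ltac:(lra)). specialize (B2 b ltac:(lra)).
    set (e := eps / (2 * (M + 1))) in *.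
    assert (Ee : 2 * (M + 1) * e = eps) by (unfold e; field; lra).
    nra.
Qed.

Lemma improper_RInt_gen (f : R -> C) (l : C) : improper f l ->
  RInt_gen (V := C_R_CompleteNormedModule) f (at_right 0) (Rbar_locally p_infty) = l.
Proof.
  intros H. apply (is_RInt_gen_unique (V := C_R_CompleteNormedModule)).
  apply filterlimi_locally. intros eps.
  destruct (H eps (cond_pos eps)) as [d [A [Hd [HA P]]]].
  apply Filter_prod with (fun a => 0 < a < d) (fun b => A < b).
  - exists (mkposreal d Hd). intros y Hy Hy'. change (Rabs (y - 0) < d) in Hy.
    rewrite Rminus_0_r, Rabs_right in Hy by lra. split; assumption.
  - exists A. auto.
  - intros a b Ha Hb. destruct (P a b Ha Hb) as [z [[Hz1 Hz2] Hz3]].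
    exists z. split.
    + destruct z as [x y]. apply (is_RInt_fct_extend_pair (U := R_NormedModule) (V := R_NormedModule));
        assumption.
    + split.
      * change (Rabs (Re (z - l)) < eps). eapply Rle_lt_trans; [apply re_le_Cmod | exact Hz3].
      * change (Rabs (Im (z - l)) < eps). eapply Rle_lt_trans; [apply im_le_Cmod | exact Hz3].
Qed.

(** * An integral for [(s - 1) * Gamma s * zeta s] *)

Lemma Rpower_le_1 (u a : R) : 0 < u <= 1 -> 0 <= a -> Rpower u a <= 1.
Proof.
  intros Hu Ha. unfold Rpower. rewrite <- exp_0. apply exp_le.
  assert (ln u <= 0) by (rewrite <- ln_1; apply ln_le; lra). nra.
Qed.

Lemma pow_exp_bound (n : nat) (c u : R) : 0 < c -> 0 <= u ->
  u ^ n * exp (- (c * u)) <= INR (fact n) / c ^ n.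
Proof.
  intros Hc Hu.
  assert (H : (c * u) ^ n / INR (fact n) <= exp (c * u)).
  { eapply Rle_trans; [|apply (exp_ge_taylor (c * u) n); nra].
    destruct n as [|n]; [right; reflexivity|]. rewrite tech5.
    assert (0 <= sum_f_R0 (fun k => (c * u) ^ k / INR (fact k)) n); [|lra].
    apply cond_pos_sum. intros k. apply Rdiv_le_0_compat; [apply pow_le; nra | apply INR_fact_lt_0]. }
  assert (Hf : 0 < INR (fact n)) by apply INR_fact_lt_0.
  assert (Hcn : 0 < c ^ n) by now apply pow_lt.
  rewrite Rpow_mult_distr in H. rewrite exp_Ropp. pose proof (exp_pos (c * u)) as He.
  apply Rmult_le_reg_r with (exp (c * u) * (c ^ n / INR (fact n))).
  { apply Rmult_lt_0_compat; [auto | apply Rdiv_lt_0_compat; auto]. }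
  replace (u ^ n * / exp (c * u) * (exp (c * u) * (c ^ n / INR (fact n)))) with
    (c ^ n * u ^ n / INR (fact n)) by (field; lra).
  replace (INR (fact n) / c ^ n * (exp (c * u) * (c ^ n / INR (fact n)))) with (exp (c * u))
    by (field; lra).
  exact H.
Qed.

(** One [M] serves all exponents in [[t, K]], the source of uniformity in [s]. For [u <= 1] the
    lower end [t] decides; for [u > 1] the exponential absorbs [u^(K + t)]. The 4 bounds
    [(1 + u^t)^2] by the larger of 1 and [u^(2 t)]. *)
Lemma power_exp_dom (t K c : R) : 0 < t -> 0 < c ->
  exists M, 0 <= M /\ forall r u, t <= r <= K -> 0 < u ->
    Rpower u (r - 1) * exp (- (c * u)) <= M * dom t u.
Proof.
  intros Ht Hc.
  destruct (nfloor_ex (Rmax (K + t) 0)) as [n0 Hn0]; [apply Rmax_r|].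
  set (n := S n0).
  assert (Hn : K + t <= INR n) by (unfold n; rewrite S_INR; pose proof (Rmax_l (K + t) 0); lra).
  assert (HF : 0 <= INR (fact n) / c ^ n).
  { apply Rdiv_le_0_compat; [left; apply INR_fact_lt_0 | now apply pow_lt]. }
  exists (4 * (1 + INR (fact n) / c ^ n)). split; [lra|].
  intros r u Hr Hu.
  pose proof (Rpower_pos u t) as Pt.
  assert (E : Rpower u (r - 1) = Rpower u (r - t) * (1 + Rpower u t) ^ 2 * dom t u).
  { unfold dom. replace (r - 1) with ((r - t) + t + - (1)) by ring.
    rewrite !Rpower_plus, Rpower_Ropp, Rpower_1 by auto. field. split; lra. }
  rewrite E.
  assert (Hd : 0 < dom t u).
  { unfold dom. apply Rdiv_lt_0_compat; auto. apply Rmult_lt_0_compat; auto. apply pow_lt; lra. }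
  enough (Rpower u (r - t) * (1 + Rpower u t) ^ 2 * exp (- (c * u))
    <= 4 * (1 + INR (fact n) / c ^ n)) by nra.
  pose proof (Rpower_pos u (r - t)) as P1. pose proof (exp_pos (- (c * u))) as P2.
  destruct (Rle_lt_dec u 1) as [H1|H1].
  - assert (Rpower u (r - t) <= 1) by (apply Rpower_le_1; lra).
    assert (Rpower u t <= 1) by (apply Rpower_le_1; lra).
    assert (exp (- (c * u)) <= 1) by (rewrite <- exp_0; apply exp_le; nra).
    assert ((1 + Rpower u t) ^ 2 <= 4) by nra.
    apply Rle_trans with (1 * 4 * 1); [|lra].
    apply Rmult_le_compat; try nra.
  - assert (Q1 : 1 <= Rpower u t).
    { rewrite <- (Rpower_O u) by auto. apply Rle_Rpower; lra. }
    assert (Q2 : (1 + Rpower u t) ^ 2 <= 4 * (Rpower u t * Rpower u t)) by nra.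
    apply Rle_trans with (Rpower u (r - t) * (4 * (Rpower u t * Rpower u t)) * exp (- (c * u))).
    { apply Rmult_le_compat_r; [lra|]. apply Rmult_le_compat_l; lra. }
    replace (Rpower u (r - t) * (4 * (Rpower u t * Rpower u t))) with (4 * Rpower u (r + t))
      by (replace (r + t) with ((r - t) + t + t) by ring; rewrite !Rpower_plus; ring).
    assert (Q3 : Rpower u (r + t) <= u ^ n).
    { rewrite <- Rpower_pow by auto. apply Rle_Rpower; lra. }
    pose proof (pow_exp_bound n c u Hc ltac:(lra)). nra.
Qed.

Lemma dom_mult_le (t u : R) : 0 < u ->
  u * dom t u <= Rpower u t /\ u * dom t u <= Rpower u (- t).
Proof.
  intros Hu. unfold dom. pose proof (Rpower_pos u t) as P. rewrite Rpower_Ropp.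
  set (v := Rpower u t) in *.
  replace (u * (v / (u * (1 + v) ^ 2))) with (v / (1 + v) ^ 2) by (field; lra).
  assert (Q : 0 < (1 + v) ^ 2) by (apply pow_lt; lra).
  split; apply Rmult_le_reg_r with ((1 + v) ^ 2); auto.
  - replace (v / (1 + v) ^ 2 * (1 + v) ^ 2) with v by (field; lra). nra.
  - replace (v / (1 + v) ^ 2 * (1 + v) ^ 2) with v by (field; lra).
    apply Rmult_le_reg_l with v; auto.
    replace (v * (/ v * (1 + v) ^ 2)) with ((1 + v) ^ 2) by (field; lra). nra.
Qed.

(** * Gamma integrals and integration by parts *)

Lemma Cpow_pos_base_mult (x y : R) (s : C) : 0 < x -> 0 < y ->
  Cpow_pos (x * y) s = (Cpow_pos x s * Cpow_pos y s)%C.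
Proof.
  intros Hx Hy. unfold Cpow_pos. rewrite <- Cexp_plus, ln_mult, RtoC_plus by auto.
  f_equal. ring.
Qed.

Lemma Cpow_pos_exp_0 (x : R) : Cpow_pos x 0 = RtoC 1.
Proof. unfold Cpow_pos. rewrite Cmult_0_l. apply Cexp_0. Qed.

Lemma Cmod_Cpow_Rpower (u : R) (s : C) : Cmod (Cpow_pos u s) = Rpower u (Re s).
Proof. apply Cmod_Cpow_pos. Qed.

Lemma Gamma_improper (s : C) : 0 < Re s ->
  improper (fun t => Cpow_pos t (s - 1) * RtoC (exp (- t)))%C (Gamma s).
Proof.
  intros Hs.
  destruct (power_exp_dom (Re s) (Re s) 1 Hs ltac:(lra)) as [M [HM P]].
  destruct (improper_dominated (fun t => Cpow_pos t (s - 1) * RtoC (exp (- t)))%C (Re s) M)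
    as [l [Hl _]]; auto.
  - intros x Hx. apply ex_Rderive_mult; [now apply ex_Rderive_Cpow_pos|].
    apply ex_Rderive_RtoC. auto_derive; auto.
  - intros x Hx. rewrite Cmod_mult, Cmod_Cpow_Rpower, Cmod_R, Rabs_right
      by (apply Rle_ge; left; apply exp_pos).
    rewrite <- (Rmult_1_l x) at 2. apply (P (Re s)); lra.
  - unfold Gamma. now rewrite (improper_RInt_gen _ l Hl).
Qed.

Lemma Gamma_scaled (s : C) (c : R) : 0 < Re s -> 0 < c ->
  improper (fun u => Cpow_pos u (s - 1) * RtoC (exp (- (c * u))))%C
    (Cpow_pos c (- s) * Gamma s)%C.
Proof.
  intros Hs Hc.
  generalize (improper_Cmult (Cpow_pos c (- s)) _ _
    (improper_scale c _ _ Hc (Gamma_improper s Hs))).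
  apply improper_ext. intros u Hu. cbv beta. rewrite Cpow_pos_base_mult by auto.
  rewrite <- (Cpow_pos_1 c) by auto.
  replace (Cpow_pos c (- s) * (Cpow_pos c 1 *
    (Cpow_pos c (s - 1) * Cpow_pos u (s - 1) * (exp (- (c * u)))%R)))%C with
    ((Cpow_pos c (- s) * Cpow_pos c 1 * Cpow_pos c (s - 1)) *
      (Cpow_pos u (s - 1) * (exp (- (c * u)))%R))%C by ring.
  rewrite <- !Cpow_pos_plus. replace (- s + 1 + (s - 1))%C with (RtoC 0) by ring.
  rewrite Cpow_pos_exp_0. ring.
Qed.

(** The derivative of [u^(s-1)] times the weight [w]; including [s - 1] makes it fit integration by
    parts and keeps bounds uniform near [s = 1]. *)
Definition kern (s : C) (w : R -> R) (u : R) : C :=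
  ((s - 1) * Cpow_pos u (s - 2) * RtoC (w u))%C.

Lemma Cmod_kern (s : C) (w : R -> R) (u : R) :
  Cmod (kern s w u) = Cmod (s - 1) * Rpower u (Re s - 2) * Rabs (w u).
Proof. unfold kern. now rewrite !Cmod_mult, Cmod_Cpow_Rpower, Cmod_R. Qed.

Lemma Cmod_kern_le (s : C) (w : R -> R) (u th c W : R) : 0 < u -> 0 <= W ->
  Rabs (w u) <= W * Rpower u (1 - th) * exp (- (c * u)) ->
  Cmod (kern s w u) <= Cmod (s - 1) * W * (Rpower u (Re s - th - 1) * exp (- (c * u))).
Proof.
  intros Hu HW H. rewrite Cmod_kern.
  replace (Re s - th - 1) with ((Re s - 2) + (1 - th)) by ring. rewrite Rpower_plus.
  pose proof (Cmod_ge_0 (s - 1)). pose proof (Rpower_pos u (Re s - 2)).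
  replace (Cmod (s - 1) * W * (Rpower u (Re s - 2) * Rpower u (1 - th) * exp (- (c * u))))
    with (Cmod (s - 1) * Rpower u (Re s - 2) * (W * Rpower u (1 - th) * exp (- (c * u)))) by ring.
  apply Rmult_le_compat_l; auto. apply Rmult_le_pos; lra.
Qed.

Lemma ex_Rderive_kern (s : C) (w : R -> R) (u : R) : 0 < u -> ex_derive w u ->
  ex_Rderive (kern s w) u.
Proof.
  intros Hu Hw. unfold kern. apply ex_Rderive_mult; [|now apply ex_Rderive_RtoC].
  apply ex_Rderive_mult; [apply ex_Rderive_const | now apply ex_Rderive_Cpow_pos].
Qed.

Lemma Cpow_pos_pred (u : R) (s : C) : 0 < u ->
  Cpow_pos u (s - 1) = (RtoC u * Cpow_pos u (s - 2))%C.
Proof.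
  intros Hu. rewrite <- (Cpow_pos_1 u Hu), <- Cpow_pos_plus. f_equal. ring.
Qed.

Lemma is_Rderive_Cpow_pred (s : C) (u : R) : 0 < u ->
  is_Rderive (fun t => Cpow_pos t (s - 1)) u ((s - 1) * Cpow_pos u (s - 2))%C.
Proof.
  intros Hu. eapply is_Rderive_eq; [now apply is_Rderive_Cpow_pos|].
  rewrite Cpow_pos_pred by auto. rewrite RtoC_inv by lra. field. apply RtoC_neq_0; lra.
Qed.

(** By parts, with two Gamma integrals for [w']. Each exponential alone would diverge at 0 when
    [Re s <= 1]; the difference vanishes to first order there, so the boundary term is of order
    [u^(Re s)]. *)
Lemma kern_exp_diff (s : C) (c : R) : 0 < Re s -> 1 <= c ->
  improper (kern s (fun u => exp (- (c * u)) - exp (- ((c + 1) * u))))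
    ((RtoC c * Cpow_pos c (- s) - RtoC (c + 1) * Cpow_pos (c + 1) (- s)) * Gamma s)%C.
Proof.
  intros Hs Hc.
  set (w := fun u => exp (- (c * u)) - exp (- ((c + 1) * u))).
  set (w' := fun u => - c * exp (- (c * u)) + (c + 1) * exp (- ((c + 1) * u))).
  assert (Hw : forall u, is_derive w u (w' u)).
  { intros u. unfold w, w'. auto_derive; auto. ring. }
  assert (Hw' : forall u, ex_derive w' u) by (intros u; unfold w'; auto_derive; auto).
  destruct (power_exp_dom (Re s) (Re s) 1 Hs ltac:(lra)) as [M [HM P]].
  assert (B : forall u, 0 < u -> Cmod (Cpow_pos u (s - 1) * RtoC (w u)) <= M * (u * dom (Re s) u)).
  { intros u Hu. rewrite Cmod_mult, Cmod_Cpow_Rpower, Cmod_R.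
    assert (Hwu : Rabs (w u) <= u * exp (- (1 * u))).
    { unfold w. replace (- ((c + 1) * u)) with (- (c * u) + - u) by ring. rewrite exp_plus.
      pose proof (exp_ge (- u)). pose proof (exp_pos (- (c * u))).
      assert (exp (- u) <= 1) by (rewrite <- exp_0; apply exp_le; lra).
      assert (exp (- (c * u)) <= exp (- (1 * u))) by (apply exp_le; nra).
      rewrite Rabs_right by nra. nra. }
    specialize (P (Re s) u ltac:(lra) Hu). change (Re (s - 1)) with (Re s - 1).
    pose proof (Rpower_pos u (Re s - 1)).
    apply Rle_trans with (Rpower u (Re s - 1) * (u * exp (- (1 * u)))).
    - apply Rmult_le_compat_l; lra.
    - nra. }
  assert (D : improper (fun u => kern s w u + Cpow_pos u (s - 1) * RtoC (w' u))%C 0).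
  { apply (improper_derive (fun u => Cpow_pos u (s - 1) * RtoC (w u))%C _ (Re s) M); auto.
    - intros u Hu.
      apply (is_Rderive_mult (fun u => Cpow_pos u (s - 1)) (fun u => RtoC (w u)) u
        ((s - 1) * Cpow_pos u (s - 2)) (RtoC (w' u))).
      + now apply is_Rderive_Cpow_pred.
      + apply is_Rderive_RtoC, Hw.
    - intros u Hu. apply ex_Rderive_plus.
      + apply ex_Rderive_kern; auto. eexists; apply Hw.
      + apply ex_Rderive_mult; [now apply ex_Rderive_Cpow_pos | apply ex_Rderive_RtoC, Hw'].
    - intros u Hu. eapply Rle_trans; [apply B, Hu|]. apply Rmult_le_compat_l; auto.
      now apply dom_mult_le.
    - intros u Hu. eapply Rle_trans; [apply B, Hu|]. apply Rmult_le_compat_l; auto.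
      now apply dom_mult_le. }
  pose proof (improper_Cmult (RtoC c) _ _ (Gamma_scaled s c Hs ltac:(lra))) as G1.
  pose proof (improper_Cmult (- RtoC (c + 1)) _ _ (Gamma_scaled s (c + 1) Hs ltac:(lra))) as G2.
  generalize (improper_plus _ _ _ _ D (improper_plus _ _ _ _ G1 G2)).
  replace (0 + (RtoC c * (Cpow_pos c (- s) * Gamma s) +
      - RtoC (c + 1) * (Cpow_pos (c + 1) (- s) * Gamma s)))%C with
    ((RtoC c * Cpow_pos c (- s) - RtoC (c + 1) * Cpow_pos (c + 1) (- s)) * Gamma s)%C by ring.
  apply improper_ext. intros u Hu. unfold w'.
  rewrite (RtoC_plus (- c * _)), !RtoC_mult, RtoC_opp. ring.
Qed.

Definition bern_gap (u : R) : R := bern_gf u - exp (- u).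

Lemma exp_opp_sandwich (u : R) : 0 < u ->
  0 <= exp (- u) /\ 1 - u <= exp (- u) /\ exp (- u) <= exp (- (u / 2)).
Proof.
  intros Hu. repeat split; [left; apply exp_pos | |apply exp_le; lra].
  pose proof (exp_ge (- u)). lra.
Qed.

Lemma bern_gap_bound (u : R) : 0 < u -> Rabs (bern_gap u) <= 2 * u * exp (- (u / 4)).
Proof.
  intros Hu. apply sandwich_diff; auto; [now apply bern_gf_bounds | now apply exp_opp_sandwich].
Qed.

Lemma ex_derive_bern_gf (u : R) : 0 < u -> ex_derive bern_gf u.
Proof.
  intros Hu. unfold bern_gf. auto_derive. pose proof (exp_ge u). lra.
Qed.

Lemma ex_derive_bern_gap (u : R) : 0 < u -> ex_derive bern_gap u.
Proof.
  intros Hu. apply (ex_derive_minus bern_gf (fun u => exp (- u))).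
  - now apply ex_derive_bern_gf.
  - auto_derive; auto.
Qed.

Lemma exp_opp_le_power (th x : R) : 0 <= th <= 1 -> 0 < x -> exp (- x) <= Rpower x (- th).
Proof.
  intros Ht Hx. rewrite exp_Ropp, Rpower_Ropp. apply Rinv_le_contravar; [apply Rpower_pos|].
  pose proof (exp_ge x). destruct (Rle_lt_dec x 1) as [H1|H1].
  - pose proof (Rpower_le_1 x th ltac:(lra) (proj1 Ht)). lra.
  - assert (Rpower x th <= x); [|lra]. rewrite <- (Rpower_1 x) at 2 by auto.
    apply Rle_Rpower; lra.
Qed.

(** The decay comes from [exp (- (n * u)) <= (n * u)^(- th)]. The loss of [u^(- th)] at 0 is
    affordable: [bern_gap] brings a factor [u], and [th <= Re s / 2] leaves [Re s - th >= th]. *)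
Lemma gap_integrals (s : C) : 0 < Re s ->
  exists (T : nat -> C) (M th : R), 0 <= M /\ 0 < th /\
    (forall n, improper (kern s (fun u => bern_gap u * exp (- (INR n * u)))) (T n)) /\
    (forall n, Cmod (T (S n)) <= M * Rpower (INR (S n)) (- th)).
Proof.
  intros Hs. set (th := Rmin 1 (Re s) / 2).
  pose proof (Rmin_l 1 (Re s)) as R1. pose proof (Rmin_r 1 (Re s)) as R2.
  assert (R3 : 0 < Rmin 1 (Re s)) by (apply Rmin_glb_lt; lra).
  assert (Hth : 0 < th <= 1 / 2 /\ th <= Re s / 2) by (unfold th; lra).
  destruct (power_exp_dom th (Re s) (1 / 4) ltac:(lra) ltac:(lra)) as [M [HM P]].
  pose proof (Cmod_ge_0 (s - 1)) as Hc.
  set (M' := Cmod (s - 1) * 2 * M).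
  assert (HM' : 0 <= M') by (unfold M'; apply Rmult_le_pos; lra).
  assert (D : forall n u, 0 < u ->
    ex_Rderive (kern s (fun u => bern_gap u * exp (- (INR n * u)))) u).
  { intros n u Hu. apply ex_Rderive_kern; auto.
    apply (ex_derive_mult bern_gap (fun u => exp (- (INR n * u))));
      [now apply ex_derive_bern_gap | auto_derive; auto]. }
  assert (X : forall n, exists l,
    improper (kern s (fun u => bern_gap u * exp (- (INR n * u)))) l /\
    ((1 <= n)%nat -> Cmod l <= 4 * (M' * Rpower (INR n) (- th) * / th))).
  { intros [|n].
    - destruct (improper_dominated (kern s (fun u => bern_gap u * exp (- (INR 0 * u)))) th M')
        as [l [Hl _]]; auto; [lra | |].
      + intros u Hu. eapply Rle_trans.
        * apply (Cmod_kern_le s _ u 0 (1 / 4) 2); [auto | lra |].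
          rewrite Rabs_mult, Rminus_0_r, Rpower_1 by auto.
          simpl INR. rewrite Rmult_0_l, Ropp_0, exp_0, Rabs_R1, Rmult_1_r.
          replace (1 / 4 * u) with (u / 4) by field. now apply bern_gap_bound.
        * rewrite Rminus_0_r. unfold M'. rewrite !Rmult_assoc.
          apply Rmult_le_compat_l; auto. apply Rmult_le_compat_l; [lra|].
          apply P; [lra | auto].
      + exists l. split; auto. intros; lia.
    - set (q := Rpower (INR (S n)) (- th)).
      assert (Hq : 0 < q) by apply Rpower_pos.
      destruct (improper_dominated (kern s (fun u => bern_gap u * exp (- (INR (S n) * u)))) th (M' * q))
        as [l [Hl Hl']]; auto; [lra | nra | |].
      + intros u Hu. eapply Rle_trans.
        * apply (Cmod_kern_le s _ u th (1 / 4) (2 * q)); [auto | lra |].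
          rewrite Rabs_mult, (Rabs_right (exp _)) by (apply Rle_ge; left; apply exp_pos).
          replace (1 / 4 * u) with (u / 4) by field.
          assert (E : exp (- (INR (S n) * u)) <= q * Rpower u (- th)).
          { unfold q. rewrite Rpower_mult_distr by (auto; apply lt_0_INR; lia).
            apply exp_opp_le_power; [lra|]. apply Rmult_lt_0_compat; [apply lt_0_INR; lia | auto]. }
          unfold Rminus. rewrite Rpower_plus, Rpower_1 by auto.
          replace (2 * q * (u * Rpower u (- th)) * exp (- (u / 4))) with
            (2 * u * exp (- (u / 4)) * (q * Rpower u (- th))) by ring.
          apply Rmult_le_compat; [apply Rabs_pos | left; apply exp_pos | | exact E].
          now apply bern_gap_bound.
        * specialize (P (Re s - th) u ltac:(lra) Hu). unfold M'.
          replace (Cmod (s - 1) * 2 * M * q * dom th u) with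
            (Cmod (s - 1) * (2 * q) * (M * dom th u)) by ring.
          apply Rmult_le_compat_l; [|exact P]. apply Rmult_le_pos; lra.
      + exists l. split; auto. }
  assert (Hth' : 0 < / th) by (apply Rinv_0_lt_compat; lra).
  set (T := fun n => RInt_gen (V := C_R_CompleteNormedModule)
    (kern s (fun u => bern_gap u * exp (- (INR n * u)))) (at_right 0) (Rbar_locally p_infty)).
  assert (HT : forall n,
    improper (kern s (fun u => bern_gap u * exp (- (INR n * u)))) (T n) /\
    ((1 <= n)%nat -> Cmod (T n) <= 4 * (M' * Rpower (INR n) (- th) * / th))).
  { intros n. destruct (X n) as [l Hl]. unfold T.
    now rewrite (improper_RInt_gen _ l) by apply Hl. }
  exists T, (4 * (M' * / th)), th. split; [|split; [lra | split]].
  - apply Rmult_le_pos; [lra|]. apply Rmult_le_pos; lra.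
  - intros n. apply HT.
  - intros n. eapply Rle_trans; [apply HT; lia|]. right; ring.
Qed.

(* [bern_gf u * (1 - exp (- u)) = u * exp (- u)], so consecutive integrals differ by Gamma integrals. *)
Lemma gap_integrals_step (s : C) (n : nat) (l l' : C) : 0 < Re s ->
  improper (kern s (fun u => bern_gap u * exp (- (INR n * u)))) l ->
  improper (kern s (fun u => bern_gap u * exp (- (INR (S n) * u)))) l' ->
  l = (l' + (s - 1) * Gamma s * Cpow_pos (INR (S n)) (- s)
    - (Cpow_pos (INR (S n)) (1 - s) - Cpow_pos (INR (S (S n))) (1 - s)) * Gamma s)%C.
Proof.
  intros Hs H H'. set (c := INR (S n)) in *.
  assert (Hc : 1 <= c) by apply INR_S_ge_1.
  assert (Ec : INR (S (S n)) = c + 1) by (unfold c; now rewrite (S_INR (S n))).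
  rewrite Ec, !Cpow_pos_1s by lra.
  pose proof (improper_Cmult (s - 1) _ _ (Gamma_scaled s c Hs ltac:(lra))) as G1.
  pose proof (improper_Cmult (- (1)) _ _ (kern_exp_diff s c Hs Hc)) as G2.
  pose proof (improper_plus _ _ _ _ H' (improper_plus _ _ _ _ G1 G2)) as G.
  apply (improper_unique _ _ _ H).
  replace (l' + (s - 1) * Gamma s * Cpow_pos c (- s) -
    (RtoC c * Cpow_pos c (- s) - RtoC (c + 1) * Cpow_pos (c + 1) (- s)) * Gamma s)%C with
    (l' + ((s - 1) * (Cpow_pos c (- s) * Gamma s) + - (1) *
      ((RtoC c * Cpow_pos c (- s) - RtoC (c + 1) * Cpow_pos (c + 1) (- s)) * Gamma s)))%C by ring.
  revert G. apply improper_ext. intros u Hu. unfold kern.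
  rewrite Cpow_pos_pred by auto.
  assert (E : bern_gap u * exp (- (INR n * u)) =
    bern_gap u * exp (- (c * u)) + u * exp (- (c * u))
      - (exp (- (c * u)) - exp (- ((c + 1) * u)))).
  { unfold bern_gap, bern_gf, c. rewrite S_INR.
    replace (- ((INR n + 1) * u)) with (- (INR n * u) + - u) by ring.
    replace (- ((INR n + 1 + 1) * u)) with (- (INR n * u) + - u + - u) by ring.
    rewrite !exp_plus, (exp_Ropp u). pose proof (exp_ge u). field. split; lra. }
  rewrite E, !RtoC_minus, !RtoC_plus, !RtoC_mult. ring.
Qed.

(** The geometric expansion of [g] in finite form, with exact remainder [T N]. *)
Lemma gap_integrals_sum (s : C) (T : nat -> C) : 0 < Re s ->
  (forall n, improper (kern s (fun u => bern_gap u * exp (- (INR n * u)))) (T n)) ->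
  forall N, (T O + Gamma s = (s - 1) * Gamma s * sum_n_m (fun n => Cpow_pos (INR n) (- s)) 1 N
    + Cpow_pos (INR (S N)) (1 - s) * Gamma s + T N)%C.
Proof.
  intros Hs HT N. induction N as [|N IH].
  - rewrite sum_n_m_zero by lia. simpl INR. rewrite Cpow_pos_base_1.
    change (@zero C_AbelianMonoid) with (RtoC 0). ring.
  - rewrite IH, (gap_integrals_step s N (T N) (T (S N))) by auto.
    rewrite (sum_n_Sm _ 1 N) by lia. change plus with Cplus. ring.
Qed.

(** Absorbs an off-by-one: [gap_integrals_sum] ends with [(N + 1)^(1 - s)], [zeta_approx] with
    [N^(1 - s)]. *)
Lemma Cpow_pos_increment (s : C) (n : nat) : 0 < Re s ->
  Cmod (Cpow_pos (INR (S (S n))) (1 - s) - Cpow_pos (INR (S n)) (1 - s))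
  <= 2 * (Cmod (1 - s) * Rpower (INR (S n)) (- Re s)).
Proof.
  intros Hs. pose proof (INR_S_ge_1 n) as Hn. rewrite (S_INR (S n)).
  set (x := INR (S n)) in *. set (K := Cmod (1 - s) * Rpower x (- Re s)).
  replace K with (K * (x + 1) - K * x) by ring.
  apply (mean_value_C (fun u => Cpow_pos u (1 - s))
    (fun u => (1 - s) * RtoC (/ u) * Cpow_pos u (1 - s))%C (fun u => K * u) (fun _ => K)); [lra | | |].
  - intros u Hu. apply is_Rderive_Cpow_pos. lra.
  - intros u Hu. auto_derive; auto. ring.
  - intros u Hu. rewrite Cpow_pos_1s by lra.
    replace ((1 - s) * RtoC (/ u) * (RtoC u * Cpow_pos u (- s)))%C with
      ((1 - s) * Cpow_pos u (- s))%C
      by (rewrite RtoC_inv by lra; field; apply RtoC_neq_0; lra).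
    rewrite Cmod_mult, Cmod_Cpow_Rpower. change (Re (- s)) with (- Re s).
    apply Rmult_le_compat_l; [apply Cmod_ge_0|].
    rewrite !Rpower_Ropp. apply Rinv_le_contravar; [apply Rpower_pos|].
    apply Rle_Rpower_l; lra.
Qed.

Lemma Rpower_opp_lim (t : R) : 0 < t ->
  is_lim_seq (fun n => Rpower (INR (S n)) (- t)) 0.
Proof.
  intros Ht. apply is_lim_seq_spec. intros eps.
  destruct (Rpower_opp_small t eps Ht (cond_pos eps)) as [A [HA H]].
  destruct (nfloor_ex A ltac:(lra)) as [N HN]. exists (S N). intros n Hn.
  rewrite Rminus_0_r, Rabs_right by (apply Rle_ge; left; apply Rpower_pos).
  apply H. apply Rlt_le_trans with (INR (S N)); [rewrite S_INR; lra|]. apply le_INR; lia.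
Qed.

Lemma is_lim_seq_close (u e : nat -> R) (l : R) :
  is_lim_seq e 0 -> (forall n, Rabs (u n - l) <= e n) -> is_lim_seq u l.
Proof.
  intros He H. apply is_lim_seq_ext with (fun n => l + (u n - l)); [intros; ring|].
  replace (Finite l) with (Finite (l + 0)) by (f_equal; ring).
  apply is_lim_seq_plus'; [apply is_lim_seq_const|].
  apply is_lim_seq_abs_0. eapply is_lim_seq_le_le; [|apply is_lim_seq_const | exact He].
  intros n. split; [apply Rabs_pos | apply H].
Qed.

(** The integral is [T O + Gamma s]. It differs from [(s - 1) * Gamma s * zeta_approx s (S N)] by
    [T (S N)] and one increment of [n^(1 - s)] times [Gamma s], both of which tend to 0. *)
Lemma zeta_improper (s : C) : 0 < Re s -> s <> 1%C ->
  improper (fun u => kern s bern_gap u + Cpow_pos u (s - 1) * RtoC (exp (- u)))%C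
    ((s - 1) * Gamma s * zeta s)%C.
Proof.
  intros Hs H1.
  destruct (gap_integrals s Hs) as [T [M [th [HM [Hth [HT HB]]]]]].
  pose proof (gap_integrals_sum s T Hs HT) as HS.
  assert (E : (T O + Gamma s = (s - 1) * Gamma s * zeta s)%C).
  { set (e := fun N => Cmod (Gamma s) * (2 * (Cmod (1 - s) * Rpower (INR (S N)) (- Re s)))
      + M * Rpower (INR (S N)) (- th)).
    assert (He : is_lim_seq e 0).
    { replace 0 with (Cmod (Gamma s) * (2 * (Cmod (1 - s) * 0)) + M * 0) by ring.
      apply is_lim_seq_plus'.
      - repeat apply (is_lim_seq_scal_l _ _ (Finite _)). now apply Rpower_opp_lim.
      - apply (is_lim_seq_scal_l _ _ (Finite _)). now apply Rpower_opp_lim. }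
    assert (HD : forall N,
      Cmod (((s - 1) * Gamma s) * zeta_approx s (S N) - (T O + Gamma s)) <= e N).
    { intros N. rewrite (HS (S N)). unfold zeta_approx.
      set (Sg := sum_n_m _ 1 (S N)).
      replace (_ - _)%C with
        (- (Gamma s * (Cpow_pos (INR (S (S N))) (1 - s) - Cpow_pos (INR (S N)) (1 - s)))
         + - T (S N))%C.
      - eapply Rle_trans; [apply Cmod_triangle|]. rewrite !Cmod_opp, Cmod_mult.
        apply Rplus_le_compat; [|apply HB].
        apply Rmult_le_compat_l; [apply Cmod_ge_0 | now apply Cpow_pos_increment].
      - field. intros E. apply H1. replace s with (1 - (1 - s))%C by ring. rewrite E. ring. }
    pose proof (Ccvg_mult_l ((s - 1) * Gamma s) _ _ (zeta_cvg s Hs H1)) as [L1 L2].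
    apply C_ext.
    - assert (L := is_lim_seq_close (fun N => Re ((s - 1) * Gamma s * zeta_approx s (S N)))
        e (Re (T O + Gamma s)) He (fun N => Rle_trans _ _ _ (re_le_Cmod _) (HD N))).
      apply is_lim_seq_unique in L. apply is_lim_seq_unique in L1. congruence.
    - assert (L := is_lim_seq_close (fun N => Im ((s - 1) * Gamma s * zeta_approx s (S N)))
        e (Im (T O + Gamma s)) He (fun N => Rle_trans _ _ _ (im_le_Cmod _) (HD N))).
      apply is_lim_seq_unique in L. apply is_lim_seq_unique in L2. congruence. }
  rewrite <- E. generalize (improper_plus _ _ _ _ (HT O) (Gamma_improper s Hs)).
  apply improper_ext. intros u Hu. f_equal. unfold kern. simpl INR.
  now rewrite Rmult_0_l, Ropp_0, exp_0, Rmult_1_r.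
Qed.

(** * Convergence *)

Definition kint (s : C) (u : R) : C :=
  (kern s bern_gap u + Cpow_pos u (s - 1) * RtoC (exp (- u)))%C.

Lemma Cminus_1_neq_0 (s : C) : s <> 1%C -> (s - 1)%C <> 0%C.
Proof. intros H E. apply H. replace s with ((s - 1) + 1)%C by ring. rewrite E. ring. Qed.

Lemma shifted_neq_0 (s : C) (j : nat) : 0 < Re s -> s <> 1%C -> (s + INR j - 1)%C <> 0%C.
Proof.
  intros Hs H1 E. destruct j as [|j].
  - apply H1. replace s with ((s + INR 0 - 1) + 1)%C by (simpl INR; ring). rewrite E. ring.
  - apply (f_equal Re) in E. change (Re s + INR (S j) + - (1) = 0) in E.
    pose proof (INR_S_ge_1 j). lra.
Qed.

Lemma Cpow_pos_INR (u : R) (j : nat) : 0 < u -> Cpow_pos u (INR j) = RtoC (u ^ j).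
Proof.
  intros Hu. induction j as [|j IH]; [apply Cpow_pos_exp_0|].
  rewrite S_INR, RtoC_plus, Cpow_pos_plus, IH, Cpow_pos_1 by auto.
  rewrite <- RtoC_mult. f_equal. simpl. ring.
Qed.

(* A primitive of [(s - 1) * u^(s-2) * sum_j b j * u^j]. *)
Definition mellin_prim (s : C) (b : nat -> R) (n : nat) (u : R) : C :=
  sum_n (fun j => (s - 1) * RtoC (b j) / (s + INR j - 1) * Cpow_pos u (s - 1 + INR j))%C n.

Lemma is_Rderive_mellin_prim (s : C) (b : nat -> R) (n : nat) (u : R) :
  0 < Re s -> s <> 1%C -> 0 < u ->
  is_Rderive (mellin_prim s b n) u (kern s (fun u => sum_f_R0 (fun j => b j * u ^ j) n) u).
Proof.
  intros Hs H1 Hu.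
  assert (T : forall j, is_Rderive
    (fun u => (s - 1) * RtoC (b j) / (s + INR j - 1) * Cpow_pos u (s - 1 + INR j))%C u
    ((s - 1) * Cpow_pos u (s - 2) * RtoC (b j * u ^ j))%C).
  { intros j. eapply is_Rderive_eq.
    - apply is_Rderive_mult; [apply is_Rderive_const | now apply is_Rderive_Cpow_pos].
    - cbv beta. rewrite Cpow_pos_plus, Cpow_pos_INR, Cpow_pos_pred, RtoC_inv, RtoC_mult by lra.
      field. split; [apply RtoC_neq_0; lra | now apply shifted_neq_0]. }
  unfold mellin_prim, kern. induction n as [|n IH].
  - apply is_Rderive_ext with
      (fun u => (s - 1) * RtoC (b O) / (s + INR 0 - 1) * Cpow_pos u (s - 1 + INR 0))%C.
    + intros x. now rewrite sum_O.
    + apply T.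
  - apply is_Rderive_ext with
      (fun u => sum_n (fun j => (s - 1) * RtoC (b j) / (s + INR j - 1)
          * Cpow_pos u (s - 1 + INR j)) n
        + (s - 1) * RtoC (b (S n)) / (s + INR (S n) - 1) * Cpow_pos u (s - 1 + INR (S n)))%C.
    + intros x. now rewrite sum_Sn.
    + eapply is_Rderive_eq; [apply is_Rderive_plus; [apply IH | apply T]|].
      cbv beta. rewrite tech5, RtoC_plus. ring.
Qed.

(** When [b O = 1], the term [j = 0] is exactly [u^(s-1)], the only one that may fail to vanish at 0
    when [Re s <= 1]. *)
Lemma mellin_prim_at_0 (s : C) (b : nat -> R) (n : nat) : 0 < Re s -> s <> 1%C -> b O = 1 ->
  exists K, 0 <= K /\ forall u, 0 < u <= 1 ->
    Cmod (mellin_prim s b n u - Cpow_pos u (s - 1)) <= K * Rpower u (Re s).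
Proof.
  intros Hs H1 Hb. unfold mellin_prim. induction n as [|n [K [HK IH]]].
  - exists 0. split; [lra|]. intros u Hu. rewrite sum_O, Hb.
    replace (s - 1 + INR 0)%C with (s - 1)%C by (simpl INR; ring).
    replace (_ - _)%C with (RtoC 0); [rewrite Cmod_0; lra|].
    simpl INR. field. now apply Cminus_1_neq_0.
  - set (c := ((s - 1) * RtoC (b (S n)) / (s + INR (S n) - 1))%C).
    pose proof (Cmod_ge_0 c) as Hc.
    exists (K + Cmod c). split; [lra|]. intros u Hu. rewrite sum_Sn.
    set (S0 := sum_n _ n) in *. specialize (IH u Hu). fold S0 in IH.
    change plus with Cplus. fold c.
    replace (S0 + c * Cpow_pos u (s - 1 + INR (S n)) - Cpow_pos u (s - 1))%C with
      ((S0 - Cpow_pos u (s - 1)) + c * Cpow_pos u (s - 1 + INR (S n)))%C by ring.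
    eapply Rle_trans; [apply Cmod_triangle|]. rewrite Rmult_plus_distr_r.
    apply Rplus_le_compat; [exact IH|]. rewrite Cmod_mult, Cmod_Cpow_Rpower.
    apply Rmult_le_compat_l; auto.
    change (Re (s - 1 + INR (S n))) with (Re s + - (1) + INR (S n)).
    replace (Re s + - (1) + INR (S n)) with (Re s + INR n) by (rewrite S_INR; ring).
    rewrite Rpower_plus.
    assert (Rpower u (INR n) <= 1) by (apply Rpower_le_1; [auto | apply pos_INR]).
    pose proof (Rpower_pos u (Re s)). nra.
Qed.

Lemma ex_derive_poly (b : nat -> R) (n : nat) (u : R) :
  ex_derive (fun u => sum_f_R0 (fun j => b j * u ^ j) n) u.
Proof.
  induction n as [|n IH].
  - simpl. auto_derive; auto.
  - apply (ex_derive_plus (fun u => sum_f_R0 (fun j => b j * u ^ j) n)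
      (fun u => b (S n) * u ^ S n)); [apply IH | auto_derive; auto].
Qed.

Lemma interpolation (d eta b th : R) : d <= eta -> d <= b -> 0 < eta -> 0 < b ->
  0 <= th <= 1 -> d <= Rpower eta th * Rpower b (1 - th).
Proof.
  intros H1 H2 He Hb Ht.
  pose proof (Rpower_pos eta th). pose proof (Rpower_pos b (1 - th)).
  destruct (Rle_lt_dec eta b) as [L|L].
  - apply Rle_trans with (Rpower eta th * Rpower eta (1 - th)).
    + rewrite <- Rpower_plus. replace (th + (1 - th)) with 1 by ring. now rewrite Rpower_1.
    + apply Rmult_le_compat_l; [lra|]. apply Rle_Rpower_l; lra.
  - apply Rle_trans with (Rpower b th * Rpower b (1 - th)).
    + rewrite <- Rpower_plus. replace (th + (1 - th)) with 1 by ring. now rewrite Rpower_1.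
    + apply Rmult_le_compat_r; [lra|]. apply Rle_Rpower_l; lra.
Qed.

(** A weighted geometric mean of the two bounds keeps a positive power of the small [eta] and still
    an integrable profile in [u]. Since [th <= 1 / 2], at least half of the exponential rate
    survives, hence 1/8. *)
Lemma interpolation_exp (d eta u th : R) : d <= eta -> d <= 2 * u * exp (- (u / 4)) ->
  0 < eta -> 0 < u -> 0 <= th <= 1 / 2 ->
  d <= 2 * Rpower eta th * Rpower u (1 - th) * exp (- (1 / 8 * u)).
Proof.
  intros H1 H2 He Hu Ht. pose proof (exp_pos (- (u / 4))) as Hp.
  assert (Hb : 0 < 2 * u * exp (- (u / 4))) by (repeat apply Rmult_lt_0_compat; lra).
  eapply Rle_trans; [apply (interpolation d eta _ th H1 H2 He Hb); lra|].
  rewrite <- !Rpower_mult_distr by (try lra; repeat apply Rmult_lt_0_compat; lra).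
  pose proof (Rpower_pos eta th) as P1. pose proof (Rpower_pos u (1 - th)) as P2.
  assert (Q1 : Rpower 2 (1 - th) <= 2).
  { rewrite <- (Rpower_1 2) at 2 by lra. apply Rle_Rpower; lra. }
  assert (Q2 : Rpower (exp (- (u / 4))) (1 - th) <= exp (- (1 / 8 * u))).
  { unfold Rpower. rewrite ln_exp. apply exp_le. nra. }
  pose proof (Rpower_pos 2 (1 - th)). pose proof (Rpower_pos (exp (- (u / 4))) (1 - th)).
  replace (2 * Rpower eta th * Rpower u (1 - th) * exp (- (1 / 8 * u))) with
    (Rpower eta th * (2 * Rpower u (1 - th) * exp (- (1 / 8 * u)))) by ring.
  apply Rmult_le_compat_l; [lra|]. apply Rmult_le_compat; try nra.
Qed.

Lemma kint_bound (s : C) (u Mc : R) : 0 < u -> Cmod (s - 1) <= Mc ->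
  Cmod (kint s u) <= (2 * Mc + 1) * (Rpower u (Re s - 1) * exp (- (1 / 8 * u))).
Proof.
  intros Hu HM. unfold kint. eapply Rle_trans; [apply Cmod_triangle|].
  assert (E1 : exp (- (1 / 4 * u)) <= exp (- (1 / 8 * u))) by (apply exp_le; lra).
  assert (E2 : exp (- u) <= exp (- (1 / 8 * u))) by (apply exp_le; lra).
  pose proof (Rpower_pos u (Re s - 1)) as P. pose proof (exp_pos (- (1 / 4 * u))) as P1.
  pose proof (Cmod_ge_0 (s - 1)) as P2.
  rewrite Rmult_plus_distr_r. apply Rplus_le_compat.
  - eapply Rle_trans; [apply (Cmod_kern_le s bern_gap u 0 (1 / 4) 2); [auto | lra |]|].
    + rewrite Rminus_0_r, Rpower_1 by auto. replace (1 / 4 * u) with (u / 4) by field.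
      now apply bern_gap_bound.
    + rewrite Rminus_0_r. apply Rmult_le_compat; try nra.
  - rewrite Cmod_mult, Cmod_Cpow_Rpower, Cmod_R, Rabs_right
      by (apply Rle_ge; left; apply exp_pos).
    change (Re (s - 1)) with (Re s - 1). nra.
Qed.

Lemma ex_Rderive_kint (s : C) (u : R) : 0 < u -> ex_Rderive (kint s) u.
Proof.
  intros Hu. apply ex_Rderive_plus.
  - apply ex_Rderive_kern; auto. now apply ex_derive_bern_gap.
  - apply ex_Rderive_mult; [now apply ex_Rderive_Cpow_pos|].
    apply ex_Rderive_RtoC. auto_derive; auto.
Qed.

Definition scaled_coef (B : nat -> R) (m j : nat) : R :=
  coef m j * B j / harmonic m ^ j.

Lemma scaled_coef_poly (B : nat -> R) (m : nat) (u : R) : 0 < harmonic m ->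
  sum_f_R0 (fun j => scaled_coef B m j * u ^ j) m = bern_poly B m (u / harmonic m).
Proof.
  intros Hh. apply sum_eq. intros j _. unfold scaled_coef, Rdiv.
  rewrite Rpow_mult_distr, pow_inv. ring.
Qed.

(** At the endpoint [u = h] the powers [h ^ j] cancel the scaling in [scaled_coef], which makes the
    scaled [F_m] a value of a primitive. *)
Lemma mellin_prim_harmonic (a : nat -> nat -> R) (B : nat -> R) (m : nat) (s : C) :
  p_coefficients a -> 0 < harmonic m -> 0 < Re s -> s <> 1%C ->
  mellin_prim s (scaled_coef B m) m (harmonic m)
  = (Cpow_pos (harmonic m) (s - 1) * ((s - 1) * F a B m s))%C.
Proof.
  intros Ha Hh Hs H1. unfold mellin_prim, F.
  transitivity (sum_n (fun j => mult (Cpow_pos (harmonic m) (s - 1) * (s - 1))%C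
    (RtoC (a m j * B j) / (s + INR j - 1))%C) m).
  - apply sum_n_ext_loc. intros j Hj. rewrite (p_coefficients_unique a m j Ha Hj).
    rewrite Cpow_pos_plus, Cpow_pos_INR by auto. unfold scaled_coef.
    assert (harmonic m ^ j <> 0) by (apply pow_nonzero; lra).
    rewrite RtoC_div by auto. change mult with Cmult.
    match goal with |- ?x = ?y => change (@eq C x y) end. field.
    split; [now apply shifted_neq_0 | now apply RtoC_neq_0].
  - rewrite (sum_n_mult_l (K := C_Ring)). symmetry. apply Cmult_assoc.
Qed.

Lemma bernoulli_0 (B : nat -> R) : bernoulli_numbers B -> B O = 1.
Proof.
  intros HB. pose proof (bernoulli_p B 0 HB) as H. simpl in H. rewrite Rinv_1 in H. lra.
Qed.

Lemma scaled_coef_0 (B : nat -> R) (m : nat) : bernoulli_numbers B -> scaled_coef B m 0 = 1.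
Proof.
  intros HB. unfold scaled_coef. rewrite coef_0, bernoulli_0 by auto. simpl. field.
Qed.

(** The three errors are the boundary term [h^(s-1) * exp (- h)], the integral of the kernel against
    [G_m (u / h) - g u] over [(0, h)], and the tail of [kint] beyond [h]. *)
Lemma scaled_F_distance (a : nat -> nat -> R) (B : nat -> R) (m : nat) (s : C) (eta th M Mc : R) :
  p_coefficients a -> bernoulli_numbers B ->
  0 < Re s -> s <> 1%C -> Cmod (s - 1) <= Mc ->
  0 < th <= 1 / 2 -> 0 <= M -> 0 < eta -> 1 <= harmonic m ->
  (forall u, 0 < u -> Rpower u (Re s - 1) * exp (- (1 / 8 * u)) <= M * dom th u) ->
  (forall u, 0 < u -> Rpower u (Re s - th - 1) * exp (- (1 / 8 * u)) <= M * dom th u) ->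
  (forall u, 0 < u <= harmonic m ->
    Rabs (bern_poly B m (u / harmonic m) - bern_gf u) <= eta) ->
  Cmod (Cpow_pos (harmonic m) (s - 1) * ((s - 1) * F a B m s) - (s - 1) * Gamma s * zeta s)
  <= M * Rpower (harmonic m) (- th) + 4 * (Mc * M * / th) * Rpower eta th
     + 2 * ((2 * Mc + 1) * M * / th) * Rpower (harmonic m) (- th).
Proof.
  intros Ha HB Hs H1 HMc Hth HM Heta Hh D1 D2 Hu.
  set (h := harmonic m) in *. set (L := ((s - 1) * Gamma s * zeta s)%C).
  pose proof (Cmod_ge_0 (s - 1)) as Hc0.
  assert (Hit : 0 < / th) by (apply Rinv_0_lt_compat; lra).
  set (w := fun u => bern_poly B m (u / h) - bern_gf u).
  (* [Lam u] plays the integral of [kern s w + kint s] over [(0, u)]: it has that derivative ([DL])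
     and vanishes at 0 ([BL]). *)
  set (Lam := fun u => (mellin_prim s (scaled_coef B m) m u
    - Cpow_pos u (s - 1) * RtoC (exp (- u)))%C).
  assert (DG : forall u, 0 < u -> ex_derive (fun u => bern_poly B m (u / h)) u).
  { intros u Hu0. apply (ex_derive_ext (fun u => sum_f_R0 (fun j => scaled_coef B m j * u ^ j) m)).
    - intros t. apply scaled_coef_poly. fold h. lra.
    - apply ex_derive_poly. }
  assert (Dw : forall u, 0 < u -> ex_derive w u).
  { intros u Hu0. apply (ex_derive_minus (fun u => bern_poly B m (u / h)) bern_gf); auto.
    now apply ex_derive_bern_gf. }
  assert (DL : forall u, 0 < u -> is_Rderive Lam u (kern s w u + kint s u)%C).
  { intros u Hu0. unfold Lam. eapply is_Rderive_eq.
    - apply is_Rderive_plus; [now apply is_Rderive_mellin_prim|].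
      apply is_Rderive_opp, is_Rderive_mult; [now apply is_Rderive_Cpow_pred|].
      apply is_Rderive_RtoC with (l := - exp (- u)). auto_derive; auto. ring.
    - unfold kint, kern, w, bern_gap. rewrite scaled_coef_poly by (fold h; lra). fold h.
      rewrite !RtoC_minus, RtoC_opp. ring. }
  assert (Ex : forall u, 0 < u -> ex_Rderive (fun u => kern s w u + kint s u)%C u).
  { intros u Hu0. apply ex_Rderive_plus; [|now apply ex_Rderive_kint].
    apply ex_Rderive_kern; auto. }
  assert (Lh : (Cpow_pos h (s - 1) * ((s - 1) * F a B m s)
    = Lam h + Cpow_pos h (s - 1) * RtoC (exp (- h)))%C).
  { unfold Lam, h. rewrite (mellin_prim_harmonic a) by (auto; fold h; lra). ring. }
  rewrite Lh.
  assert (Bw : forall u, 0 < u <= h ->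
    Cmod (kern s w u) <= 2 * (Mc * M) * Rpower eta th * dom th u).
  { intros u Hu0. pose proof (Rpower_pos eta th) as P1.
    assert (Hx : 0 <= u / h <= 1).
    { split; [apply Rdiv_le_0_compat; lra|]. apply Rmult_le_reg_r with h; [lra|].
      unfold Rdiv. rewrite Rmult_assoc, Rinv_l by lra. lra. }
    assert (W : Rabs (w u) <= 2 * Rpower eta th * Rpower u (1 - th) * exp (- (1 / 8 * u))).
    { apply interpolation_exp; try lra; [now apply Hu|].
      apply sandwich_diff; [lra | | apply bern_gf_bounds; lra].
      pose proof (bern_poly_bounds B m (u / h) HB Hx) as Bb. fold h in Bb.
      replace (u / h * h) with u in Bb by (field; lra). exact Bb. }
    eapply Rle_trans; [apply (Cmod_kern_le s w u th (1 / 8) (2 * Rpower eta th)); [lra | lra | exact W]|].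
    replace (2 * (Mc * M) * Rpower eta th * dom th u) with
      (Mc * (2 * Rpower eta th) * (M * dom th u)) by ring.
    apply Rmult_le_compat; [nra | | nra | apply D2; lra].
    apply Rmult_le_pos; [left; apply Rpower_pos | left; apply exp_pos]. }
  assert (Bk : forall u, 0 < u -> Cmod (kint s u) <= (2 * Mc + 1) * M * dom th u).
  { intros u Hu0. eapply Rle_trans; [now apply (kint_bound s u Mc)|].
    rewrite Rmult_assoc. apply Rmult_le_compat_l; [lra | now apply D1]. }
  assert (Bh : Cmod (Cpow_pos h (s - 1) * RtoC (exp (- h))) <= M * Rpower h (- th)).
  { rewrite Cmod_mult, Cmod_Cpow_Rpower, Cmod_R, Rabs_right
      by (apply Rle_ge; left; apply exp_pos).
    change (Re (s - 1)) with (Re s - 1).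
    assert (exp (- h) <= exp (- (1 / 8 * h))) by (apply exp_le; lra).
    pose proof (Rpower_pos h (Re s - 1)). specialize (D1 h ltac:(lra)).
    destruct (dom_mult_le th h) as [_ Q]; [lra|].
    assert (0 < dom th h).
    { unfold dom. pose proof (Rpower_pos h th).
      apply Rdiv_lt_0_compat; auto. apply Rmult_lt_0_compat; [lra|]. apply pow_lt; lra. }
    assert (dom th h <= Rpower h (- th)) by nra.
    apply Rle_trans with (M * dom th h); [nra | now apply Rmult_le_compat_l]. }
  (* [K] may depend on [m] and [s]: it serves only at the cut [x], chosen afterwards, and is absent
     from the final bound. *)
  destruct (mellin_prim_at_0 s (scaled_coef B m) m Hs H1 (scaled_coef_0 B m HB)) as [K [HK PK]].
  assert (BL : forall u, 0 < u <= 1 -> Cmod (Lam u) <= (K + 1) * Rpower u (Re s)).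
  { intros u Hu0. unfold Lam.
    replace (_ - _)%C with ((mellin_prim s (scaled_coef B m) m u - Cpow_pos u (s - 1))
      + Cpow_pos u (s - 1) * (1 - RtoC (exp (- u))))%C by ring.
    eapply Rle_trans; [apply Cmod_triangle|]. rewrite Rmult_plus_distr_r.
    apply Rplus_le_compat; [now apply PK|].
    rewrite Cmod_mult, Cmod_Cpow_Rpower, <- RtoC_minus, Cmod_R.
    change (Re (s - 1)) with (Re s - 1).
    assert (exp (- u) <= 1) by (rewrite <- exp_0; apply exp_le; lra).
    pose proof (exp_ge (- u)). rewrite Rabs_right by lra.
    replace (Rpower u (Re s)) with (Rpower u (Re s - 1) * u).
    - pose proof (Rpower_pos u (Re s - 1)). nra.
    - rewrite <- (Rpower_1 u) at 2 by lra. rewrite <- Rpower_plus. f_equal. ring. }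
  (* Integrals are cut at [x] near 0 and at [y] beyond [h]; [Lam x] and the truncation of the limit
     integral cost [eps / 2] each. *)
  apply le_epsilon. intros eps He.
  destruct (zeta_improper s Hs H1 (eps / 2)) as [d [A [Hd [HA P]]]]; [lra|].
  destruct (Rpower_small (Re s) (eps / (2 * (K + 1))) Hs) as [d' [Hd' P']].
  { apply Rdiv_lt_0_compat; lra. }
  set (x := Rmin (Rmin d d') 1 / 2).
  assert (Hx : 0 < x /\ x < d /\ x < d' /\ x < 1).
  { pose proof (Rmin_l (Rmin d d') 1). pose proof (Rmin_r (Rmin d d') 1).
    pose proof (Rmin_l d d'). pose proof (Rmin_r d d').
    assert (0 < Rmin (Rmin d d') 1) by (repeat apply Rmin_glb_lt; lra). unfold x. lra. }
  set (y := Rmax A h + 1).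
  assert (Hy : A < y /\ h < y)
    by (pose proof (Rmax_l A h); pose proof (Rmax_r A h); unfold y; lra).
  destruct (P x y) as [z [Hz1 Hz2]]; [lra | lra |].
  change (is_CInt (kint s) x y z) in Hz1. fold L in Hz2.
  destruct (ex_CInt (kint s) x h) as [z1 Z1]; [lra | lra | apply ex_Rderive_kint |].
  destruct (ex_CInt (kint s) h y) as [z2 Z2]; [lra | lra | apply ex_Rderive_kint |].
  pose proof (is_CInt_unique _ _ _ _ _ Hz1 (is_CInt_Chasles _ _ _ _ _ _ Z1 Z2)) as Ez.
  assert (I1 : is_CInt (fun u => kern s w u + kint s u)%C x h (Lam h - Lam x)%C).
  { apply is_CInt_derive; [lra | |]; intros u Hu0; [apply DL | apply Ex]; lra. }
  assert (I2 : is_CInt (kern s w) x h (Lam h - Lam x - z1)%C).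
  { eapply is_CInt_ext; [| |apply (is_CInt_minus _ _ _ _ _ _ I1 Z1)]; [lra|].
    intros u Hu0. cbv beta. ring. }
  assert (N1 : Cmod (Lam h - Lam x - z1) <= 2 * (2 * (Mc * M) * Rpower eta th * / th)).
  { eapply Rle_trans.
    - apply (is_CInt_bound _ _ x h _ _ ltac:(lra) I2
        (is_RInt_dom th (2 * (Mc * M) * Rpower eta th) x h ltac:(lra) ltac:(lra))).
      intros u Hu0. apply Bw. lra.
    - apply Rmult_le_compat_l; [lra|]. apply Rmult_le_compat_l.
      + apply Rmult_le_pos; [|left; apply Rpower_pos]. nra.
      + destruct (dom_int_bounds th h ltac:(lra) ltac:(lra)) as [Q1 _].
        destruct (dom_int_bounds th x ltac:(lra) ltac:(lra)) as [Q2 _]. lra. }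
  assert (N2 : Cmod z2 <= 2 * ((2 * Mc + 1) * M * (/ th * Rpower h (- th)))).
  { eapply Rle_trans.
    - apply (is_CInt_bound _ _ h y _ _ ltac:(lra) Z2
        (is_RInt_dom th ((2 * Mc + 1) * M) h y ltac:(lra) ltac:(lra))).
      intros u Hu0. apply Bk. lra.
    - apply Rmult_le_compat_l; [lra|]. apply Rmult_le_compat_l.
      + apply Rmult_le_pos; lra.
      + destruct (dom_int_bounds th h ltac:(lra) ltac:(lra)) as [_ [_ Q1]].
        destruct (dom_int_bounds th y ltac:(lra) ltac:(lra)) as [Q2 _]. lra. }
  assert (N3 : Cmod (Lam x) <= eps / 2).
  { eapply Rle_trans; [apply BL; lra|]. specialize (P' x ltac:(lra)).
    apply Rle_trans with ((K + 1) * (eps / (2 * (K + 1)))); [|right; field; lra].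
    apply Rmult_le_compat_l; lra. }
  replace (Lam h + Cpow_pos h (s - 1) * RtoC (exp (- h)) - L)%C with
    ((Lam h - Lam x - z1) + (Cpow_pos h (s - 1) * RtoC (exp (- h)))
      + (Lam x + ((z - L) + - z2)))%C by (rewrite Ez; ring).
  eapply Rle_trans; [apply Cmod_triangle|].
  pose proof (Cmod_triangle (Lam h - Lam x - z1) (Cpow_pos h (s - 1) * RtoC (exp (- h)))).
  pose proof (Cmod_triangle (Lam x) ((z - L) + - z2)).
  pose proof (Cmod_triangle (z - L) (- z2)) as T3. rewrite Cmod_opp in T3. lra.
Qed.

(** With [th <= t / 2], [power_exp_dom] gives one [M] for the whole strip, so [C1] and [C2] depend
    neither on [m] nor on [s] and stay bounded as [s] approaches 1. *)
Lemma scaled_F_uniform_cvg (a : nat -> nat -> R) (B : nat -> R) (t K Mc eps : R) :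
  p_coefficients a -> bernoulli_numbers B -> 0 < t -> 0 <= Mc -> 0 < eps ->
  eventually (fun m => forall s : C, t <= Re s <= K -> Cmod (s - 1) <= Mc -> s <> 1%C ->
    Cmod (Cpow_pos (harmonic m) (s - 1) * ((s - 1) * F a B m s)
      - (s - 1) * Gamma s * zeta s) < eps).
Proof.
  intros Ha HB Ht HMc He. set (th := Rmin 1 t / 2).
  pose proof (Rmin_l 1 t) as R1. pose proof (Rmin_r 1 t) as R2.
  assert (R3 : 0 < Rmin 1 t) by (apply Rmin_glb_lt; lra).
  assert (Hth : 0 < th <= 1 / 2 /\ th <= t / 2) by (unfold th; lra).
  assert (Hit : 0 < / th) by (apply Rinv_0_lt_compat; lra).
  destruct (power_exp_dom th K (1 / 8) ltac:(lra) ltac:(lra)) as [M [HM P]].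
  set (C1 := M + 2 * ((2 * Mc + 1) * M * / th)). set (C2 := 4 * (Mc * M * / th)).
  assert (HC1 : 0 <= C1).
  { unfold C1. assert (0 <= (2 * Mc + 1) * M * / th); [|lra].
    repeat apply Rmult_le_pos; lra. }
  assert (HC2 : 0 <= C2).
  { unfold C2. assert (0 <= Mc * M * / th); [|lra]. repeat apply Rmult_le_pos; lra. }
  destruct (Rpower_opp_small th (eps / (2 * (C1 + 1)))) as [A [HA PA]]; [lra | |].
  { apply Rdiv_lt_0_compat; lra. }
  destruct (Rpower_small th (eps / (2 * (C2 + 1)))) as [d [Hd Pd]]; [lra | |].
  { apply Rdiv_lt_0_compat; lra. }
  assert (Hd2 : 0 < d / 2) by lra.
  generalize (filter_and _ _ (bern_poly_cvg B (d / 2) HB Hd2)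
    (filter_and _ _ (harmonic_eventually A) (harmonic_eventually 1))).
  apply filter_imp. intros m [U [HA' H1']] s Hs Hc H1.
  eapply Rle_lt_trans.
  - apply (scaled_F_distance a B m s (d / 2) th M Mc); auto; try lra.
    + intros u Hu. apply P; lra.
    + intros u Hu. apply P; lra.
  - specialize (PA (harmonic m) HA'). specialize (Pd (d / 2) ltac:(lra)).
    set (X := Rpower (harmonic m) (- th)) in *. set (Y := Rpower (d / 2) th) in *.
    replace (M * X + 4 * (Mc * M * / th) * Y + 2 * ((2 * Mc + 1) * M * / th) * X) with
      (C1 * X + C2 * Y) by (unfold C1, C2; ring).
    assert (0 < X /\ 0 < Y) by (split; apply Rpower_pos).
    set (e1 := eps / (2 * (C1 + 1))) in *. set (e2 := eps / (2 * (C2 + 1))) in *.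
    assert (E1 : (C1 + 1) * e1 = eps / 2) by (unfold e1; field; lra).
    assert (E2 : (C2 + 1) * e2 = eps / 2) by (unfold e2; field; lra).
    nra.
Qed.

(** The pole of [F_m] at 1 comes from [j = 0] alone, with residue [a m 0 * B 0 = 1]; for [j >= 1]
    the denominators stay at least 1/2 in modulus. [Q] depends on [m]. *)
Lemma scaled_F_near_1 (a : nat -> nat -> R) (B : nat -> R) (m : nat) :
  p_coefficients a -> bernoulli_numbers B ->
  exists Q, 0 <= Q /\ forall s : C, s <> 1%C -> Cmod (s - 1) <= 1 / 2 ->
    Cmod (Cpow_pos (harmonic m) (s - 1) * ((s - 1) * F a B m s) - 1) <= Q * Cmod (s - 1).
Proof.
  intros Ha HB.
  assert (HF : forall n, exists K, 0 <= K /\ forall s : C, s <> 1%C -> Cmod (s - 1) <= 1 / 2 ->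
    Cmod ((s - 1) * sum_n (fun j => RtoC (a m j * B j) / (s + INR j - 1))%C n - 1)
      <= K * Cmod (s - 1)).
  { assert (E0 : a m O * B O = 1).
    { rewrite (p_coefficients_unique a m 0 Ha) by lia. rewrite coef_0, bernoulli_0 by auto. ring. }
    induction n as [|n [K [HK IH]]].
    - exists 0. split; [lra|]. intros s H1 Hs. rewrite sum_O, E0.
      replace (_ - _)%C with (RtoC 0); [rewrite Cmod_0; lra|].
      simpl INR. field. now apply Cminus_1_neq_0.
    - set (c := RtoC (a m (S n) * B (S n))). pose proof (Cmod_ge_0 c) as Hc.
      exists (K + 2 * Cmod c). split; [lra|]. intros s H1 Hs. rewrite sum_Sn.
      specialize (IH s H1 Hs). set (S0 := sum_n _ n) in *. change plus with Cplus. fold c.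
      replace ((s - 1) * (S0 + c / (s + INR (S n) - 1)) - 1)%C with
        (((s - 1) * S0 - 1) + c * (/ (s + INR (S n) - 1)) * (s - 1))%C by (unfold Cdiv; ring).
      eapply Rle_trans; [apply Cmod_triangle|]. rewrite Rmult_plus_distr_r.
      apply Rplus_le_compat; [exact IH|]. rewrite !Cmod_mult.
      apply Rmult_le_compat_r; [apply Cmod_ge_0|]. rewrite Rmult_comm.
      apply Rmult_le_compat_r; auto.
      assert (Hd : 1 / 2 <= Cmod (s + INR (S n) - 1)).
      { eapply Rle_trans; [|apply re_le_Cmod]. eapply Rle_trans; [|apply Rle_abs].
        change (Re (s + INR (S n) - 1)) with (Re s + INR (S n) - 1).
        pose proof (re_le_Cmod (s - 1)) as Hr. apply Rabs_le_between in Hr.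
        change (Re (s - 1)) with (Re s - 1) in Hr. pose proof (INR_S_ge_1 n). lra. }
      rewrite Cmod_inv by (intros E; rewrite E, Cmod_0 in Hd; lra).
      replace 2 with (/ (1 / 2)) by field. apply Rinv_le_contravar; lra. }
  destruct (HF m) as [K [HK PK]].
  set (Lh := Rabs (ln (harmonic m))). pose proof (Rabs_pos (ln (harmonic m)) : 0 <= Lh) as HL.
  pose proof (exp_pos Lh) as HeL.
  exists (2 * (Lh * exp Lh) * (1 + K) + K).
  split. { assert (0 <= Lh * exp Lh) by nra. nra. }
  intros s H1 Hs. specialize (PK s H1 Hs). fold (F a B m s) in PK.
  set (Y := ((s - 1) * F a B m s)%C) in *. set (X := Cpow_pos (harmonic m) (s - 1)).
  pose proof (Cmod_ge_0 (s - 1)) as Hd.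
  assert (HX : Cmod (X - 1) <= 2 * (Lh * exp Lh) * Cmod (s - 1)).
  { unfold X, Cpow_pos. eapply Rle_trans; [apply Cexp_taylor0|].
    rewrite Cmod_mult, Cmod_R. fold Lh.
    assert (exp (Cmod (s - 1) * Lh) <= exp Lh) by (apply exp_le; nra).
    assert (0 <= Cmod (s - 1) * Lh) by nra. nra. }
  assert (HY : Cmod Y <= 1 + K).
  { replace Y with ((Y - 1) + 1)%C by ring. eapply Rle_trans; [apply Cmod_triangle|].
    rewrite Cmod_1. nra. }
  replace (X * Y - 1)%C with ((X - 1) * Y + (Y - 1))%C by ring.
  eapply Rle_trans; [apply Cmod_triangle|]. rewrite Cmod_mult.
  pose proof (Cmod_ge_0 (X - 1)). pose proof (Cmod_ge_0 Y).
  assert (Cmod (X - 1) * Cmod Y <= 2 * (Lh * exp Lh) * Cmod (s - 1) * (1 + K))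
    by (apply Rmult_le_compat; auto).
  lra.
Qed.

Lemma filterlim_at_1 (f : C -> C) :
  (forall eps, 0 < eps -> exists d, 0 < d /\ forall s : C, s <> 1%C -> Cmod (s - 1) < d ->
    Cmod (f s - 1) < eps) ->
  filterlim f (locally' (RtoC 1)) (locally (RtoC 1)).
Proof.
  intros H. apply filterlim_locally. intros eps.
  destruct (H eps (cond_pos eps)) as [d [Hd P]].
  (* Neighbourhoods in [C] are boxes; [Cmod_le_2] puts the box of half-side [d / 4] inside the disc
     of radius [d]. *)
  assert (Hd4 : 0 < d / 4) by lra.
  exists (mkposreal _ Hd4). intros s [S1 S2] Hs.
  change (Rabs (Re (s - 1)) < d / 4) in S1. change (Rabs (Im (s - 1)) < d / 4) in S2.
  assert (Hc : Cmod (f s - 1) < eps).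
  { apply P; auto. pose proof (Cmod_le_2 (s - 1) (d / 4)). lra. }
  split.
  - change (Rabs (Re (f s - 1)) < eps). eapply Rle_lt_trans; [apply re_le_Cmod | exact Hc].
  - change (Rabs (Im (f s - 1)) < eps). eapply Rle_lt_trans; [apply im_le_Cmod | exact Hc].
Qed.

Theorem theorem2 (a : nat -> nat -> R) (B : nat -> R)
  (ha : p_coefficients a) (hB : bernoulli_numbers B) :
  let lhs := fun (m : nat) (s : C) =>
    (Cpow_pos (harmonic m) (s - 1) * ((s - 1) * F a B m s))%C in
  let rhs := fun s : C => ((s - 1) * Gamma s * zeta s)%C in
  (forall m : nat, (1 <= m)%nat ->
     filterlim (lhs m) (locally' (RtoC 1)) (locally (RtoC 1))) /\
  filterlim rhs (locally' (RtoC 1)) (locally (RtoC 1)) /\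
  cvg_locally_uniformly half_plane
    (fun m => extend_at_1 (lhs m)) (extend_at_1 rhs).
Proof.
  intros lhs rhs. split; [|split].
  - intros m _. apply filterlim_at_1. intros eps He.
    destruct (scaled_F_near_1 a B m ha hB) as [Q [HQ P]].
    assert (He' : 0 < eps / (Q + 1)) by (apply Rdiv_lt_0_compat; lra).
    exists (Rmin (1 / 2) (eps / (Q + 1))). split; [apply Rmin_glb_lt; lra|].
    intros s H1 Hs.
    pose proof (Rmin_l (1 / 2) (eps / (Q + 1))). pose proof (Rmin_r (1 / 2) (eps / (Q + 1))).
    eapply Rle_lt_trans; [apply P; auto; lra|].
    assert ((Q + 1) * (eps / (Q + 1)) = eps) by (field; lra).
    pose proof (Cmod_ge_0 (s - 1)). nra.
  (* A single [m] is fixed for which [lhs m] is within [eps / 2] of [rhs] around 1; the limit of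
     that [lhs m] then gives the limit of [rhs]. *)
  - apply filterlim_at_1. intros eps He.
    destruct (scaled_F_uniform_cvg a B (1 / 2) 2 (1 / 2) (eps / 2) ha hB) as [m Hm]; try lra.
    specialize (Hm m (le_n m)).
    destruct (scaled_F_near_1 a B m ha hB) as [Q [HQ P]].
    assert (He' : 0 < eps / 2 / (Q + 1)) by (apply Rdiv_lt_0_compat; lra).
    exists (Rmin (1 / 2) (eps / 2 / (Q + 1))). split; [apply Rmin_glb_lt; lra|].
    intros s H1 Hs.
    pose proof (Rmin_l (1 / 2) (eps / 2 / (Q + 1))).
    pose proof (Rmin_r (1 / 2) (eps / 2 / (Q + 1))).
    pose proof (re_le_Cmod (s - 1)) as Hr. apply Rabs_le_between in Hr.
    change (Re (s - 1)) with (Re s - 1) in Hr.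
    specialize (Hm s ltac:(lra) ltac:(lra) H1). specialize (P s H1 ltac:(lra)).
    fold (lhs m s) in Hm, P. fold (rhs s) in Hm.
    replace (rhs s - 1)%C with ((lhs m s - 1) + - (lhs m s - rhs s))%C by ring.
    eapply Rle_lt_trans; [apply Cmod_triangle|]. rewrite Cmod_opp.
    assert ((Q + 1) * (eps / 2 / (Q + 1)) = eps / 2) by (field; lra).
    pose proof (Cmod_ge_0 (s - 1)). nra.
  - intros s0 Hs0. unfold half_plane in Hs0.
    (* This radius keeps the disc inside the strip from [Re s0 / 2] to [2 * Re s0], away from the
       boundary of the half-plane. *)
    assert (Hd : 0 < Re s0 / 2) by lra.
    exists (mkposreal _ Hd). intros eps.
    pose proof (Cmod_ge_0 (s0 - 1)) as Hm0.
    generalize (scaled_F_uniform_cvg a B (Re s0 / 2) (2 * Re s0) (Cmod (s0 - 1) + Re s0 / 2) eps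
      ha hB Hd ltac:(lra) (cond_pos eps)).
    apply filter_imp. intros m Hm s Hs Hd0. simpl in Hd0. unfold extend_at_1.
    destruct (Ceq_dec s (RtoC 1)) as [E|E].
    + replace (RtoC 1 - RtoC 1)%C with (RtoC 0) by ring. rewrite Cmod_0. apply cond_pos.
    + apply Hm; auto.
      * pose proof (re_le_Cmod (s - s0)) as Hr. apply Rabs_le_between in Hr.
        change (Re (s - s0)) with (Re s - Re s0) in Hr. unfold Re in *. lra.
      * replace (s - 1)%C with ((s - s0) + (s0 - 1))%C by ring.
        eapply Rle_trans; [apply Cmod_triangle|]. unfold Re in *. lra.
Qed.
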